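(* Let $n>2$ be an even integer, let $m\ge1$, and let $T$ be the operator and $C$ the matrix defined in the context, with $\mu_1<\mu_2<\dots<\mu_s$ the distinct real eigenvalues of $C$. If $C$ has at least three real eigenvalues $\mu_{j_1},\mu_{j_2},\mu_{j_3}$ (distinct) of odd multiplicity such that $$\min_{i_1,i_2,i_3\in\{1,2,\dots,s\}}\operatorname{diam}\left(\{\mu_{j_1}+\mu_{i_1},\ \mu_{j_2}+\mu_{i_2},\ \mu_{j_3}+\mu_{i_3}\}\right)\ne0,$$ where $\operatorname{diam}(E)=\sup_{x,y\in E}|x-y|$, then there exists a number $H$ such that $[H,\infty)\subset\sigma(T)$.
   Context: Let $P_k=(p_{k,i,j})$, $k=2,\dots,n$, be $m\times m$ matrix functions with complex-valued PT-symmetric periodic entries: $p_{k,i,j}(x+1)=p_{k,i,j}(x)$, $p_{k,i,j}(-x)=\overline{p_{k,i,j}(x)}$, $p_{k,i,j}\in L_2[0,1]$. $T$ is the operator generated in $L_2^m(-\infty,\infty)$ (the $L_2$ space of $\mathbb{C}^m$-valued functions on $\mathbb{R}$) by the differential expression $$(-i)^ny^{(n)}+(-i)^{n-2}P_2y^{(n-2)}+(-i)^{n-3}P_3y^{(n-3)}+\dots+P_ny$$ (domain: $y\in L_2^m(-\infty,\infty)$ with $y^{(n-1)}$ locally absolutely continuous and the expression in $L_2^m(-\infty,\infty)$). It is well known that $\sigma(T)=\bigcup_{t\in[0,2\pi)}\sigma(T_t)$, where $T_t$ is generated in $L_2^m[0,1]$ by the same expression and the boundary conditions $y^{(\nu)}(1)=e^{it}y^{(\nu)}(0)$,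 $\nu=0,\dots,n-1$, and has a spectrum consisting of eigenvalues. $C=\int_0^1P_2(x)\,dx$ (a matrix with real entries). Multiplicity of an eigenvalue of $C$ means algebraic multiplicity. *)

(* Defs.v *)
From HB Require Import structures.
From mathcomp Require Export all_boot all_order all_algebra.
From mathcomp Require Export all_classical all_reals all_analysis.
From mathcomp Require Export complex.
Import Order.TTheory GRing.Theory Num.Theory.
Import numFieldNormedType.Exports.

Set Implicit Arguments.
Unset Strict Implicit.
Unset Printing Implicit Defensive.

Local Open Scope classical_set_scope.
Local Open Scope ring_scope.
Local Open Scope complex_scope.

                                                                       
                       

Section Defs.
Context {R : realType}.
Implicit Types (D : set R) (m n k : nat).

Let leb := @lebesgue_measure R.

                                                                             
                                                                     
Definition L2on D (f : R -> R[i]) : Prop :=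
  [/\ measurable_fun D (fun x => complex.Re (f x)),
      measurable_fun D (fun x => complex.Im (f x)) &
      (\int[leb]_(x in D) ((ComplexField.Normc.normc (f x)) ^+ 2)%:E < +oo)%E].

Definition L2vec m (f : R -> 'cV[R[i]]_m) : Prop :=
  forall i, L2on setT (fun x => f x i ord0).

Definition vec_norm m (v : 'cV[R[i]]_m) : R :=
  Num.sqrt (\sum_i (ComplexField.Normc.normc (v i ord0)) ^+ 2).

Definition L2norm m (f : R -> 'cV[R[i]]_m) : \bar R :=
  Lnorm leb 2%:E (fun x => (vec_norm (f x))%:E).

Definition ae_equal m (f g : R -> 'cV[R[i]]_m) : Prop :=
  {ae leb, forall x, f x = g x}.

                                                                         
                                                                               
                                                                      
                                           
Definition resolvent_set m
    (A : (R -> 'cV[R[i]]_m) -> (R -> 'cV[R[i]]_m) -> Prop) : set R[i] :=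
  [set lambda |
    [/\ forall f, L2vec f ->
          exists y h, A y h /\ ae_equal (fun x => h x - lambda *: y x) f,
        forall y h, A y h ->
          ae_equal (fun x => h x - lambda *: y x) (fun=> 0) ->
          ae_equal y (fun=> 0) &
        exists M : R, forall y h, A y h ->
          (L2norm y <= M%:E * L2norm (fun x => (h x - lambda *: y x)%R))%E]].

Definition spectrum m
    (A : (R -> 'cV[R[i]]_m) -> (R -> 'cV[R[i]]_m) -> Prop) : set R[i] :=
  ~` resolvent_set A.

Definition abs_continuous_on (a b : R) (u : R -> R) : Prop :=
  forall eps : R, 0 < eps -> exists2 delta : R, 0 < delta &
    forall (N : nat) (c d : 'I_N -> R),
      (forall i, a <= c i /\ c i <= d i /\ d i <= b) ->
      trivIset setT (fun i => `]c i, d i[%classic) ->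
      \sum_i (d i - c i) < delta ->
      \sum_i `|u (d i) - u (c i)| < eps.

Definition loc_abs_continuous (u : R -> R) : Prop :=
  forall a b : R, a < b -> abs_continuous_on a b u.

                                                                       
                                                                
Definition real_regular n (u : R -> R) : Prop :=
  (forall k (x : R), (k < n.-1)%N -> derivable (derive1n k u) x 1) /\
  loc_abs_continuous (derive1n n.-1 u).

Definition vec_regular n m (y : R -> 'cV[R[i]]_m) : Prop :=
  forall i, real_regular n (fun x => complex.Re (y x i ord0)) /\
            real_regular n (fun x => complex.Im (y x i ord0)).

Definition vec_deriv m k (y : R -> 'cV[R[i]]_m) (x : R) : 'cV[R[i]]_m :=
  \col_i (derive1n k (fun t => complex.Re (y t i ord0)) x
          +i* derive1n k (fun t => complex.Im (y t i ord0)) x).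

Definition diff_expr n m (P : nat -> R -> 'M[R[i]]_m)
    (y : R -> 'cV[R[i]]_m) (x : R) : 'cV[R[i]]_m :=
  (0 -i* 1) ^+ n *: vec_deriv n y x
  + \sum_(2 <= k < n.+1)
      (0 -i* 1) ^+ (n - k) *: (P k x *m vec_deriv (n - k) y x).

                                                                             
                                                                        
                       
Definition operT n m (P : nat -> R -> 'M[R[i]]_m)
    (y h : R -> 'cV[R[i]]_m) : Prop :=
  [/\ L2vec y, vec_regular n y, L2vec h & ae_equal (diff_expr n P y) h].

                                                                       
                                               
Definition PT_periodic_L2 (p : R -> R[i]) : Prop :=
  [/\ {ae leb, forall x : R, p (x + 1) = p x},
      {ae leb, forall x : R, p (- x) = (p x)^*} &
      L2on `[0, 1] p].

Definition mean_matrix m (Q : R -> 'M[R[i]]_m) : 'M[R[i]]_m :=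
  \matrix_(i, j) ((\int[leb]_(x in `[0, 1]) complex.Re (Q x i j))%R
                  +i* (\int[leb]_(x in `[0, 1]) complex.Im (Q x i j))%R).

Definition alg_mult m (A : 'M[R[i]]_m) (z : R[i]) : nat := mup z (char_poly A).

Definition diam (E : set R) : R := sup [set `|x - y| | x in E & y in E].

                                               
                                                                              
                                                         
Definition min_diam (s : nat) (mu : 'I_s -> R) (j1 j2 j3 : 'I_s) : R :=
  let F (i : 'I_s * 'I_s * 'I_s) : R :=
    diam [set mu j1 + mu i.1.1; mu j2 + mu i.1.2; mu j3 + mu i.2] in
  F [arg min_(i < (j1, j2, j3)) F i]%O.

End Defs.

(* Main.v *)
From HB Require Import structures.
Require Import Defs.
From mathcomp Require Import fingroup perm measurable_realfun ring lra zify.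
Import Order.TTheory GRing.Theory Num.Theory.
Import numFieldNormedType.Exports.

(** The number r ^ n, with r large, belongs to the spectrum because for some real quasimomentum t
    near r the equation has approximate solutions that are sums of finitely many waves
    exp (i (t + 2 pi z) x), z an integer.

    Finite systems.  The symbol (t + 2 pi z) ^ n is close to r ^ n for two of these waves only, z = 0
    and z = - N with N the integer nearest to r / pi.  PT symmetry makes the Fourier coefficients of
    the entries of P real, so that the equation restricted to the waves |z| <= L has a real matrix,
    polynomial in t.  Such a matrix has a kernel for some t as soon as its determinant takes values of
    opposite signs (family_kernel).  Put t = r - u / (n r).  After division by r ^ (n - 2) the two
    resonant diagonal blocks are close to C - u and C - (S - u), where S = n r (2 r - 2 pi N).  The
    coupling between the two resonant waves is a Fourier coefficient of P 2 with a large index, hence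
    small, and outside resonance the symbol dominates the couplings (symbol_gap, column_sums,
    kernel_trivial).  If u crosses an eigenvalue mu j of odd multiplicity, det (C - u) changes its
    sign (odd_root_sign), while C - (S - u) stays invertible provided that S - mu j is away from
    all mu i.  The condition on the diameters says that, whatever S is, one of the three given indices
    has this property (gap_choice): otherwise three sums mu j + mu i, one for each of these j, would
    all be close to S.  Along the linear homotopy to the decoupled system the kernel remains trivial
    (galerkin_segment), so that the sign change passes to the full system
    (galerkin_solution_exists).  Cramer's rule gives C - v a lower bound proportional to 1 + |v|
    (resolvent_bound), which is needed since S may be as large as a multiple of r.

    From finite systems to the operator.  The entries are approximated in mean square by
    trigonometric polynomials with real coefficients (pt_approx), with bounds common to all good
    approximations (good_coefs_of_approximation).  A solution of the finite system has at least half
    of its mass in the two resonant waves, and its other components decay quadratically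
    (galerkin_mass), so that little is lost at the edge of the window |z| <= L (spill_bound).  Hence the
    sum of waves solves the original equation up to an error that is small, in mean square over a
    period, relative to the sum itself (residual_small).  Cutting off such sums over long
    intervals contradicts the existence of a bounded resolvent
    (spectrum_of_approximate_solutions). *)

Set Implicit Arguments.
Unset Strict Implicit.
Unset Printing Implicit Defensive.

Local Open Scope classical_set_scope.
Local Open Scope ring_scope.
Local Open Scope complex_scope.

(** * The entrywise norm and the resolvent of a real matrix *)

Section EntrywiseNorm.
Context {R : realType}.

Definition n1 p q (A : 'M[R]_(p, q)) : R := \sum_i \sum_j `|A i j|.

Lemma n1_ge0 p q (A : 'M[R]_(p, q)) : 0 <= n1 A.
Proof. by apply: sumr_ge0 => i _; apply: sumr_ge0. Qed.

Lemma n1_entry p q (A : 'M[R]_(p, q)) i j : `|A i j| <= n1 A.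
Proof.
rewrite /n1 (bigD1 i) //= (bigD1 j) //= -addrA lerDl addr_ge0 //.
  exact: sumr_ge0.
by apply: sumr_ge0 => k _; apply: sumr_ge0.
Qed.

Lemma n1_eq0 p q (A : 'M[R]_(p, q)) : n1 A = 0 -> A = 0.
Proof.
move=> A0; apply/matrixP => i j; rewrite mxE; apply/eqP.
by rewrite -normr_le0 -A0 n1_entry.
Qed.

Lemma n10 p q : n1 (0 : 'M[R]_(p, q)) = 0.
Proof. by rewrite /n1 big1 // => i _; rewrite big1 // => j _; rewrite mxE normr0. Qed.

Lemma n1D p q (A B : 'M[R]_(p, q)) : n1 (A + B) <= n1 A + n1 B.
Proof.
rewrite /n1 -big_split ler_sum //= => i _; rewrite -big_split ler_sum //= => j _.
by rewrite mxE ler_normD.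
Qed.

Lemma n1Z p q a (A : 'M[R]_(p, q)) : n1 (a *: A) = `|a| * n1 A.
Proof.
rewrite /n1 mulr_sumr; apply: eq_bigr => i _; rewrite mulr_sumr.
by apply: eq_bigr => j _; rewrite mxE normrM.
Qed.

Lemma n1N p q (A : 'M[R]_(p, q)) : n1 (- A) = n1 A.
Proof. by rewrite -scaleN1r n1Z normrN1 mul1r. Qed.

Lemma n1_sum p q (I : Type) (r : seq I) (Q : pred I) (F : I -> 'M[R]_(p, q)) :
  n1 (\sum_(i <- r | Q i) F i) <= \sum_(i <- r | Q i) n1 (F i).
Proof.
elim/big_ind2: _ => //; first by rewrite n10.
by move=> A x B y Ax By; rewrite (le_trans (n1D _ _)) // lerD.
Qed.

Lemma n1M p q r (A : 'M[R]_(p, q)) (B : 'M[R]_(q, r)) :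
  n1 (A *m B) <= n1 A * n1 B.
Proof.
rewrite {1 2}/n1 mulr_suml ler_sum // => i _.
have: \sum_j `|(A *m B) i j| <= \sum_j \sum_k `|A i k| * `|B k j|.
  apply: ler_sum => j _; rewrite mxE (le_trans (ler_norm_sum _ _ _)) //.
  by apply: ler_sum => k _; rewrite normrM.
move=> /le_trans; apply; rewrite exchange_big /= mulr_suml ler_sum // => k _.
rewrite -mulr_sumr ler_wpM2l // /n1 [leRHS](bigD1 k) //= lerDl.
by apply: sumr_ge0 => l _; apply: sumr_ge0.
Qed.

Lemma det_le n (A : 'M[R]_n) (K : R) :
  (forall i j, `|A i j| <= K) -> `|\det A| <= n`!%:R * K ^+ n.
Proof.
move=> AK; rewrite /determinant (le_trans (ler_norm_sum _ _ _)) //.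
rewrite -(card_Sn n) -sumr_const mulr_suml /= big_mkcond /=.
rewrite [leRHS]big_mkcond /= ler_sum // => s _; rewrite ?inE mul1r.
rewrite normrM normrX normrN1 expr1n mul1r normr_prod.
rewrite -[n in K ^+ n]card_ord -prodr_const ler_prod // => i _.
by rewrite normr_ge0 AK.
Qed.

End EntrywiseNorm.

Section ResolventBound.
Context {R : realType}.

(** Over the complex numbers p is a product of factors v - z. A real root stays at distance
    e from v by assumption, a nonreal one at the distance of its imaginary part. In both
    cases |v - z| is also comparable to |v| for large v, which gives one factor 1 + |v| per
    root. *)
Lemma monic_lower_bound (p : {poly R}) (e : R) : p \is monic -> 0 < e ->
  exists2 c : R, 0 < c & forall v, (forall z, root p z -> e <= `|v - z|) ->
    c * (1 + `|v|) ^+ (size p).-1 <= `|p.[v]|.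
Proof.
move=> pm e0; pose f := real_complex R.
have fi : injective f by exact: complexI.
have [r Dr] := closed_field_poly_normal (map_poly f p).
have lf : lead_coef (map_poly f p) = 1.
  by rewrite lead_coef_map (monicP pm) rmorph1.
move: Dr; rewrite lf scale1r => Dr.
have szr : (size p).-1 = size r.
  by rewrite -(size_map_poly f) Dr size_prod_XsubC.
have rootr z : z \in r -> forall x : R, z = f x -> root p x.
  move=> zr x zx; have : root (map_poly f p) z by rewrite Dr root_prod_XsubC.
  by rewrite zx fmorph_root.
pose N (z : R[i]) : R := ComplexField.Normc.normc z.
have factor z : z \in r -> exists2 c, 0 < c &
    forall v, (forall x, root p x -> e <= `|v - x|) -> c * (1 + `|v|) <= N (f v - z).
  move=> zr; case: (eqVneq (complex.Im z) 0) => [z0|z0].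
  - have zx : z = f (complex.Re z) by case: z z0 {zr} => a b /= ->.
    pose x := complex.Re z; have x0 : 0 < (1 + `|x|) / e + 1.
      by rewrite ltr_wpDl // divr_ge0 ?ltW // addr_ge0.
    exists ((1 + `|x|) / e + 1)^-1; first by rewrite invr_gt0.
    move=> v /(_ x (rootr _ zr _ zx)) ev.
    rewrite zx -/x -rmorphB /N /= expr0n addr0 sqrtr_sqr.
    rewrite mulrC ler_pdivrMr // mulrDr mulr1.
    have h : 1 + `|x| <= `|v - x| * ((1 + `|x|) / e).
      rewrite mulrA ler_pdivlMr // mulrC ler_wpM2r // addr_ge0 //.
    have := ler_normD (v - x) x; rewrite subrK; lra.
  - set y := `|complex.Im z|; pose x := complex.Re z.
    have y0 : 0 < y by rewrite normr_gt0.
    have c0 : 0 < (1 + `|x|) / y + 1.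
      by rewrite ltr_wpDl // divr_ge0 ?ltW // addr_ge0.
    exists ((1 + `|x|) / y + 1)^-1; first by rewrite invr_gt0.
    move=> v _; rewrite mulrC ler_pdivrMr // mulrDr mulr1.
    have Ny : y <= N (f v - z).
      rewrite /N /y; case: (z) => a b /=; rewrite add0r.
      by rewrite -sqrtr_sqr ler_sqrt ?addr_ge0 ?sqr_ge0 // sqrrN lerDr sqr_ge0.
    have Nx : `|v - x| <= N (f v - z).
      rewrite /N /x; case: (z) => a b /=; rewrite add0r.
      by rewrite -sqrtr_sqr ler_sqrt ?addr_ge0 ?sqr_ge0 // lerDl sqr_ge0.
    have h : 1 + `|x| <= N (f v - z) * ((1 + `|x|) / y).
      rewrite mulrA ler_pdivlMr // mulrC ler_wpM2r // addr_ge0 //.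
    have := ler_normD (v - x) x; rewrite subrK; lra.
have prodb : forall s : seq R[i], {subset s <= r} -> exists2 c, 0 < c &
    forall v, (forall x, root p x -> e <= `|v - x|) ->
    c * (1 + `|v|) ^+ size s <= N (\prod_(z <- s) (f v - z)).
  elim=> [_|z s IH sr].
    by exists 1 => // v _; rewrite big_nil mul1r /N /= expr1n expr0n addr0 sqrtr1.
  have [c c0 cP] := factor z (sr _ (mem_head _ _)).
  have [|d d0 dP] := IH; first by move=> y ys; apply: sr; rewrite inE ys orbT.
  exists (c * d) => [|v hv]; first by rewrite mulr_gt0.
  rewrite big_cons /N ComplexField.Normc.normcM exprS.
  have -> : c * d * ((1 + `|v|) * (1 + `|v|) ^+ size s)
          = (c * (1 + `|v|)) * (d * (1 + `|v|) ^+ size s) by ring.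
  have v1 : 0 <= 1 + `|v| by rewrite addr_ge0.
  apply: ler_pM; rewrite ?cP ?dP //; rewrite mulr_ge0 ?exprn_ge0 //; exact: ltW.
have [c c0 cP] := prodb r (fun _ h => h).
exists c => // v hv; rewrite szr (le_trans (cP v hv)) //.
have -> : \prod_(z <- r) (f v - z) = (map_poly f p).[f v].
  rewrite Dr horner_prod; apply: eq_bigr => z _; by rewrite !hornerE.
by rewrite horner_map /N /= expr0n addr0 sqrtr_sqr.
Qed.

(** Cramer's rule: the adjugate of C - v grows at most like the power m - 1 of 1 + |v|,
    while its determinant grows like the power m. The surplus factor 1 + |v| is what makes
    errors proportional to v harmless, however large v is. *)
Lemma resolvent_bound m (C : 'M[R]_m) (e : R) : 0 < e ->
  exists2 g : R, 0 < g &
    forall v, (forall z, root (char_poly C) z -> e <= `|v - z|) ->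
    forall x : 'cV[R]_m, g * (1 + `|v|) * n1 x <= n1 (C *m x - v *: x).
Proof.
move=> e0; case: m C => [|m] C.
  exists 1 => // v _ x; rewrite [x]flatmx0 n10 mulr0; exact: n1_ge0.
have [c c0 cP] := monic_lower_bound (char_poly_monic C) e0.
rewrite size_char_poly /= in cP.
pose K := n1 C + 1; have K0 : 0 < K by rewrite ltr_wpDl // n1_ge0.
pose D := m.+1%:R * m.+1%:R * (m`!%:R * K ^+ m).
have D0 : 0 < D by rewrite !mulr_gt0 ?ltr0n ?fact_gt0 ?exprn_gt0.
exists (c / D) => [|v hv x]; first by rewrite divr_gt0.
have v1 : 0 < 1 + `|v| by rewrite ltr_pwDl.
set A := C - v%:M.
have Ax : C *m x - v *: x = A *m x by rewrite mulmxBl mul_scalar_mx.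
have detA : `|\det A| = `|(char_poly C).[v]|.
  rewrite /char_poly -horner_evalE -det_map_mx.
  have -> : map_mx (horner_eval v) (char_poly_mx C) = - A.
    apply/matrixP => i j; rewrite !mxE /horner_eval !hornerE hornerMn hornerX opprB.
    by [].
  by rewrite -[- A]scaleN1r detZ normrM normrX normrN1 expr1n mul1r.
have nadj : n1 (\adj A) <= D * (1 + `|v|) ^+ m.
  have ent i j : `|(\adj A) i j| <= m`!%:R * (K * (1 + `|v|)) ^+ m.
    rewrite mxE /cofactor normrM normrX normrN1 expr1n mul1r.
    apply: det_le => k l; rewrite !mxE.
    have := n1_entry C (lift j k) (lift i l); rewrite /K => h.
    rewrite (le_trans (ler_normB _ _)) // mulrDl mul1r.
    have h2 : `|v *+ (lift j k == lift i l)| <= `|v|.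
      by case: (_ == _); rewrite ?mulr1n ?mulr0n ?normr0.
    apply: lerD; last by rewrite (le_trans h2) // lerDr.
    by rewrite (le_trans h) // ler_peMr ?n1_ge0 // lerDl.
  rewrite /n1 (le_trans (ler_sum _ (fun i _ => ler_sum _ (fun j _ => ent i j)))) //.
  rewrite !sumr_const !card_ord /D exprMn -[leLHS]mulr_natl -[X in _ * X <= _]mulr_natl.
  by rewrite -!mulrA.
have key : `|\det A| * n1 x <= D * (1 + `|v|) ^+ m * n1 (A *m x).
  rewrite -n1Z -mul_scalar_mx -mul_adj_mx -mulmxA (le_trans (n1M _ _)) //.
  by rewrite ler_wpM2r ?n1_ge0.
have {}key : c * (1 + `|v|) ^+ m.+1 * n1 x <= D * (1 + `|v|) ^+ m * n1 (A *m x).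
  by rewrite (le_trans _ key) // ler_wpM2r ?n1_ge0 // detA cP.
rewrite Ax -(ler_pM2l (exprn_gt0 m v1)) -(ler_pM2l D0).
apply: le_trans _ (le_trans key _); last by rewrite mulrA.
rewrite exprS le_eqVlt; apply/orP; left; apply/eqP.
by clearbody D; field; exact: lt0r_neq0.
Qed.

End ResolventBound.

Section DeterminantSign.
Context {R : realType}.

(** The determinant is a polynomial in the parameter without zeros between a and b, so that
    the intermediate value theorem for polynomials applies. *)
Lemma det_sign_path N (M : 'M[{poly R}]_N) (a b : R) : a <= b ->
  (forall s, a <= s <= b -> forall c : 'cV[R]_N,
     map_mx (horner_eval s) M *m c = 0 -> c = 0) ->
  0 < \det (map_mx (horner_eval a) M) * \det (map_mx (horner_eval b) M).
Proof.
move=> ab ker; pose q := \det M.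
have dE s : \det (map_mx (horner_eval s) M) = q.[s] by rewrite det_map_mx.
have q0 s : a <= s <= b -> q.[s] != 0.
  move=> sab; rewrite -dE -det_tr; apply/negP => /eqP d0.
  have /eqP/det0P [v v0] := d0.
  move=> /(congr1 trmx); rewrite trmx_mul trmxK trmx0 => /(ker s sab) /eqP.
  by rewrite trmx_eq0 (negbTE v0).
rewrite !dE ltNge; apply/negP => h.
have aab : a <= a <= b by rewrite lexx.
have bab : a <= b <= b by rewrite ab lexx.
have [qa|qa] := ltP 0 q.[a].
  have qb : q.[b] <= 0 by move: h; rewrite pmulr_rle0.
  have : (- q).[a] <= 0 <= (- q).[b] by rewrite !hornerN; lra.
  move=> /(poly_ivt ab) [x xab]; rewrite rootE hornerN oppr_eq0.
  by rewrite (negbTE (q0 _ xab)).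
have {}qa : q.[a] < 0 by rewrite lt_neqAle q0.
have qb : 0 <= q.[b] by move: h; rewrite nmulr_rle0.
have : q.[a] <= 0 <= q.[b] by rewrite ltW.
move=> /(poly_ivt ab) [x xab].
by rewrite rootE (negbTE (q0 _ xab)).
Qed.

End DeterminantSign.

(** * Sign changes of determinants of block families *)

Section BlockFamilies.
Context {R : realType} (I : finType) (m : nat) (p0 : I).

Definition kerfree (F : I -> I -> 'M[R]_m) : Prop :=
  forall c : I -> 'cV[R]_m, (forall k, \sum_l F k l *m c l = 0) ->
  forall k, c k = 0.

Let q := #|{: {k : I | k != p0} * 'I_m}|.

(** The indices are enumerated with the block p0 first: once this block is decoupled, the
    matrix is block triangular and its determinant splits. *)
Let sg (i : 'I_(m + q)) : I * 'I_m :=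
  match fintype.split i with
  | inl a => (p0, a)
  | inr r => let u := enum_val r in (val u.1, u.2)
  end.

Let sg_inj : injective sg.
Proof.
move=> i j; rewrite /sg -{2}(splitK i) -{2}(splitK j).
case: (fintype.split i) => [a|r]; case: (fintype.split j) => [b|s] /=.
- by case=> ->.
- by case=> e _; have := valP (enum_val s).1; rewrite /= -e eqxx.
- by case=> e _; have := valP (enum_val r).1; rewrite /= e eqxx.
- case=> e1 e2; congr rshift; apply: enum_val_inj.
  by move: (enum_val r) (enum_val s) e1 e2 => [x a] [y b] /= /val_inj -> ->.
Qed.

Let sg_bij : bijective sg.
Proof.
apply: inj_card_bij sg_inj _.
rewrite card_ord /q !card_prod !card_ord card_sig.
have -> : #|[pred k | k != p0]| = #|I|.-1.
  by rewrite -(cardC1 p0); apply: eq_card => k; rewrite !inE.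
have : (0 < #|I|)%N by apply/card_gt0P; exists p0.
by case: #|I| => // n _; rewrite /= mulSn.
Qed.

Definition flat_mx (T : nzRingType) (F : I -> I -> 'M[T]_m) : 'M[T]_(m + q) :=
  \matrix_(i, j) F (sg i).1 (sg j).1 (sg i).2 (sg j).2.

Let crd (c : 'cV[R]_(m + q)) (k : I) : 'cV[R]_m :=
  \col_a (if [pick i | sg i == (k, a)] is Some i then c i 0 else 0).

Let crdP c i : crd c (sg i).1 (sg i).2 0 = c i 0.
Proof.
rewrite /crd mxE -surjective_pairing; case: pickP => [j /eqP /sg_inj -> //|].
by move/(_ i); rewrite eqxx.
Qed.

Let sum_flat F c i :
  (flat_mx F *m c) i 0 = (\sum_l F (sg i).1 l *m crd c l) (sg i).2 0.
Proof.
rewrite mxE summxE; under [RHS]eq_bigr do rewrite mxE.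
rewrite pair_big /= (reindex sg) /=; last exact: onW_bij.
by apply: eq_bigr => j _; rewrite mxE crdP.
Qed.

Let flat_kernel (F : I -> I -> 'M[R]_m) (c : 'cV[R]_(m + q)) :
  flat_mx F *m c = 0 <-> forall k, \sum_l F k l *m crd c l = 0.
Proof.
have [g gK Kg] := sg_bij; split=> [Fc k|Fc].
  apply/colP => a; move: (sum_flat F c (g (k, a))).
  by rewrite Fc Kg /= !mxE => <-.
by apply/matrixP => i j; rewrite ord1 sum_flat Fc !mxE.
Qed.

Let kerfree_flat (F : I -> I -> 'M[R]_m) : kerfree F ->
  forall c : 'cV[R]_(m + q), flat_mx F *m c = 0 -> c = 0.
Proof.
move=> kF c /flat_kernel /kF c0; apply/matrixP => i j.
by rewrite ord1 -crdP c0 !mxE.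
Qed.

Definition segment (F G : I -> I -> 'M[R]_m) (s : R) (k l : I) : 'M[R]_m :=
  (1 - s) *: F k l + s *: G k l.

Let det_segment (F G : I -> I -> 'M[R]_m) :
  (forall s, 0 <= s <= 1 -> kerfree (segment F G s)) ->
  0 < \det (flat_mx F) * \det (flat_mx G).
Proof.
move=> kFG.
pose M : 'M[{poly R}]_(m + q) := \matrix_(i, j)
  ((1 - 'X) * (flat_mx F i j)%:P + 'X * (flat_mx G i j)%:P).
have ME s : map_mx (horner_eval s) M = flat_mx (segment F G s).
  by apply/matrixP => i j; rewrite !mxE /horner_eval !hornerE.
have M0 : map_mx (horner_eval 0) M = flat_mx F.
  rewrite ME; apply/matrixP => i j; rewrite !mxE /segment; by rewrite subr0 mul1r mul0r addr0.
have M1 : map_mx (horner_eval 1) M = flat_mx G.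
  rewrite ME; apply/matrixP => i j; rewrite !mxE /segment; by rewrite subrr mul1r mul0r add0r.
rewrite -M0 -M1; apply: det_sign_path => // s s01 c; rewrite ME.
exact/kerfree_flat/kFG.
Qed.

Let det_flat_split (F : I -> I -> 'M[R]_m) :
  (forall k, k != p0 -> F p0 k = 0 /\ F k p0 = 0) ->
  \det (flat_mx F) = \det (F p0 p0) * \det (drsubmx (flat_mx F)).
Proof.
move=> F0; rewrite -[in LHS](submxK (flat_mx F)).
have sl a : sg (lshift q a) = (p0, a) by rewrite /sg (unsplitK (inl a)).
have sr r : (sg (rshift m r)).1 != p0.
  by rewrite /sg (unsplitK (inr r)) /=; exact: valP (enum_val r).1.
have -> : ulsubmx (flat_mx F) = F p0 p0.
  by apply/matrixP => a b; rewrite !mxE !sl.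
have -> : ursubmx (flat_mx F) = 0.
  by apply/matrixP => a b; rewrite !mxE sl (F0 _ (sr b)).1 mxE.
have -> : dlsubmx (flat_mx F) = 0.
  by apply/matrixP => a b; rewrite !mxE sl (F0 _ (sr a)).2 mxE.
by rewrite det_ublock.
Qed.

(** If no Mt t had a kernel, the determinant would keep its sign between t1 and t2, as it
    does along the two segments, and X1, X2 would have determinants of the same sign. But X1
    and X2 agree outside the block p0, so that the product of their determinants is a square
    times the product of the two determinants of this block, which is negative. *)
Lemma family_kernel (M : I -> I -> 'M[{poly R}]_m) (t1 t2 : R)
    (X1 X2 : I -> I -> 'M[R]_m) :
  let Mt t k l := map_mx (horner_eval t) (M k l) in
  t1 <= t2 ->
  (forall k, k != p0 -> X1 p0 k = 0 /\ X1 k p0 = 0) ->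
  (forall k, k != p0 -> X2 p0 k = 0 /\ X2 k p0 = 0) ->
  (forall k l, k != p0 -> l != p0 -> X1 k l = X2 k l) ->
  \det (X1 p0 p0) * \det (X2 p0 p0) < 0 ->
  (forall s, 0 <= s <= 1 -> kerfree (segment (Mt t1) X1 s)) ->
  (forall s, 0 <= s <= 1 -> kerfree (segment (Mt t2) X2 s)) ->
  exists2 t, t1 <= t <= t2 & exists2 c : I -> 'cV[R]_m,
    (exists k, c k != 0) & forall k, \sum_l Mt t k l *m c l = 0.
Proof.
move=> Mt t12 X10 X20 X12 dX k1 k2.
apply/not_exists2P => noker.
have kM t : t1 <= t <= t2 -> kerfree (Mt t).
  move=> tt c cM k; apply: contrapT => /eqP ck.
  by case: (noker t) => // -[]; exists c => //; exists k.
have d1 := det_segment k1; have d2 := det_segment k2.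
have d12 : 0 < \det (flat_mx (Mt t1)) * \det (flat_mx (Mt t2)).
  pose Mf : 'M[{poly R}]_(m + q) := flat_mx M.
  have ME t : map_mx (horner_eval t) Mf = flat_mx (Mt t).
    by apply/matrixP => i j; rewrite !mxE.
  rewrite -!ME; apply: det_sign_path => // s s01 c; rewrite ME.
  exact/kerfree_flat/kM.
have : 0 < \det (flat_mx X1) * \det (flat_mx X2).
  move: d1 d2 d12.
  set a := \det _; set b := \det _; set a' := \det _; set b' := \det _ => ab ab' aa.
  have aa2 : 0 < (a * a') ^+ 2 by rewrite exprn_gt0.
  have : 0 < (a * a') ^+ 2 * (b * b').
    have -> : (a * a') ^+ 2 * (b * b') = (a * b) * (a' * b') * (a * a') by ring.
    by rewrite mulr_gt0 // mulr_gt0.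
  by rewrite pmulr_rgt0.
rewrite !det_flat_split //.
have -> : drsubmx (flat_mx X1) = drsubmx (flat_mx X2).
  have sr r : (sg (rshift m r)).1 != p0.
    by rewrite /sg (unsplitK (inr r)) /=; exact: valP (enum_val r).1.
  by apply/matrixP => i j; rewrite !mxE X12.
set d := \det (drsubmx _); rewrite ltNge => /negP; apply.
have -> : \det (X1 p0 p0) * d * (\det (X2 p0 p0) * d)
        = \det (X1 p0 p0) * \det (X2 p0 p0) * d ^+ 2 by ring.
by rewrite mulr_le0_ge0 ?sqr_ge0 // ltW.
Qed.

End BlockFamilies.

(** * Reduction to two resonant components *)

Section ResonantReduction.
Context {R : realType} (I : finType) (m : nat) (p0 p1 : I).
Variables (w h : I -> R) (b : I -> I -> R) (A : I -> I -> 'M[R]_m) (tau : R).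
Hypothesis p01 : p0 != p1.
Hypothesis w_gt0 : forall k, 0 < w k.
Hypothesis h_ge0 : forall k, 0 <= h k.
Hypothesis n1A : forall k l, n1 (A k l) <= b k l * w l.
Hypothesis col_sum : forall l,
  \sum_(k | (k != p0) && (k != p1)) h k * b k l <= tau.

Definition mass (c : I -> 'cV[R]_m) : R := \sum_k w k * n1 (c k).

(** What the row k of (d + A) c = 0 yields when d is a scalar of absolute value at least w k
    / h k. *)
Definition off_resonant (c : I -> 'cV[R]_m) : Prop :=
  forall k, k != p0 -> k != p1 ->
  w k * n1 (c k) <= h k * n1 (\sum_l A k l *m c l).

Lemma mass_split c : mass c = w p0 * n1 (c p0) + w p1 * n1 (c p1)
  + \sum_(k | (k != p0) && (k != p1)) w k * n1 (c k).
Proof. by rewrite /mass (bigD1 p0) //= (bigD1 p1) 1?eq_sym //= addrA. Qed.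

Lemma image_bound (Q : pred I) (c : I -> 'cV[R]_m) k :
  n1 (\sum_(l | Q l) A k l *m c l) <= \sum_(l | Q l) b k l * (w l * n1 (c l)).
Proof.
rewrite (le_trans (n1_sum _ _ _)) // ler_sum // => l _.
rewrite (le_trans (n1M _ _)) // mulrA ler_wpM2r ?n1_ge0 //.
Qed.

Lemma off_resonant_mass c : off_resonant c ->
  \sum_(k | (k != p0) && (k != p1)) w k * n1 (c k) <= tau * mass c.
Proof.
move=> cO; apply: (@le_trans _ _ (\sum_(k | (k != p0) && (k != p1))
    \sum_l (h k * b k l) * (w l * n1 (c l)))).
  apply: ler_sum => k /andP[k0 k1]; rewrite (le_trans (cO k k0 k1)) //.
  under [leRHS]eq_bigr do rewrite -mulrA.
  by rewrite -mulr_sumr ler_wpM2l // (le_trans (image_bound predT _ _)).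
rewrite exchange_big /= /mass mulr_sumr ler_sum // => l _.
by rewrite -mulr_suml ler_wpM2r // mulr_ge0 ?n1_ge0 // ltW.
Qed.

(** The part of the mass that lies outside the two resonant indices is at most half of it,
    and can be absorbed. *)
Lemma mass_le_resonant c : off_resonant c -> tau <= 2^-1 ->
  mass c <= 2 * (w p0 * n1 (c p0) + w p1 * n1 (c p1)).
Proof.
move=> cO t2; have := off_resonant_mass cO; have := mass_split c.
have m0 : 0 <= mass c.
  by apply: sumr_ge0 => k _; rewrite mulr_ge0 ?n1_ge0 // ltW.
have := ler_wpM2r m0 t2; lra.
Qed.

(** Each resonant row bounds one resonant component by eta times the other one plus the
    contribution of the remaining indices, which is tau times the mass and hence again a
    multiple of the resonant components. If all these factors stay below the lower bound g
    of the resonant blocks, both components vanish, and the mass with them. *)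
Lemma kernel_trivial (B W rr g eta : R) c :
  (forall k l, b k l <= B) -> tau <= 2^-1 -> 0 < rr ->
  w p0 <= W * rr -> w p1 <= W * rr ->
  n1 (A p0 p1) <= eta * rr -> n1 (A p1 p0) <= eta * rr ->
  eta + 4 * B * tau * W < g -> 0 <= tau -> 0 <= B ->
  off_resonant c ->
  g * rr * n1 (c p0) <= n1 (\sum_(l | l != p0) A p0 l *m c l) ->
  g * rr * n1 (c p1) <= n1 (\sum_(l | l != p1) A p1 l *m c l) ->
  forall k, c k = 0.
Proof.
move=> bB t2 rr0 w0 w1 e01 e10 small t0 B0 cO r0 r1.
set x0 := n1 (c p0) in r0 *; set x1 := n1 (c p1) in r1 *.
have x00 : 0 <= x0 by exact: n1_ge0.
have x10 : 0 <= x1 by exact: n1_ge0.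
have off := off_resonant_mass cO; have tot := mass_le_resonant cO t2.
set S := \sum_(k | _) _ in off.
have W0 : 0 <= W.
  by rewrite -(pmulr_lge0 _ rr0) (le_trans _ w0) // ltW.
have massW : mass c <= 2 * (W * rr) * (x0 + x1).
  rewrite (le_trans tot) // -mulrA ler_pM2l // mulrDr lerD // ler_wpM2r //.
have SB : B * S <= B * (tau * (2 * (W * rr) * (x0 + x1))).
  by rewrite ler_wpM2l // (le_trans off) // ler_wpM2l.
have other p o : p != o -> (forall k, (k != p) && (k != o) = (k != p0) && (k != p1)) ->
    n1 (A p o) <= eta * rr ->
    n1 (\sum_(l | l != p) A p l *m c l) <= eta * rr * n1 (c o) + B * S.
  move=> po eqp e; rewrite (bigD1 o) /= 1?eq_sym // (le_trans (n1D _ _)) //.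
  apply: lerD; first by rewrite (le_trans (n1M _ _)) // ler_wpM2r ?n1_ge0.
  rewrite (le_trans (image_bound _ _ _)) // /S mulr_sumr.
  rewrite (eq_bigl _ _ eqp) ler_sum // => l _.
  by rewrite ler_wpM2r // mulr_ge0 ?n1_ge0 // ltW.
have o0 := other p0 p1 p01 (fun _ => erefl) e01.
have o1 : n1 (\sum_(l | l != p1) A p1 l *m c l) <= eta * rr * x0 + B * S.
  by apply: other => //; rewrite 1?eq_sym // => k; rewrite andbC.
have fin : (g - (eta + 4 * B * tau * W)) * rr * (x0 + x1) <= 0.
  have E : B * (tau * (2 * (W * rr) * (x0 + x1))) = 2 * B * tau * W * rr * (x0 + x1) by ring.
  rewrite E in SB; move: (le_trans r0 o0) (le_trans r1 o1).
  have -> : (g - (eta + 4 * B * tau * W)) * rr * (x0 + x1)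
     = g * rr * x0 + g * rr * x1 - (eta * rr * x1 + eta * rr * x0)
       - 2 * (2 * B * tau * W * rr * (x0 + x1)) by ring.
  by rewrite -/x1; lra.
have x01 : x0 + x1 <= 0.
  by move: fin; rewrite pmulr_rle0 // mulr_gt0 // subr_gt0.
have m0 : mass c <= 0.
  rewrite (le_trans massW) // mulr_ge0_le0 // !mulr_ge0 //; exact: ltW.
have {m0} : mass c == 0.
  by rewrite eq_le m0 sumr_ge0 // => k _; rewrite mulr_ge0 ?n1_ge0 // ltW.
rewrite psumr_eq0 => [/allP c0 k|k _]; last by rewrite mulr_ge0 ?n1_ge0 // ltW.
have := c0 k (mem_index_enum _); rewrite /= mulf_eq0 gt_eqF //= => /eqP.
exact: n1_eq0.
Qed.

End ResonantReduction.

(** * Elementary estimates, roots of odd order and the diameter condition *)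

Section Estimates.
Context {R : realType}.

(** The estimate 1 / d ^ 2 <= 2 / d - 2 / (d + 1) telescopes on either side of j. *)
Lemma inv_square_sum (K j : nat) :
  \sum_(k < K | k != j :> nat) ((k%:R - j%:R : R) ^+ 2)^-1 <= 4.
Proof.
(* The partial sums are bounded by what telescoping leaves: before j the boundary term 2 /
   (j - K + 1), after j the total 4 minus a boundary term. *)
pose F K : R := if (K <= j)%N then 2 / (j%:R - K%:R + 1) else 4 - 2 / (K%:R - j%:R).
have FP : \sum_(k < K | k != j :> nat) ((k%:R - j%:R : R) ^+ 2)^-1 <= F K.
  elim: K => [|K IH].
    by rewrite big_ord0 /F leq0n subr0 divr_ge0 // addr_ge0.
  rewrite big_mkcond big_ord_recr -big_mkcond /=.
  have step d : 1 <= d -> (d ^+ 2)^-1 <= 2 / d - 2 / (d + 1) :> R.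
    move=> d1; have d0 : 0 < d by lra.
    have -> : 2 / d - 2 / (d + 1) = (2 / (d + 1)) / d by field; lra.
    rewrite expr2 invfM ler_wpM2r ?invr_ge0 //; first lra.
    rewrite ler_pdivlMr; last lra.
    rewrite mulrC ler_pdivrMr //; lra.
  case: (ltngtP K j) => Kj /=.
  - have -> : F K.+1 = F K + (2 / (j%:R - K%:R) - 2 / (j%:R - K%:R + 1)).
      rewrite /F Kj (ltnW Kj) -[K.+1%:R]natr1; have : (K%:R : R) < j%:R by rewrite ltr_nat.
      move=> h; field; lra.
    rewrite lerD // -sqrrN opprB step // lerBrDl natr1 ler_nat //.
  - have -> : F K.+1 = F K + (2 / (K%:R - j%:R) - 2 / (K%:R - j%:R + 1)).
      have f1 : (K.+1 <= j)%N = false by lia.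
      have f2 : (K <= j)%N = false by lia.
      rewrite /F f1 f2 -[K.+1%:R]natr1; have : (j%:R : R) < K%:R by rewrite ltr_nat.
      move=> h; field; lra.
    rewrite lerD // step // lerBrDl natr1 ler_nat //.
  - rewrite addr0 (le_trans IH) // /F Kj leqnn ltnn -[j.+1%:R]natr1.
    have -> : j%:R - j%:R + 1 = 1 :> R by ring.
    have -> : j%:R + 1 - j%:R = 1 :> R by ring.
    lra.
rewrite (le_trans FP) // /F; case: ifPn => Kj.
  have : (K%:R : R) <= j%:R by rewrite ler_nat.
  by move=> h; rewrite ler_pdivrMr; lra.
have : (j%:R : R) < K%:R by rewrite ltr_nat ltnNge.
by move=> h; rewrite gerBl divr_ge0 //; lra.
Qed.

Lemma pow_close (x : R) i : `|x| <= 2 -> `|x ^+ i - 1| <= 4 ^+ i * `|x - 1|.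
Proof.
move=> x2; elim: i => [|i IH]; first by rewrite !expr0 subrr normr0 mul1r.
have -> : x ^+ i.+1 - 1 = x * (x ^+ i - 1) + (x - 1) by rewrite exprS; ring.
rewrite (le_trans (ler_normD _ _)) // normrM exprS.
have h : `|x| * `|x ^+ i - 1| <= 2 * (4 ^+ i * `|x - 1|) by rewrite ler_pM.
have h4 : `|x - 1| <= 4 ^+ i * `|x - 1| by rewrite ler_peMl // exprn_ege1 // ler1n.
have u0 : 0 <= 4 ^+ i * `|x - 1| by rewrite mulr_ge0.
by rewrite -mulrA; move: h h4 u0; set u := 4 ^+ i * _; lra.
Qed.

Lemma pow_linear (x : R) n : `|x| <= 2 ->
  `|1 - x ^+ n - n%:R * (1 - x)| <= n%:R * 4 ^+ n * `|x - 1| ^+ 2.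
Proof.
move=> x2; rewrite -[X in X - x ^+ n](expr1n _ n) subrXX.
have -> : (1 - x) * \sum_(i < n) 1 ^+ (n.-1 - i) * x ^+ i - n%:R * (1 - x)
   = (1 - x) * \sum_(i < n) (x ^+ i - 1).
  rewrite sumrB sumr_const card_ord; under eq_bigr do rewrite expr1n mul1r.
  by set S := \sum_(i < n) _; ring.
rewrite normrM distrC expr2 [leRHS]mulrA mulrC ler_wpM2r //.
rewrite (le_trans (ler_norm_sum _ _ _)) //.
have bnd i : i \in 'I_n -> `|x ^+ i - 1| <= 4 ^+ n * `|x - 1|.
  move=> _; rewrite (le_trans (pow_close i x2)) // ler_wpM2r //.
  by rewrite ler_eXn2l ?ltr1n // ltnW.
rewrite (le_trans (ler_sum _ (fun i (_ : true) => bnd i isT))) //.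
by rewrite sumr_const card_ord -[leLHS]mulr_natl mulrA.
Qed.

(** For even n the quotient of x ^ n - r ^ n by x ^ 2 - r ^ 2 is a sum of nonnegative terms,
    one of which is the power n / 2 - 1 of the larger of x ^ 2 and r ^ 2. *)
Lemma even_pow_gap (x r : R) n : ~~ odd n -> (0 < n)%N -> 0 <= r ->
  exists2 q : R, ((`|x| + r) / 2) ^+ (n - 2) <= q &
    x ^+ n - r ^+ n = (x ^+ 2 - r ^+ 2) * q.
Proof.
move=> ev n0 r0; have nE : n = (n./2 * 2)%N by rewrite muln2 -[LHS]odd_double_half (negbTE ev).
move: nE; set j := n./2 => nE; clearbody j; have j0 : (0 < j)%N by move: n0; rewrite nE muln_gt0 => /andP[].
exists (\sum_(i < j) (x ^+ 2) ^+ (j.-1 - i) * (r ^+ 2) ^+ i).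
  have -> : (n - 2 = 2 * j.-1)%N by lia.
  rewrite exprM; have [xr|rx] := leP `|x| r.
  - case: j j0 {nE} => // j _ /=.
    rewrite big_ord_recr /= subnn expr0 mul1r ler_wpDl //.
      by apply: sumr_ge0 => i _; rewrite mulr_ge0 // exprn_ge0 // sqr_ge0.
    rewrite lerXn2r ?nnegrE ?sqr_ge0 // lerXn2r ?nnegrE ?divr_ge0 ?addr_ge0 //.
    lra.
  - case: j j0 {nE} => // j _ /=.
    rewrite big_ord_recl /= subn0 expr0 mulr1 ler_wpDr //.
      by apply: sumr_ge0 => i _; rewrite mulr_ge0 // exprn_ge0 // sqr_ge0.
    rewrite -[x ^+ 2]real_normK ?num_real //.
    rewrite lerXn2r ?nnegrE ?sqr_ge0 // lerXn2r ?nnegrE ?divr_ge0 ?addr_ge0 //.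
    lra.
by rewrite {1 2}nE mulnC !exprM subrXX.
Qed.

End Estimates.

Section SpectralGap.
Context {R : realType}.

(** After division by the full power of X - z no root is left near z. The cofactor has
    therefore the same sign at both points, and the odd power changes its sign. *)
Lemma odd_root_sign (p : {poly R}) (z e : R) : 0 < e -> p != 0 ->
  odd (mup z p) -> (forall x, root p x -> `|x - z| <= e -> x = z) ->
  p.[z - e] * p.[z + e] < 0.
Proof.
move=> e0 p0 om iso.
have := mup_geq z (mup z p) p0; rewrite leqnn => /esym /dvdpP [q pE].
have qz x : `|x - z| <= e -> ~~ root q x.
  move=> xz; apply/negP => qx; have xE : x = z.
    by apply: iso => //; rewrite pE rootM qx.
  have : ('X - z%:P) ^+ (mup z p).+1 %| p.
    rewrite {2}pE exprS dvdp_mul // dvdp_XsubCl -xE //.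
  by rewrite -mup_geq // ltnn.
have [/negP nq|q0] := ltP (q.[z - e] * q.[z + e]) 0.
  case: nq; apply/negP; rewrite -leNgt; rewrite leNgt; apply/negP => nq.
  have ab : z - e <= z + e by lra.
  have [qa|qa] := leP q.[z - e] 0.
    have qb : 0 <= q.[z + e].
      by rewrite leNgt; apply/negP => qb; move: nq; rewrite ltNge mulr_le0 // ltW.
    have : q.[z - e] <= 0 <= q.[z + e] by rewrite qa qb.
    move=> /(poly_ivt ab) [x xab]; apply/negP/qz; rewrite ler_norml; lra.
  have qb : q.[z + e] <= 0.
    by rewrite leNgt; apply/negP => qb; move: nq; rewrite ltNge mulr_ge0 // ltW.
  have : (- q).[z - e] <= 0 <= (- q).[z + e] by rewrite !hornerN; lra.
  move=> /(poly_ivt ab) [x xab]; rewrite rootN; apply/negP/qz; rewrite ler_norml; lra.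
have {}q0 : 0 < q.[z - e] * q.[z + e].
  rewrite lt_neqAle q0 andbT eq_sym mulf_neq0 //; rewrite -rootE qz //.
    by rewrite addrAC subrr sub0r normrN gtr0_norm.
  by rewrite addrAC subrr add0r gtr0_norm.
rewrite pE !hornerM !horner_exp !hornerXsubC.
have -> : z - e - z = - e by ring.
have -> : z + e - z = e by ring.
rewrite exprNn -signr_odd om expr1.
move: q0; set u := q.[z - e]; set v := q.[z + e]; set E := e ^+ mup z p => q0.
have -> : u * (-1 * E) * (v * E) = - ((u * v) * E ^+ 2) by ring.
by rewrite oppr_lt0 mulr_gt0 // exprn_gt0 // exprn_gt0.
Qed.

(** With d a third of the minimal diameter: if all three indices failed, then for suitable
    i1, i2, i3 the numbers mu j1 + mu i1, mu j2 + mu i2, mu j3 + mu i3 would all be closer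
    than d to S, and their set would have diameter at most 2 d. *)
Lemma gap_choice s (mu : 'I_s -> R) (j1 j2 j3 : 'I_s) :
  min_diam mu j1 j2 j3 <> 0 ->
  exists2 d : R, 0 < d & forall S : R, exists2 j, j \in [:: j1; j2; j3] &
    forall i, d <= `|S - mu j - mu i|.
Proof.
rewrite /min_diam /=; set im := [arg min_(_ < _) _]%O => D0.
pose F (i : 'I_s * 'I_s * 'I_s) : R :=
  diam [set mu j1 + mu i.1.1; mu j2 + mu i.1.2; mu j3 + mu i.2].
have Fmin i : F im <= F i by rewrite /im; case: arg_minP => // k _; apply.
have diamP (x y z b : R) : `|x - y| <= b -> `|x - z| <= b -> `|y - z| <= b ->
    0 <= diam [set x; y; z] <= b.
  move=> xy xz yz; have b0 : 0 <= b by rewrite (le_trans _ xy).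
  rewrite /diam; set E := (X in sup X).
  have E0 : E 0 by exists x; [left; left|exists x; [left; left|rewrite subrr normr0]].
  have Eb : ubound E b.
    move=> _ [u uE] [v vE] <-; move: uE vE.
    by case=> [[]|] ->; case=> [[]|] ->; rewrite ?subrr ?normr0 // distrC.
  apply/andP; split; first by apply: sup_ubound => //; exists b.
  by apply: ge_sup => //; exists 0.
have Fge0 i : 0 <= F i.
  have [b [h1 h2 h3]] : exists b, [/\ `|(mu j1 + mu i.1.1) - (mu j2 + mu i.1.2)| <= b,
      `|(mu j1 + mu i.1.1) - (mu j3 + mu i.2)| <= b &
      `|(mu j2 + mu i.1.2) - (mu j3 + mu i.2)| <= b].
    exists (`|(mu j1 + mu i.1.1) - (mu j2 + mu i.1.2)| +
      (`|(mu j1 + mu i.1.1) - (mu j3 + mu i.2)| +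
      `|(mu j2 + mu i.1.2) - (mu j3 + mu i.2)|)).
    split; [by rewrite lerDl addr_ge0| | ].
      by rewrite addrCA lerDl addr_ge0.
    by rewrite addrA lerDr addr_ge0.
  by have /andP[] := diamP _ _ _ _ h1 h2 h3.
have D : 0 < F im by rewrite lt_neqAle Fge0 andbT eq_sym; apply/eqP; exact: D0.
exists (F im / 3) => [|S]; first by rewrite divr_gt0.
apply: contrapT => /forall2NP nj.
have bad j : j \in [:: j1; j2; j3] -> exists i, `|S - mu j - mu i| < F im / 3.
  move=> jin; case: (nj j) => // /existsNP [i /negP]; rewrite -ltNge => h.
  by exists i.
have [i1 b1] : exists i, `|S - mu j1 - mu i| < F im / 3 by apply: bad; rewrite !inE eqxx.
have [i2 b2] : exists i, `|S - mu j2 - mu i| < F im / 3 by apply: bad; rewrite !inE eqxx orbT.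
have [i3 b3] : exists i, `|S - mu j3 - mu i| < F im / 3 by apply: bad; rewrite !inE eqxx !orbT.
have /andP[_] : 0 <= F (i1, i2, i3) <= 2 * (F im / 3).
  move: b1 b2 b3; rewrite !ltr_norml => b1 b2 b3.
  by apply: diamP; rewrite ler_norml; lra.
have := Fmin (i1, i2, i3); lra.
Qed.

End SpectralGap.

(** * Frequencies, couplings and the symbol *)

Section Galerkin.
Context {R : realType} (n m : nat).
Hypothesis n_even : ~~ odd n.
Hypothesis n_gt2 : (2 < n)%N.
Implicit Types (a : nat -> int -> 'M[R]_m) (t r : R) (z : int) (L N : nat).

Definition freq t z : R := t + 2 * pi * z%:~R.

(** The entry (k, l) of the terms of lower order in the basis of the exponentials with
    frequencies freq t z, when a nu lists the Fourier coefficients of the coefficient P nu.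
    *)
Definition coupling a t (k l : int) : 'M[R]_m :=
  \sum_(2 <= nu < n.+1) freq t l ^+ (n - nu) *: a nu (k - l).

Definition coef_size a z : R := \sum_(2 <= nu < n.+1) n1 (a nu z).

(** A common majorant of the powers of freq t z that occur in the couplings, for all t
    within 1 of r. Its exponent n - 2 is also the order of growth of the quotient of x ^ n -
    r ^ n by x ^ 2 - r ^ 2. *)
Definition weight r z : R := (`|freq r z| + r + 1) ^+ (n - 2).

Lemma coef_size_ge0 a z : 0 <= coef_size a z.
Proof. by apply: sumr_ge0 => nu _; exact: n1_ge0. Qed.

Lemma freq_close t r z : `|t - r| <= 1 -> `|freq t z| <= `|freq r z| + 1.
Proof.
move=> tr; have -> : freq t z = freq r z + (t - r) by rewrite /freq; ring.
by rewrite (le_trans (ler_normD _ _)) // lerD2l.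
Qed.

Lemma coupling_bound a t r k l : 0 <= r -> `|t - r| <= 1 ->
  n1 (coupling a t k l) <= coef_size a (k - l) * weight r l.
Proof.
move=> r0 tr; rewrite (le_trans (n1_sum _ _ _)) // /coef_size mulr_suml.
rewrite big_nat_cond [leRHS]big_nat_cond ler_sum // => nu /andP[/andP[nu2 nun] _].
rewrite n1Z mulrC ler_wpM2l ?n1_ge0 // normrX.
apply: (@le_trans _ _ ((`|freq r l| + r + 1) ^+ (n - nu))).
  rewrite lerXn2r ?nnegrE ?addr_ge0 //.
  by rewrite (le_trans (freq_close _ tr)) // lerD2r lerDl.
by rewrite /weight ler_weXn2l ?lerDr ?addr_ge0 // leq_sub2l.
Qed.

Lemma intr_sqr_ge z : (`|z%:~R| : R) <= z%:~R ^+ 2.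
Proof.
rewrite -real_normK ?num_real // expr2 -intr_norm -{1}[`|z|%:~R]mul1r.
have [->|z0] := eqVneq z 0; first by rewrite normr0 !mulr0.
rewrite ler_wpM2r ?ler0z // ler1z; lia.
Qed.

(** With x = freq t z one has x ^ 2 - r ^ 2 = (x - r) (x + r), where x - r is within 1 of 2
    pi z and x + r is within 1 + pi of 2 pi (z + N). As z and z + N are integers, these
    errors cannot change the signs, and the factors are at least as large as z and z + N.
    The product with y, instead of absolute values, makes the inequality stable under convex
    combinations of values of t. *)
Lemma symbol_gap t r z N (y : R) : 3 <= r -> `|t - r| <= 1 ->
    `|2 * r - 2 * pi * N%:R| <= pi ->
  y = z%:~R * (z + N%:Z)%:~R ->
  y ^+ 2 * weight r z <= 4 ^+ n * (y * (freq t z ^+ n - r ^+ n)).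
Proof.
move=> r3 tr rN yE; set x := freq t z.
have r0 : 0 <= r by lra.
have [q qge ->] := even_pow_gap x n_even (ltn_trans (isT : (0 < 2)%N) n_gt2) r0.
have wq : weight r z <= 4 ^+ n * q.
  apply: (@le_trans _ _ (4 ^+ (n - 2) * ((`|x| + r) / 2) ^+ (n - 2))).
    rewrite -exprMn /weight lerXn2r ?nnegrE ?addr_ge0 //.
      by rewrite mulr_ge0 // divr_ge0 // addr_ge0.
    have := @freq_close r t z; rewrite distrC -/x => /(_ tr); have := normr_ge0 x.
    lra.
  rewrite ler_pM // ?exprn_ge0 ?divr_ge0 ?addr_ge0 //.
  by rewrite ler_weXn2l ?ler1n // leq_subr.
have q0 : 0 <= q by rewrite (le_trans _ qge) // exprn_ge0 // divr_ge0 ?addr_ge0.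
have pi2 := @pi_ge2 R.
have yx : y ^+ 2 <= y * (x ^+ 2 - r ^+ 2).
  have hz : z%:~R ^+ 2 <= z%:~R * (x - r) :> R.
    have -> : x - r = (t - r) + 2 * pi * z%:~R by rewrite /x /freq; ring.
    have h1 := intr_sqr_ge z; set Z : R := z%:~R in h1 *.
    have h2 : - `|Z| <= Z * (t - r).
      rewrite lerNl (le_trans (ler_norm _)) // normrN normrM.
      by rewrite ler_piMr.
    have h3 : 2 * Z ^+ 2 <= pi * Z ^+ 2 by rewrite ler_wpM2r ?sqr_ge0.
    have -> : Z * (t - r + 2 * pi * Z) = Z * (t - r) + 2 * (pi * Z ^+ 2) by ring.
    have := sqr_ge0 Z; lra.
  have hv : (z + N%:Z)%:~R ^+ 2 <= (z + N%:Z)%:~R * (x + r) :> R.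
    have -> : x + r = (t - r) + (2 * r - 2 * pi * N%:R) + 2 * pi * (z + N%:Z)%:~R.
      by rewrite /x /freq intrD; ring.
    have h1 := intr_sqr_ge (z + N%:Z); set Z : R := (z + N%:Z)%:~R in h1 *.
    have h2 : - (`|Z| * (1 + pi)) <= Z * (t - r + (2 * r - 2 * pi * N%:R)).
      rewrite lerNl (le_trans (ler_norm _)) // normrN normrM.
      by rewrite ler_wpM2l // (le_trans (ler_normD _ _)) // lerD.
    have h3 : 2 * (2 * Z ^+ 2 - `|Z|) <= pi * (2 * Z ^+ 2 - `|Z|).
      by rewrite ler_wpM2r //; have := sqr_ge0 Z; lra.
    have -> : Z * (t - r + (2 * r - 2 * pi * N%:R) + 2 * pi * Z)
      = Z * (t - r + (2 * r - 2 * pi * N%:R)) + pi * (2 * Z ^+ 2) by ring.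
    move: h2 h3; set T := Z * (_ + _); have := sqr_ge0 Z; lra.
  have -> : y * (x ^+ 2 - r ^+ 2) = (z%:~R * (x - r)) * ((z + N%:Z)%:~R * (x + r)).
    by rewrite yE; ring.
  by rewrite yE exprMn ler_pM // sqr_ge0.
rewrite (le_trans (ler_wpM2l (sqr_ge0 y) wq)) //.
have -> : 4 ^+ n * (y * ((x ^+ 2 - r ^+ 2) * q)) = y * (x ^+ 2 - r ^+ 2) * (4 ^+ n * q) by ring.
by rewrite ler_wpM2r // mulr_ge0.
Qed.

(** Taylor expansion at |x| = r. The scaling of v is the one for which r ^ n - x ^ n is r ^
    (n - 2) v to first order, the size of the term P 2; all further terms are smaller by the
    factor 1 / r. The radius 5 is large enough for both resonant frequencies. *)
Lemma near_resonance (x r v : R) : 5 <= r -> `| `|x| - r| <= 5 ->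
  v = n%:R * r * (r - `|x|) ->
  [/\ `|x ^+ n - r ^+ n + r ^+ (n - 2) * v| <= 5 * 4 ^+ n / r * (r ^+ (n - 2) * `|v|),
      `|x ^+ (n - 2) - r ^+ (n - 2)| <= 5 * 4 ^+ n / r * r ^+ (n - 2),
      `|x| ^+ (n - 2) <= 4 ^+ n * r ^+ (n - 2) &
      forall nu, (3 <= nu <= n)%N -> `|x| ^+ (n - nu) <= 5 * 4 ^+ n / r * r ^+ (n - 2)].
Proof.
move=> r5 xr vE; have r0 : 0 < r by lra.
have rn : 0 < r ^+ (n - 2) by rewrite exprn_gt0.
have evX (k : nat) : ~~ odd k -> x ^+ k = `|x| ^+ k.
  by move=> ek; rewrite -normrX ger0_norm // exprn_even_ge0.
set w := `|x| / r; have wr : `|x| = w * r by rewrite /w divfK // gt_eqF.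
have w1 : `|w - 1| <= 5 / r.
  rewrite ler_pdivlMr // -(gtr0_norm r0) -normrM mulrBl mul1r -wr.
  exact: xr.
have w2 : `|w| <= 2.
  have : 5 / r <= 1 by rewrite ler_pdivrMr // mul1r.
  move: w1; rewrite !ler_norml; lra.
have xn : `|x| <= 2 * r by rewrite wr ler_pM2r // (le_trans (ler_norm _)).
have rE : r ^+ n = r ^+ (n - 2) * r ^+ 2 by rewrite -exprD subnK // ltnW.
split.
- rewrite evX // wr exprMn rE vE wr.
  have -> : w ^+ n * (r ^+ (n - 2) * r ^+ 2) - r ^+ (n - 2) * r ^+ 2
      + r ^+ (n - 2) * (n%:R * r * (r - w * r))
     = - (r ^+ (n - 2) * r ^+ 2 * (1 - w ^+ n - n%:R * (1 - w))) by ring.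
  rewrite normrN normrM (gtr0_norm (mulr_gt0 rn (exprn_gt0 _ r0))).
  have := pow_linear n w2; have vv : `|n%:R * r * (r - w * r)| = n%:R * r ^+ 2 * `|w - 1|.
    have -> : n%:R * r * (r - w * r) = n%:R * r ^+ 2 * (1 - w) by ring.
    by rewrite normrM distrC ger0_norm // mulr_ge0 ?ler0n ?sqr_ge0.
  rewrite vv => h.
  have h2 : n%:R * 4 ^+ n * `|w - 1| ^+ 2 <= n%:R * 4 ^+ n * (5 / r * `|w - 1|).
    by rewrite ler_wpM2l ?mulr_ge0 ?ler0n ?exprn_ge0 // expr2 ler_wpM2r.
  rewrite (le_trans (ler_wpM2l _ (le_trans h h2))) ?mulr_ge0 ?sqr_ge0 ?(ltW rn) ?(ltW r0) //.
  rewrite le_eqVlt; apply/orP; left; apply/eqP; field; lra.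
- rewrite evX; last by rewrite oddB ?(ltnW n_gt2) //= addbF.
  have -> : `|x| ^+ (n - 2) - r ^+ (n - 2) = (w ^+ (n - 2) - 1) * r ^+ (n - 2).
    by rewrite wr exprMn; ring.
  rewrite normrM (gtr0_norm rn) ler_pM2r // (le_trans (pow_close _ w2)) //.
  have -> : 5 * 4 ^+ n / r = 4 ^+ n * (5 / r) by ring.
  rewrite ler_pM // ?exprn_ge0 //.
  by rewrite ler_weXn2l ?ler1n // leq_subr.
- rewrite (le_trans (lerXn2r _ _ _ xn)) ?nnegrE ?mulr_ge0 ?(ltW r0) //.
  rewrite exprMn ler_pM2r //; apply: (@le_trans _ _ (4 ^+ (n - 2))).
    by rewrite lerXn2r ?nnegrE // ler_nat.
  by rewrite ler_weXn2l ?ler1n // leq_subr.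
- move=> nu /andP[nu3 nun].
  have xr1 : `|x| <= 2 * r by [].
  have h : `|x| ^+ (n - nu) <= (2 * r) ^+ (n - 3).
    apply: (@le_trans _ _ ((2 * r) ^+ (n - nu))).
      by rewrite lerXn2r ?nnegrE // mulr_ge0 // ltW.
    by rewrite ler_weXn2l ?leq_sub2l //; lra.
  rewrite (le_trans h) //.
  have -> : (n - 2 = (n - 3).+1)%N by clear -n_gt2; lia.
  have -> : 5 * 4 ^+ n / r * r ^+ (n - 3).+1 = 5 * 4 ^+ n * r ^+ (n - 3).
    by rewrite exprS; field; lra.
  rewrite exprMn ler_pM2r ?exprn_gt0 //.
  apply: (@le_trans _ _ (4 ^+ (n - 3))); first by rewrite lerXn2r ?nnegrE // ler_nat.
  apply: (@le_trans _ _ (4 ^+ n)); first by rewrite ler_weXn2l ?ler1n // leq_subr.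
  by rewrite ler_peMl ?exprn_ge0 // ler1n.
Qed.

End Galerkin.

(** * The finite systems *)

Section Modes.

Definition mode L (k : 'I_(L.*2.+1)) : int := k%:Z - L%:Z.

Definition mode_ix L (j : nat) : 'I_(L.*2.+1) := inord (L - j).

Lemma mode_ixE L j : (j <= L)%N -> mode (mode_ix L j) = - j%:Z.
Proof. by move=> jL; rewrite /mode /mode_ix inordK; lia. Qed.

Lemma mode_inj L : injective (@mode L).
Proof. by move=> k l /addIr [] /val_inj. Qed.

Lemma off_diag_modes L N (k : 'I_(L.*2.+1)) : (N <= L)%N ->
  (k != mode_ix L 0) && (k != mode_ix L N) =
  ((k != L :> nat) && (k != (L - N)%N :> nat)).
Proof.
by move=> NL; rewrite -!val_eqE /= !inordK ?subn0 //; lia.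
Qed.

Lemma mode_ix_neq L N : (0 < N <= L)%N -> mode_ix L 0 != mode_ix L N.
Proof. by move=> /andP[N0 NL]; rewrite -val_eqE /= !inordK; lia. Qed.

End Modes.

Section GalerkinKernel.
Context {R : realType} (n m : nat).
Hypothesis n_even : ~~ odd n.
Hypothesis n_gt2 : (2 < n)%N.

(** Outside resonance the symbol is at least weight / res_weight, by symbol_gap. *)
Definition res_weight (N : nat) (z : int) : R :=
  4 ^+ n / `|z%:~R * (z + N%:Z)%:~R|.

(** The Fourier coefficients of a square-integrable function are square-summable but in
    general not summable, so that the sum is estimated by 2 x y <= y ^ 2 / r + r x ^ 2.
    Partial fractions split 1 / (z (z + N)) into (1 / z - 1 / (z + N)) / N, and 1 / N is of
    order 1 / r. *)
Lemma column_sums (a : nat -> int -> 'M[R]_m) L N (r B : R) l :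
  0 < r -> r <= 8 * N%:R -> (N <= L)%N ->
  \sum_(k < L.*2.+1) coef_size n a (mode k - l) ^+ 2 <= B ->
  \sum_(k | (k != mode_ix L 0) && (k != mode_ix L N))
     res_weight N (mode k) * coef_size n a (mode k - l)
  <= (B + 16 ^+ n.+3) / r.
Proof.
move=> r0 rN NL Bsq; have N0 : 0 < N%:R :> R by lra.
have B0 : 0 <= B by rewrite (le_trans _ Bsq) // sumr_ge0 // => k _; rewrite sqr_ge0.
pose P := [pred k : 'I_(L.*2.+1) | (k != mode_ix L 0) && (k != mode_ix L N)].
rewrite -/P; pose Q k : R := (k%:R - L%:R) ^- 2; pose Q' k : R := (k%:R - (L - N)%N%:R) ^- 2.
have hk k : P k -> res_weight N (mode k) ^+ 2 <= 16 ^+ n * (2 / N%:R ^+ 2) * (Q k + Q' k).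
  rewrite /P /= off_diag_modes // => /andP[k1 k2].
  have e16 : 4 ^+ 2 = 16 :> R by ring.
  rewrite /res_weight exprMn exprVn -exprM mulnC exprM e16.
  rewrite -mulrA ler_wpM2l ?exprn_ge0 // real_normK ?num_real //.
  have zE : (mode k)%:~R = k%:R - L%:R :> R by rewrite /mode intrD intrN.
  have vE : (mode k + N%:Z)%:~R = k%:R - (L - N)%N%:R :> R.
    by rewrite intrD zE natrB //; ring.
  rewrite /Q /Q' vE zE natrB //.
  have z0 : k%:R - L%:R != 0 :> R by rewrite subr_eq0 eqr_nat.
  have v0 : k%:R - (L%:R - N%:R) != 0 :> R by rewrite -natrB // subr_eq0 eqr_nat.
  set z := k%:R - L%:R in z0 *; have vz : k%:R - (L%:R - N%:R) = z + N%:R by rewrite /z; ring.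
  rewrite vz in v0 *; set v := z + N%:R in v0 *.
  have Nn : N%:R != 0 :> R by rewrite gt_eqF.
  have -> : 2 / N%:R ^+ 2 * (z ^- 2 + v ^- 2) = (2 * (z ^+ 2 + v ^+ 2) / N%:R ^+ 2) * (z * v) ^- 2.
    by field; rewrite v0 z0 Nn.
  rewrite ler_peMl ?invr_ge0 ?sqr_ge0 // ler_pdivlMr ?exprn_gt0 // mul1r.
  have -> : N%:R = v - z :> R by rewrite /v; ring.
  by rewrite sqrrB -subr_ge0; have := sqr_ge0 (z + v); rewrite sqrrD; lra.
have amgm (k : 'I_(L.*2.+1)) : res_weight N (mode k) * coef_size n a (mode k - l)
   <= 2^-1 * (coef_size n a (mode k - l) ^+ 2 / r + r * res_weight N (mode k) ^+ 2).
  set x := res_weight _ _; set y := coef_size _ _ _.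
  rewrite -subr_ge0.
  have -> : 2^-1 * (y ^+ 2 / r + r * x ^+ 2) - x * y = (y - r * x) ^+ 2 / (2 * r).
    by field; lra.
  by rewrite divr_ge0 ?sqr_ge0 // mulr_ge0 // ltW.
rewrite (le_trans (ler_sum _ (fun k (_ : P k) => amgm k))) // -mulr_sumr big_split /=.
have s1 : \sum_(k | P k) coef_size n a (mode k - l) ^+ 2 / r <= B / r.
  rewrite -mulr_suml ler_pM2r ?invr_gt0 // (le_trans _ Bsq) //.
  by rewrite [leRHS](bigID P) /= lerDl sumr_ge0 // => k _; rewrite sqr_ge0.
have s2 : \sum_(k | P k) r * res_weight N (mode k) ^+ 2 <= 16 ^+ n.+3 / r.
  rewrite -mulr_sumr (le_trans (ler_wpM2l (ltW r0) (ler_sum _ hk))) //.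
  rewrite -mulr_sumr big_split /=.
  have sub (T : 'I_(L.*2.+1) -> bool) (F : nat -> R) : (forall k, P k -> T k) -> (forall i, 0 <= F i) ->
      \sum_(k | P k) F k <= \sum_(k < L.*2.+1 | T k) F k.
    move=> PT F0; rewrite big_mkcond [leRHS]big_mkcond ler_sum // => k _.
    by case: ifPn => [/PT ->//|_]; case: ifP.
  have q1 : \sum_(k | P k) Q k <= 4.
    rewrite (le_trans _ (inv_square_sum L.*2.+1 L)) //.
    apply: (sub (fun k => k != L :> nat)) => [k|i]; last by rewrite invr_ge0 sqr_ge0.
    by rewrite /P /= off_diag_modes // => /andP[].
  have q2 : \sum_(k | P k) Q' k <= 4.
    rewrite (le_trans _ (inv_square_sum L.*2.+1 (L - N))) //.
    apply: (sub (fun k => k != (L - N)%N :> nat)) => [k|i]; last by rewrite invr_ge0 sqr_ge0.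
    by rewrite /P /= off_diag_modes // => /andP[].
  have q12 : \sum_(k | P k) Q k + \sum_(k | P k) Q' k <= 8 by lra.
  have c0 : 0 <= r * (16 ^+ n * (2 / N%:R ^+ 2)).
    by rewrite !mulr_ge0 ?invr_ge0 ?exprn_ge0 // ltW.
  rewrite mulrA (le_trans (ler_wpM2l c0 q12)) //.
  rewrite ler_pdivlMr //.
  have r2 : r ^+ 2 / N%:R ^+ 2 <= 64.
    rewrite ler_pdivrMr ?exprn_gt0 // (_ : 64 * N%:R ^+ 2 = (8 * N%:R) ^+ 2); last by ring.
    by rewrite lerXn2r ?nnegrE ?mulr_ge0 // ltW.
  have -> : r * (16 ^+ n * (2 / N%:R ^+ 2)) * 8 * r = 16 ^+ n * (16 * (r ^+ 2 / N%:R ^+ 2)) by field; lra.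
  rewrite !exprSr -!mulrA ler_wpM2l ?exprn_ge0 //; lra.
move: s1 s2; rewrite mulrDl.
have : 0 <= B / r by rewrite divr_ge0 // ltW.
have : 0 <= 16 ^+ n.+3 / r by rewrite divr_ge0 ?exprn_ge0 // ltW.
by set u := 16 ^+ n.+3 / r; lra.
Qed.

(** The entries are polynomials in the quasimomentum, hence so is the determinant, to which
    the intermediate value theorem will be applied. *)
Definition galerkin_mx (a : nat -> int -> 'M[R]_m) L (r : R) (k l : 'I_(L.*2.+1)) :
    'M[{poly R}]_m :=
  (if k == l then (('X + (2 * pi * (mode k)%:~R)%:P) ^+ n - (r ^+ n)%:P)%:M else 0)
  + \sum_(2 <= nu < n.+1) ('X + (2 * pi * (mode l)%:~R)%:P) ^+ (n - nu)
       *: map_mx polyC (a nu (mode k - mode l)).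

Lemma galerkin_eval a L r t (k l : 'I_(L.*2.+1)) :
  map_mx (horner_eval t) (galerkin_mx a r k l) =
  (if k == l then (freq t (mode k) ^+ n - r ^+ n)%:M else 0)
  + coupling n a t (mode k) (mode l).
Proof.
rewrite /galerkin_mx map_mxD; congr (_ + _).
  case: eqP => _; last by rewrite map_mx0.
  by rewrite map_scalar_mx /= /horner_eval !hornerE.
rewrite /coupling raddf_sum; apply: eq_bigr => nu _ /=.
apply/matrixP => i j; rewrite !mxE /horner_eval hornerM hornerC.
by rewrite horner_exp !hornerE.
Qed.

(** The end of the homotopy: no couplings, and the resonant blocks replaced by their limits.
    The quasimomentum t of the other blocks is a separate parameter, so that two decoupled
    systems can be made to differ in the first resonant block only. *)
Definition decoupled (C : 'M[R]_m) L N (r v0 v1 t : R) (k l : 'I_(L.*2.+1)) : 'M[R]_m :=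
  if k != l then 0 else
  if k == mode_ix L 0 then r ^+ (n - 2) *: (C - v0%:M) else
  if k == mode_ix L N then r ^+ (n - 2) *: (C - v1%:M) else
  (freq t (mode k) ^+ n - r ^+ n)%:M.

Lemma segment_row a C L N (r v0 v1 t tX s : R) c (k : 'I_(L.*2.+1)) :
  \sum_l segment (fun k l => map_mx (horner_eval t) (galerkin_mx a r k l))
           (decoupled C N r v0 v1 tX) s k l *m c l
  = (1 - s) *: ((freq t (mode k) ^+ n - r ^+ n) *: c k
                + \sum_l coupling n a t (mode k) (mode l) *m c l)
    + s *: (decoupled C N r v0 v1 tX k k *m c k) :> 'cV[R]_m.
Proof.
rewrite /segment; under eq_bigr do rewrite mulmxDl -!scalemxAl galerkin_eval mulmxDl.
rewrite big_split /= -!scaler_sumr big_split /=; congr (_ *: (_ + _) + _ *: _).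
  rewrite (bigD1 k) //= eqxx mul_scalar_mx big1 ?addr0 // => l.
  by rewrite eq_sym => /negbTE ->; rewrite mul0mx.
by rewrite (bigD1 k) //= big1 ?addr0 // => l; rewrite eq_sym /decoupled => ->; rewrite mul0mx.
Qed.

End GalerkinKernel.

(** * The homotopy to the decoupled systems *)

Section GalerkinSolution.
Context {R : realType} (n m : nat).
Hypothesis n_even : ~~ odd n.
Hypothesis n_gt2 : (2 < n)%N.

(** Up to errors bounded by a small multiple of 1 + |v|, the row reads r ^ (n - 2) (C - v) y
    + (1 - s) rest = 0 with the interpolated value v. The lower bound of C - v contains the
    same factor 1 + |v| and absorbs the errors. *)
Lemma resonant_row (A0 A2 C : 'M[R]_m) (y : 'cV[R]_m) (x r s vi vX eta B g : R) (rest : 'cV[R]_m) :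
  5 <= r -> `| `|x| - r| <= 5 -> vi = n%:R * r * (r - `|x|) ->
  0 <= s <= 1 -> `|vi - vX| <= 1 -> 0 <= g -> 0 <= B ->
  n1 (A0 - x ^+ (n - 2) *: A2) <= 5 * 4 ^+ n / r * r ^+ (n - 2) * B ->
  n1 A2 <= B -> n1 (A2 - C) <= eta ->
  eta + 5 * 4 ^+ n * (1 + 2 * B) / r <= g / 8 ->
  (let v := (1 - s) * vi + s * vX in
   g * (1 + `|v|) * n1 y <= n1 (C *m y - v *: y)) ->
  (1 - s) *: ((x ^+ n - r ^+ n) *: y + (A0 *m y + rest))
    + s *: ((r ^+ (n - 2) *: (C - vX%:M)) *m y) = 0 ->
  g / 2 * r ^+ (n - 2) * n1 y <= n1 rest.
Proof.
move=> r5 xr viE s01 viX g0 B0 hA0 hA2 hAC small; set v := (1 - s) * vi + s * vX.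
move=> /= gv row; have r0 : 0 < r by lra.
have [h1 h2 h3 _] := near_resonance n_even n_gt2 r5 xr viE.
set rr := r ^+ (n - 2) in h1 h2 h3 hA0 row *; have rr0 : 0 < rr by rewrite exprn_gt0.
set K := 5 * 4 ^+ n / r in h1 h2 hA0.
have K0 : 0 <= K by rewrite /K !mulr_ge0 ?invr_ge0 ?exprn_ge0 // ltW.
pose E := (x ^+ n - r ^+ n + rr * vi)%:M + (A0 - rr *: C).
have Ele : n1 (E *m y) <= rr * (1 + `|v|) * (g / 4) * n1 y.
  rewrite mulmxDl mul_scalar_mx (le_trans (n1D _ _)) // n1Z.
  have e1 : n1 (A0 - rr *: C) <= rr * (eta + 2 * K * B).
    have -> : A0 - rr *: C = (A0 - x ^+ (n - 2) *: A2)
        + ((x ^+ (n - 2) - rr) *: A2 + rr *: (A2 - C)).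
      by apply/matrixP => i j; rewrite !mxE; ring.
    rewrite (le_trans (n1D _ _)) //; have := n1D ((x ^+ (n - 2) - rr) *: A2) (rr *: (A2 - C)).
    rewrite !n1Z (gtr0_norm rr0).
    have : `|x ^+ (n - 2) - rr| * n1 A2 <= K * rr * B by rewrite ler_pM ?n1_ge0.
    have : rr * n1 (A2 - C) <= rr * eta by rewrite ler_wpM2l // ltW.
    lra.
  have e2 : n1 ((A0 - rr *: C) *m y) <= rr * (eta + 2 * K * B) * n1 y.
    by rewrite (le_trans (n1M _ _)) // ler_wpM2r ?n1_ge0.
  have e3 : `|x ^+ n - r ^+ n + rr * vi| * n1 y <= K * (rr * `|vi|) * n1 y.
    by rewrite ler_wpM2r ?n1_ge0.
  have vile : `|vi| <= 1 + `|v|.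
    have : `|vi - v| <= 1.
      have -> : vi - v = s * (vi - vX) by rewrite /v; ring.
      rewrite normrM ger0_norm; last by case/andP: s01.
      by rewrite mulr_ile1 //; case/andP: s01.
    by have := ler_normD (vi - v) v; rewrite subrK; lra.
  have small' : eta + K * (1 + 2 * B) <= g / 8.
    by rewrite (le_trans _ small) // lerD2l /K mulrAC.
  apply: (le_trans (lerD e3 e2)).
  have -> : K * (rr * `|vi|) * n1 y + rr * (eta + 2 * K * B) * n1 y
     = rr * (K * `|vi| + eta + 2 * K * B) * n1 y by ring.
  rewrite ler_wpM2r ?n1_ge0 // -[leRHS]mulrA ler_wpM2l ?(ltW rr0) //.
  have := ler_wpM2l K0 vile; have : 0 <= `|v| by [].
  have eta0 : 0 <= eta by rewrite (le_trans _ hAC) ?n1_ge0.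
  have KB0 : 0 <= K * B by rewrite mulr_ge0.
  move=> v0; have := ler_wpM2r v0 small'; have := mulr_ge0 eta0 v0.
  have := mulr_ge0 KB0 v0; have := mulr_ge0 g0 v0; lra.
have key : rr *: (C *m y - v *: y) = - ((1 - s) *: (E *m y + rest)).
  apply/eqP; rewrite -addr_eq0 -{}row; apply/eqP.
  rewrite /E !mulmxDl mulNmx -!scalemxAl mulmxBl !mul_scalar_mx.
  set Cy := C *m y; set Ay := A0 *m y.
  by apply/matrixP => i j; rewrite !mxE /v; ring.
have n1key : rr * n1 (C *m y - v *: y) <= n1 (E *m y) + n1 rest.
  rewrite -{1}(gtr0_norm rr0) -n1Z key n1N n1Z.
  have s1 : `|1 - s| <= 1 by rewrite ger0_norm; lra.
  rewrite (le_trans (ler_wpM2r (n1_ge0 _) s1)) // mul1r; exact: n1D.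
have := ler_wpM2l (ltW rr0) gv.
have y0 := n1_ge0 y; have v0 := normr_ge0 v.
have p1 : 0 <= rr * `|v| * (g * n1 y) by rewrite !mulr_ge0 // ltW.
have p2 : 0 <= rr * (g * n1 y) by rewrite !mulr_ge0 // ltW.
move: n1key Ele p1 p2; set X := n1 y; set V := `|v|.
have -> : rr * (1 + V) * (g / 4) * X = rr * (g * X) / 4 + rr * V * (g * X) / 4 by ring.
have -> : rr * (g * (1 + V) * X) = rr * (g * X) + rr * V * (g * X) by ring.
have -> : g / 2 * rr * X = rr * (g * X) / 2 by ring.
set P1 := rr * V * _; set P2 := rr * (g * X); lra.
Qed.

Lemma coupling_head (a : nat -> int -> 'M[R]_m) t k l :
  coupling n a t k l = freq t l ^+ (n - 2) *: a 2%N (k - l)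
    + \sum_(3 <= nu < n.+1) freq t l ^+ (n - nu) *: a nu (k - l).
Proof. by rewrite /coupling big_ltn // ltnW // ltnS ltnW. Qed.

Lemma coef_size_head (a : nat -> int -> 'M[R]_m) z :
  coef_size n a z = n1 (a 2%N z) + \sum_(3 <= nu < n.+1) n1 (a nu z).
Proof. by rewrite /coef_size big_ltn // ltnW // ltnS ltnW. Qed.

Lemma coupling_tail (a : nat -> int -> 'M[R]_m) t k l (r B : R) :
  5 <= r -> `| `|freq t l| - r| <= 5 -> coef_size n a (k - l) <= B ->
  n1 (coupling n a t k l - freq t l ^+ (n - 2) *: a 2%N (k - l))
    <= 5 * 4 ^+ n / r * r ^+ (n - 2) * B.
Proof.
move=> r5 tr aB; rewrite coupling_head addrAC subrr add0r.
have [_ _ _ h] := near_resonance n_even n_gt2 r5 tr erefl.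
rewrite (le_trans (n1_sum _ _ _)) //.
have r0 : 0 < r by lra.
have K0 : 0 <= 5 * 4 ^+ n / r * r ^+ (n - 2).
  by rewrite !mulr_ge0 ?invr_ge0 ?exprn_ge0 // ltW.
apply: (@le_trans _ _ (5 * 4 ^+ n / r * r ^+ (n - 2) * \sum_(3 <= nu < n.+1) n1 (a nu (k - l)))).
  rewrite mulr_sumr big_nat_cond [leRHS]big_nat_cond ler_sum // => nu /andP[hnu _].
  by rewrite n1Z normrX ler_wpM2r ?n1_ge0 // h.
by rewrite ler_wpM2l // (le_trans _ aB) // coef_size_head lerDr n1_ge0.
Qed.

End GalerkinSolution.

Section GalerkinTheorem.
Context {R : realType} (n m : nat).
Hypothesis n_even : ~~ odd n.
Hypothesis n_gt2 : (2 < n)%N.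

(** Everything that is used of the Fourier coefficients. The constants are chosen before r
    and the approximation, hence have to hold for all approximations of the given
    coefficients. *)
Record good_coefs (C : 'M[R]_m) (B eta : R) (N0 : nat)
    (a : nat -> int -> 'M[R]_m) : Prop := GoodCoefs {
  good_size : forall z, coef_size n a z <= B;
  good_square : forall L l, \sum_(k < L.*2.+1) coef_size n a (mode k - l) ^+ 2 <= B;
  good_mean : n1 (a 2%N 0 - C) <= eta;
  good_tail : forall z : int, (N0 <= `|z|)%N -> n1 (a 2%N z) <= eta }.

(** N is an integer nearest to r / pi, so that the modes 0 and - N, and no others, have
    frequencies of absolute value close to r. *)
Definition center_ok (r : R) (N : nat) : Prop :=
  [/\ 10 <= r, `|2 * r - 2 * pi * N%:R| <= pi & r <= 8 * N%:R].

(** The bound of column_sums: the relative size of the couplings outside resonance. *)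
Definition tau (B r : R) : R := (B + 16 ^+ n.+3) / r.

Lemma weight_resonant r N : center_ok r N ->
  weight n r 0 <= 4 ^+ n * r ^+ (n - 2) /\
  weight n r (- N%:Z) <= 4 ^+ n * r ^+ (n - 2).
Proof.
move=> [r10 rN _]; have r0 : 0 <= r by lra.
have pi4 : pi <= 4 :> R by have := @pihalf_lt2 R; lra.
have h (y : R) : 0 <= y -> y <= 4 * r -> y ^+ (n - 2) <= 4 ^+ n * r ^+ (n - 2).
  move=> y0 yr; apply: (@le_trans _ _ ((4 * r) ^+ (n - 2))).
    by rewrite lerXn2r ?nnegrE ?mulr_ge0.
  by rewrite exprMn ler_wpM2r ?exprn_ge0 // ler_weXn2l ?ler1n // leq_subr.
have t0 z : 0 <= `|freq r z| + r + 1 by rewrite !addr_ge0.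
split; apply: h => //; rewrite /freq.
  by rewrite mulr0 addr0 ger0_norm //; lra.
rewrite intrN mulrN; have : `|r - 2 * pi * N%:R| <= r + 4.
  by move: rN; rewrite !ler_norml; lra.
by rewrite pmulrn; lra.
Qed.

Lemma second_resonance r N t : center_ok r N -> `|t - r| <= 1 ->
  [/\ `| `|freq t (- N%:Z)| - r| <= 5 &
      r - `|freq t (- N%:Z)| = 2 * r - 2 * pi * N%:R - (r - t)].
Proof.
move=> [r10 rN _] tr; have pi4 : pi <= 4 :> R by have := @pihalf_lt2 R; lra.
have -> : `|freq t (- N%:Z)| = 2 * pi * N%:R - t.
  rewrite /freq intrN mulrN -pmulrn distrC ger0_norm //.
  by move: rN tr; rewrite !ler_norml; lra.
by split; [move: rN tr; rewrite !ler_norml; lra|ring].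
Qed.

(** The estimate of symbol_gap holds at t and at tX with the same factor y, hence for the
    convex combination of the two symbols as well. *)
Lemma off_resonant_of_row (a : nat -> int -> 'M[R]_m) L N (r t tX s : R) (k : 'I_(L.*2.+1))
    (y z : 'cV[R]_m) :
  center_ok r N -> (N <= L)%N -> `|t - r| <= 1 -> `|tX - r| <= 1 -> 0 <= s <= 1 ->
  k != mode_ix L 0 -> k != mode_ix L N ->
  (1 - s) *: ((freq t (mode k) ^+ n - r ^+ n) *: y + z)
    + s *: ((freq tX (mode k) ^+ n - r ^+ n)%:M *m y) = 0 ->
  weight n r (mode k) * n1 y <= res_weight n N (mode k) * n1 z.
Proof.
move=> [r10 rN r8] NL tr tXr s01 k0 k1.
set Y : R := (mode k)%:~R * (mode k + N%:Z)%:~R.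
have r3 : 3 <= r by lra.
have g1 := symbol_gap n_even n_gt2 r3 tr rN (erefl Y).
have g2 := symbol_gap n_even n_gt2 r3 tXr rN (erefl Y).
set d := _ - r ^+ n in g1 *; set dX := _ - r ^+ n in g2 *.
set D := (1 - s) * d + s * dX; set w := weight n r (mode k) in g1 g2 *.
have Y0 : 0 < `|Y|.
  have := off_diag_modes k NL; rewrite k0 k1 /= => /esym/andP[kL kN].
  rewrite normr_gt0 mulf_neq0 ?intr_eq0 //; rewrite /mode; clear -kL kN NL; lia.
have gD : Y ^+ 2 * w <= 4 ^+ n * (Y * D).
  have s0 : 0 <= s by case/andP: s01.
  have s1 : 0 <= 1 - s by rewrite subr_ge0; case/andP: s01.
  have := lerD (ler_wpM2l s1 g1) (ler_wpM2l s0 g2).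
  have -> : (1 - s) * (Y ^+ 2 * w) + s * (Y ^+ 2 * w) = Y ^+ 2 * w by ring.
  by move=> /le_trans; apply; rewrite le_eqVlt; apply/orP; left; apply/eqP; rewrite /D; ring.
have wD : w <= 4 ^+ n / `|Y| * `|D|.
  rewrite mulrAC ler_pdivlMr // -(ler_pM2l Y0).
  have -> : `|Y| * (w * `|Y|) = `|Y| ^+ 2 * w by ring.
  rewrite real_normK ?num_real // (le_trans gD) //.
  have -> : `|Y| * (4 ^+ n * `|D|) = 4 ^+ n * (`|Y * D|) by rewrite (normrM Y D); ring.
  by rewrite ler_wpM2l ?exprn_ge0 // ler_norm.
rewrite mul_scalar_mx => row.
have Dy : D *: y = - ((1 - s) *: z).
  apply/eqP; rewrite -addr_eq0 -{}row; apply/eqP.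
  by apply/matrixP => i j; rewrite !mxE /D; ring.
rewrite (le_trans (ler_wpM2r (n1_ge0 y) wD)) // -[leLHS]mulrA -n1Z Dy n1N n1Z /res_weight -/Y.
rewrite ler_wpM2l ?divr_ge0 ?exprn_ge0 // ler_piMl ?n1_ge0 // ger0_norm; lra.
Qed.

(** The two resonant modes are coupled through a coefficient of index N or - N, which is
    small by good_tail, and each of them to the other modes by bounded factors acting on
    components that the symbol keeps small. So kernel_trivial applies along the whole
    segment. *)
Lemma galerkin_segment (C : 'M[R]_m) (B eta g : R) N0 a L N r t tX v0 v1 vX s :
  good_coefs C B eta N0 a -> center_ok r N -> (N0 <= N <= L)%N ->
  `|t - r| <= 1 -> `|tX - r| <= 1 -> 0 <= s <= 1 ->
  v0 = n%:R * r * (r - t) -> v1 = n%:R * r * (2 * r - 2 * pi * N%:R) - v0 ->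
  `|v1 - vX| <= 1 -> 0 < g ->
  4 ^+ n * eta + (5 * 4 ^+ n * (1 + 2 * B) + 4 * B * 4 ^+ n * (B + 16 ^+ n.+3)) / r <= g / 16 ->
  tau B r <= 2^-1 ->
  (forall x : 'cV[R]_m, g * (1 + `|v0|) * n1 x <= n1 (C *m x - v0 *: x)) ->
  (forall x : 'cV[R]_m, let v := (1 - s) * v1 + s * vX in
     g * (1 + `|v|) * n1 x <= n1 (C *m x - v *: x)) ->
  kerfree (segment (fun k l => map_mx (horner_eval t) (galerkin_mx n a r k l))
           (@decoupled R n m C L N r v0 vX tX) s).
Proof.
move=> ga ctr /andP[N0N NL] tr tXr s01 v0E v1E v1X g0 small tau2 gv0 gv1 c row.
have [r10 rN r8] := ctr; have r0 : 0 < r by lra.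
have r5 : 5 <= r by lra.
have B0 : 0 <= B by rewrite (le_trans _ (good_size ga 0)) // coef_size_ge0.
have eta0 : 0 <= eta by rewrite (le_trans _ (good_mean ga)) // n1_ge0.
have p01 : mode_ix L 0 != mode_ix L N.
  have N1 : (0 < N)%N by rewrite -(ltr0n R); lra.
  by rewrite mode_ix_neq // N1.
have rowE k := etrans (esym (segment_row n a C N r v0 vX t tX s c k)) (row k).
have rest k : \sum_l coupling n a t (mode k) (mode l) *m c l
   = coupling n a t (mode k) (mode k) *m c k
     + \sum_(l | l != k) coupling n a t (mode k) (mode l) *m c l.
  by rewrite (bigD1 k).
have freq0 : freq t 0 = t by rewrite /freq mulr0 addr0.
have [sr1 sr2] := second_resonance ctr tr.
have t0 : 0 <= t by move: tr; rewrite ler_norml; lra.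
have tr5 : `| `|freq t 0| - r| <= 5 by rewrite freq0 (ger0_norm t0); lra.
have v0E' : v0 = n%:R * r * (r - `|freq t 0|) by rewrite freq0 ger0_norm.
have v1E' : v1 = n%:R * r * (r - `|freq t (- N%:Z)|) by rewrite v1E v0E sr2; ring.
have e4 : 1 <= 4 ^+ n :> R by rewrite exprn_ege1 // ler1n.
have K0 : 0 <= 4 * B * 4 ^+ n * (B + 16 ^+ n.+3) / r.
  by rewrite divr_ge0 ?(ltW r0) // !mulr_ge0 ?addr_ge0 ?exprn_ge0.
have small1 : eta + 5 * 4 ^+ n * (1 + 2 * B) / r <= g / 8.
  have : eta <= 4 ^+ n * eta by rewrite ler_peMl.
  by move: small; rewrite mulrDl; set u := _ / r; set v := _ / r in K0 *; lra.
have size0 z : n1 (a 2%N z) <= B.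
  by rewrite (le_trans _ (good_size ga z)) // coef_size_head // lerDl sumr_ge0 // => *; exact: n1_ge0.
have res (p : 'I_(L.*2.+1)) vi vY : `| `|freq t (mode p)| - r| <= 5 ->
    vi = n%:R * r * (r - `|freq t (mode p)|) -> `|vi - vY| <= 1 ->
    decoupled n C N r v0 vX tX p p = r ^+ (n - 2) *: (C - vY%:M) ->
    (let v := (1 - s) * vi + s * vY in
      g * (1 + `|v|) * n1 (c p) <= n1 (C *m c p - v *: c p)) ->
    g / 2 * r ^+ (n - 2) * n1 (c p)
      <= n1 (\sum_(l | l != p) coupling n a t (mode p) (mode l) *m c l).
  move=> xr viE viY dE gv; move: (rowE p); rewrite rest dE => rowp.
  apply: (@resonant_row R n m n_even n_gt2 (coupling n a t (mode p) (mode p)) (a 2%N 0) C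
     (c p) (freq t (mode p)) r s vi vY eta B g) => //; try exact: ltW.
  - have := @coupling_tail R n m n_even n_gt2 a t (mode p) (mode p) r B r5 xr (good_size ga _).
    by rewrite subrr.
  - exact: good_mean ga.
have decE0 : decoupled n C N r v0 vX tX (mode_ix L 0) (mode_ix L 0) = r ^+ (n - 2) *: (C - v0%:M).
  by rewrite /decoupled !eqxx.
have decE1 : decoupled n C N r v0 vX tX (mode_ix L N) (mode_ix L N) = r ^+ (n - 2) *: (C - vX%:M).
  by rewrite /decoupled !eqxx /= eq_sym (negbTE p01).
have row0 : g / 2 * r ^+ (n - 2) * n1 (c (mode_ix L 0))
    <= n1 (\sum_(l | l != mode_ix L 0) coupling n a t (mode (mode_ix L 0)) (mode l) *m c l).
  apply: (res _ v0 v0); rewrite ?mode_ixE ?oppr0 // ?subrr ?normr0 //.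
  by have -> : (1 - s) * v0 + s * v0 = v0 by ring.
have row1 : g / 2 * r ^+ (n - 2) * n1 (c (mode_ix L N))
    <= n1 (\sum_(l | l != mode_ix L N) coupling n a t (mode (mode_ix L N)) (mode l) *m c l).
  by apply: (res _ v1 vX); rewrite ?mode_ixE.
have [w0 w1] := weight_resonant ctr.
have off k l : `|freq t (mode l)| ^+ (n - 2) <= 4 ^+ n * r ^+ (n - 2) ->
    `| `|freq t (mode l)| - r| <= 5 ->
    n1 (a 2%N (mode k - mode l)) <= eta ->
    n1 (coupling n a t (mode k) (mode l)) <=
      (4 ^+ n * eta + 5 * 4 ^+ n * B / r) * r ^+ (n - 2).
  move=> h1 h2 h3; set A := coupling _ _ _ _ _.
  have h4 := @coupling_tail R n m n_even n_gt2 a t (mode k) (mode l) r B r5 h2 (good_size ga _).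
  rewrite -/A in h4; set A2 := _ *: _ in h4.
  have -> : A = (A - A2) + A2 by rewrite subrK.
  rewrite (le_trans (n1D _ _)) // mulrDl addrC.
  have h5 : n1 A2 <= 4 ^+ n * r ^+ (n - 2) * eta.
    by rewrite /A2 n1Z normrX ler_pM ?n1_ge0 ?exprn_ge0.
  rewrite (le_trans (lerD h5 h4)) //.
  by rewrite le_eqVlt; apply/orP; left; apply/eqP; field; lra.
have [_ _ q0 _] := near_resonance n_even n_gt2 r5 tr5 erefl.
have [_ _ q1 _] := near_resonance n_even n_gt2 r5 sr1 erefl.
apply: (@kernel_trivial R _ m (mode_ix L 0) (mode_ix L N) (fun k => weight n r (mode k))
   (fun k => res_weight n N (mode k)) (fun k l => coef_size n a (mode k - mode l))
   (fun k l => coupling n a t (mode k) (mode l)) (tau B r) p01 _ _ _ _ B (4 ^+ n)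
   (r ^+ (n - 2)) (g / 2) (4 ^+ n * eta + 5 * 4 ^+ n * B / r)) => //.
- by move=> k; rewrite exprn_gt0 // ltr_wpDl // addr_ge0 // ltW.
- by move=> k; rewrite divr_ge0 ?exprn_ge0.
- by move=> k l; rewrite coupling_bound // ltW.
- move=> l; apply: column_sums => //; exact: good_square ga _ _.
- by move=> k l; exact: good_size ga _.
- by rewrite exprn_gt0.
- by rewrite mode_ixE.
- by rewrite mode_ixE.
- apply: off; rewrite ?mode_ixE ?oppr0 ?sub0r ?opprK //.
  exact: (good_tail ga).
- by apply: off; rewrite ?mode_ixE ?oppr0 ?subr0 //; apply: (good_tail ga); rewrite abszN.
- apply: (@le_lt_trans _ _ (g / 16)); last lra.
  apply: le_trans small; rewrite -addrA lerD2l /tau.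
  have -> : 4 * B * ((B + 16 ^+ n.+3) / r) * 4 ^+ n = 4 * B * 4 ^+ n * (B + 16 ^+ n.+3) / r by ring.
  rewrite -mulrDl ler_wpM2r ?invr_ge0 ?(ltW r0) // lerD2r ler_wpM2l ?mulr_ge0 ?exprn_ge0 //; lra.
- by rewrite /tau divr_ge0 ?(ltW r0) // addr_ge0 // exprn_ge0.
- move=> k k0 k1; apply: (@off_resonant_of_row a L N r t tX s k) => //.
  move: (rowE k); rewrite [decoupled _ _ _ _ _ _ _ k k]/decoupled eqxx /=.
  by rewrite (negbTE k0) (negbTE k1).
Qed.

End GalerkinTheorem.

(** * Nonzero solutions of the finite systems *)

Section GalerkinExistence.
Context {R : realType} (n m : nat).
Hypothesis n_even : ~~ odd n.
Hypothesis n_gt2 : (2 < n)%N.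

Lemma finite_lower_bound (I : finType) (f : I -> R) :
  (forall i, 0 < f i) -> exists2 e, 0 < e & forall i, e <= f i.
Proof.
move=> f0; pose S := 1 + \sum_i (f i)^-1.
have S0 : 0 < S by rewrite ltr_wpDr // sumr_ge0 // => i _; rewrite invr_ge0 ltW.
exists S^-1 => [|i]; first by rewrite invr_gt0.
rewrite -[f i]invrK lef_pV2 ?posrE ?invr_gt0 //.
rewrite /S (bigD1 i) //= addrCA lerDl addr_ge0 // sumr_ge0 // => k _.
by rewrite invr_ge0 ltW.
Qed.

Lemma center_exists (r : R) (N0 : nat) : 10 <= r -> 8 * N0%:R <= r ->
  exists2 N, center_ok r N & (N0 <= N)%N.
Proof.
move=> r10 rN0; have pi0 := @pi_gt0 R; have pi4 : pi <= 4 :> R by have := @pihalf_lt2 R; lra.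
have q0 : 0 <= r / pi + 2^-1 by rewrite addr_ge0 // divr_ge0 // ?ltW //; lra.
exists (Num.truncn (r / pi + 2^-1)).
  have /andP[h1 h2] := truncn_itv q0; set N := Num.truncn _ in h1 h2 *.
  rewrite -[N.+1%:R]natr1 in h2.
  set q := r / pi in h1 h2; have rE : r = q * pi by rewrite /q divfK // gt_eqF.
  have b1 : N%:R * pi <= (q + 2^-1) * pi by rewrite ler_wpM2r // ltW.
  have b2 : (q + 2^-1) * pi <= (N%:R + 1) * pi by rewrite ler_wpM2r // ltW.
  have b3 : N%:R * pi <= N%:R * 4 :> R by apply: ler_wpM2l.
  split=> //; first by rewrite ler_norml; move: b1 b2; rewrite !mulrDl -rE; lra.
  by move: b2; rewrite !mulrDl -rE; lra.
have /andP[h1 h2] := truncn_itv q0; set N := Num.truncn _ in h1 h2 *.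
rewrite -(ler_nat R) -(ler_pM2l (_ : 0 < 8)) //.
rewrite -[N.+1%:R]natr1 in h2.
set q := r / pi in h1 h2; have rE : r = q * pi by rewrite /q divfK // gt_eqF.
have b2 : (q + 2^-1) * pi <= (N%:R + 1) * pi by rewrite ler_wpM2r // ltW.
have b3 : N%:R * pi <= N%:R * 4 :> R by apply: ler_wpM2l.
by move: b2; rewrite !mulrDl -rE; lra.
Qed.

Definition galerkin_solution (a : nat -> int -> 'M[R]_m) (r : R) L t
    (c : 'I_(L.*2.+1) -> 'cV[R]_m) : Prop :=
  forall k, (freq t (mode k) ^+ n - r ^+ n) *: c k
    + \sum_l coupling n a t (mode k) (mode l) *m c l = 0.

(** At u = mu j + e and u = mu j - e the first resonant block C - u has determinants of
    opposite signs. The second one, C - (S - u), stays invertible because j is chosen such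
    that S - mu j keeps away from the real eigenvalues. By the homotopy to the decoupled
    systems the determinant of the full system has opposite signs at the two corresponding
    quasimomenta, and vanishes in between. *)
Theorem galerkin_solution_exists (C : 'M[R]_m) s (mu : 'I_s -> R) (j1 j2 j3 : 'I_s) (B : R) :
  injective mu ->
  (forall z, root (char_poly C) z -> exists i, mu i = z) ->
  odd (mup (mu j1) (char_poly C)) -> odd (mup (mu j2) (char_poly C)) ->
  odd (mup (mu j3) (char_poly C)) -> min_diam mu j1 j2 j3 <> 0 -> 0 <= B ->
  exists2 eta : R, 0 < eta & forall N0 : nat, exists r0 : R, forall r, r0 <= r ->
  exists N, [/\ center_ok r N, tau n B r <= 2^-1 &
    forall a, good_coefs n C B eta N0 a -> forall L, (N <= L)%N ->
    exists t (c : 'I_(L.*2.+1) -> 'cV[R]_m),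
      [/\ `|t - r| <= 1, exists k, c k != 0 & galerkin_solution a r t c]].
Proof.
move=> muI rootC o1 o2 o3 md B0; have [d d0 gapP] := gap_choice md.
have [e1 e10 sep] : exists2 e, 0 < e & forall p : 'I_s * 'I_s,
    e <= (if p.1 == p.2 then 1 else `|mu p.1 - mu p.2|).
  apply: finite_lower_bound => -[i j] /=; case: eqVneq => // ij.
  by rewrite normr_gt0 subr_eq0; apply: contraNneq ij => /muI ->.
(* The number e isolates mu j from the other eigenvalues, leaves S - mu j with its
   neighbourhood of radius e at distance e from all of them, and lets the two values of S -
   u differ by at most 1. *)
pose e := Num.min (Num.min (d / 2) (e1 / 2)) 2^-1.
have e0 : 0 < e by rewrite !lt_min !divr_gt0 //= invr_gt0.
have ed : e <= d / 2 by rewrite !ge_min lexx.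
have ee1 : e <= e1 / 2 by rewrite !ge_min lexx orbT.
have eh : e <= 2^-1 by rewrite !ge_min lexx !orbT.
have [g g0 gP] := resolvent_bound C e0.
pose Big := 5 * 4 ^+ n * (1 + 2 * B) + 4 * B * 4 ^+ n * (B + 16 ^+ n.+3).
have Big0 : 0 <= Big by rewrite addr_ge0 // !mulr_ge0 ?addr_ge0 ?exprn_ge0 ?mulr_ge0.
have e4 : 0 < 4 ^+ n :> R by rewrite exprn_gt0.
exists (g / (32 * 4 ^+ n)) => [|N0]; first by rewrite divr_gt0 // mulr_gt0.
pose M := \sum_i `|mu i| + 1.
pose T := 2 * (B + 16 ^+ n.+3).
have T0 : 0 <= T by rewrite mulr_ge0 // addr_ge0 // exprn_ge0.
have M0 : 0 <= M by rewrite addr_ge0 // sumr_ge0.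
have BigG : 0 <= 32 * Big / g by rewrite divr_ge0 ?mulr_ge0 // ltW.
have N00 : 0 <= 8 * N0%:R :> R by rewrite mulr_ge0.
exists (10 + 8 * N0%:R + 32 * Big / g + T + M) => r rr0.
have r10 : 10 <= r by lra.
have r0 : 0 < r by lra.
have [|N ctr N0N] := @center_exists r N0 r10; first by lra.
have tau2 : tau n B r <= 2^-1.
  by rewrite /tau ler_pdivrMr //; move: rr0; rewrite /T; lra.
exists N; split=> // a ga L NL.
set eta := g / (32 * 4 ^+ n) in ga.
have small : 4 ^+ n * eta + Big / r <= g / 16.
  have -> : 4 ^+ n * eta = g / 32 by rewrite /eta; field; rewrite gt_eqF.
  suff : Big / r <= g / 32 by lra.
  rewrite ler_pdivrMr //; have : 32 * Big / g <= r by lra.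
  by rewrite ler_pdivrMr //; lra.
pose S := n%:R * r * (2 * r - 2 * pi * N%:R).
have [j jin jP] := gapP S.
have oj : odd (mup (mu j) (char_poly C)).
  by move: jin; rewrite !inE => /or3P[] /eqP ->.
have muj : `|mu j| <= M - 1.
  by rewrite /M addrK (bigD1 j) //= lerDl sumr_ge0.
have n0 : 0 < n%:R :> R by rewrite ltr0n (ltn_trans _ n_gt2).
have n1' : 1 <= n%:R :> R by rewrite ler1n (ltn_trans _ n_gt2).
have nr0 : 0 < n%:R * r by rewrite mulr_gt0.
pose tt (u : R) := r - u / (n%:R * r).
have ttE u : u = n%:R * r * (r - tt u) by rewrite /tt; field; rewrite !gt_eqF.
have ttr u : `|u - mu j| <= e -> `|tt u - r| <= 1.
  move=> uj; rewrite /tt addrAC subrr add0r normrN normrM normfV (gtr0_norm nr0).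
  rewrite ler_pdivrMr // mul1r; have : r <= n%:R * r by rewrite ler_peMl // ltW.
  have := ler_normD (u - mu j) (mu j); rewrite subrK; lra.
have rootsep u : `|u - mu j| = e -> forall z, root (char_poly C) z -> e <= `|u - z|.
  move=> uj z /rootC [i <-]; have [->|ij] := eqVneq i j; first by rewrite uj.
  have := sep (i, j); rewrite /= (negbTE ij) => s2.
  have := ler_normD (mu i - u) (u - mu j).
  by rewrite addrA subrK [`|mu i - u|]distrC; lra.
have rootsepS v : `|v - (S - mu j)| <= e -> forall z, root (char_poly C) z -> e <= `|v - z|.
  move=> vj z /rootC [i <-]; have := jP i.
  have := ler_normD (S - mu j - v) (v - mu i).
  by rewrite addrA subrK [`|S - mu j - v|]distrC; lra.
pose u1 := mu j + e; pose u2 := mu j - e.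
have u1j : `|u1 - mu j| = e by rewrite /u1 addrAC subrr add0r gtr0_norm.
have u2j : `|u2 - mu j| = e by rewrite /u2 addrAC subrr add0r normrN gtr0_norm.
(* The same value is used for the second block at both ends; otherwise the decoupled systems
   would differ in more than the first block. *)
pose vX := S - u1.
have vconv (s' v : R) : 0 <= s' <= 1 -> `|v - (S - mu j)| <= e ->
    `|(1 - s') * v + s' * vX - (S - mu j)| <= e.
  move=> s01 hv; have hX : `|vX - (S - mu j)| <= e.
    have -> : vX - (S - mu j) = - (u1 - mu j) by rewrite /vX; ring.
    by rewrite normrN u1j.
  have -> : (1 - s') * v + s' * vX - (S - mu j)
     = (1 - s') * (v - (S - mu j)) + s' * (vX - (S - mu j)) by ring.
  have s0 : 0 <= s' by case/andP: s01.
  have s1 : 0 <= 1 - s' by rewrite subr_ge0; case/andP: s01.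
  rewrite (le_trans (ler_normD _ _)) // !normrM (ger0_norm s0) (ger0_norm s1).
  have := ler_wpM2l s1 hv; have := ler_wpM2l s0 hX; lra.
have tord : tt u1 <= tt u2.
  rewrite /tt lerD2l lerN2 ler_pM2r ?invr_gt0 // /u1 /u2; lra.
have NLL : (N0 <= N <= L)%N by rewrite N0N.
have N1 : (0 < N <= L)%N.
  have [_ _ r8] := ctr; rewrite NL andbT -(ltr0n R); lra.
have p01 := mode_ix_neq N1.
have kf u : `|u - mu j| = e -> `|S - u - vX| <= 1 -> forall s', 0 <= s' <= 1 ->
   kerfree (segment (fun k l => map_mx (horner_eval (tt u)) (galerkin_mx n a r k l))
           (@decoupled R n m C L N r u vX (tt u1)) s').
  move=> uj uX s' s01.
  apply: (galerkin_segment n_even n_gt2 ga ctr NLL _ _ s01 (ttE u) (erefl _) uX g0) => //.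
  - by apply: ttr; rewrite uj.
  - by apply: ttr; rewrite u1j.
  - by move=> x; apply: gP; exact: rootsep.
  - move=> x /=; apply: gP; apply: rootsepS; apply: vconv => //.
    have -> : S - u - (S - mu j) = - (u - mu j) by ring.
    by rewrite normrN uj.
have decE v k l : k != mode_ix L 0 -> l != mode_ix L 0 ->
    @decoupled R n m C L N r u1 v (tt u1) k l = decoupled n C N r u2 v (tt u1) k l.
  by move=> /negbTE k0 _; rewrite /decoupled k0.
have dec0 u v k : k != mode_ix L 0 ->
    @decoupled R n m C L N r u v (tt u1) (mode_ix L 0) k = 0 /\
    decoupled n C N r u v (tt u1) k (mode_ix L 0) = 0.
  by move=> k0; rewrite /decoupled k0 eq_sym k0.
have detE u v : \det (@decoupled R n m C L N r u v (tt u1) (mode_ix L 0) (mode_ix L 0))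
    = (- r ^+ (n - 2)) ^+ m * (char_poly C).[u].
  rewrite /decoupled !eqxx /= /char_poly -horner_evalE -det_map_mx -detZ.
  have -> : map_mx (horner_eval u) (char_poly_mx C) = u%:M - C.
    by apply/matrixP => i k; rewrite !mxE /horner_eval !hornerE hornerMn hornerX.
  by rewrite scaleNr -scalerN opprB.
have uX1 : `|S - u1 - vX| <= 1 by rewrite /vX subrr normr0.
have uX2 : `|S - u2 - vX| <= 1.
  have -> : S - u2 - vX = 2 * e by rewrite /vX /u1 /u2; ring.
  by rewrite ger0_norm; lra.
have dX : \det (@decoupled R n m C L N r u1 vX (tt u1) (mode_ix L 0) (mode_ix L 0))
    * \det (@decoupled R n m C L N r u2 vX (tt u1) (mode_ix L 0) (mode_ix L 0)) < 0.
  have iso x : root (char_poly C) x -> `|x - mu j| <= e -> x = mu j.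
    move=> /rootC [i <-] ij; have [->//|nij] := eqVneq i j.
    by have := sep (i, j); rewrite /= (negbTE nij); lra.
  have := odd_root_sign e0 (monic_neq0 (char_poly_monic C)) oj iso.
  rewrite -/u1 -/u2 !detE; set p1 := _.[u1]; set p2 := _.[u2]; set q := (- _) ^+ m.
  have q0 : 0 < q ^+ 2.
    by rewrite exprn_even_gt0 //= expf_neq0 // oppr_eq0 expf_neq0 // gt_eqF.
  have -> : q * p1 * (q * p2) = q ^+ 2 * (p2 * p1) by ring.
  by move=> h; rewrite pmulr_rlt0.
have [t t12 [c c0 cE]] := family_kernel (M := galerkin_mx n a r)
   (X1 := decoupled n C N r u1 vX (tt u1)) (X2 := decoupled n C N r u2 vX (tt u1)) tord
   (dec0 u1 vX) (dec0 u2 vX) (decE vX)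
   dX (kf u1 u1j uX1) (kf u2 u2j uX2).
exists t, c; split=> //.
  have h1 : `|tt u1 - r| <= 1 by apply: ttr; rewrite u1j.
  have h2 : `|tt u2 - r| <= 1 by apply: ttr; rewrite u2j.
  by move: h1 h2 t12; rewrite !ler_norml; lra.
move=> k; have := cE k; under eq_bigr do rewrite galerkin_eval mulmxDl.
rewrite big_split /=; congr (_ + _ = _).
rewrite (bigD1 k) //= eqxx mul_scalar_mx big1 ?addr0 // => l.
by rewrite eq_sym => /negbTE ->; rewrite mul0mx.
Qed.

(** The equations at the modes outside resonance alone leave at least half of the mass to
    the two resonant modes, and make the other components decay like the inverse of z (z +
    N). *)
Lemma galerkin_mass (a : nat -> int -> 'M[R]_m) C B eta N0 r N L t
    (c : 'I_(L.*2.+1) -> 'cV[R]_m) :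
  good_coefs n C B eta N0 a -> center_ok r N -> (N <= L)%N ->
  `|t - r| <= 1 -> tau n B r <= 2^-1 -> galerkin_solution a r t c ->
  let G := mass (fun k => weight n r (mode k)) c in
  G <= 2 * (4 ^+ n * r ^+ (n - 2)) * (n1 (c (mode_ix L 0)) + n1 (c (mode_ix L N))) /\
  forall k, k != mode_ix L 0 -> k != mode_ix L N ->
    weight n r (mode k) * n1 (c k) <= res_weight n N (mode k) * (B * G).
Proof.
move=> ga ctr NL tr tau2 sol G; have [r10 rN r8] := ctr.
have r0 : 0 < r by lra.
have w0 (k : 'I_(L.*2.+1)) : 0 < weight n r (mode k).
  by rewrite exprn_gt0 // ltr_wpDl // addr_ge0 // ltW.
have h0 (k : 'I_(L.*2.+1)) : 0 <= res_weight n N (mode k) :> R.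
  by rewrite divr_ge0 ?exprn_ge0.
have nA (k l : 'I_(L.*2.+1)) : n1 (coupling n a t (mode k) (mode l))
    <= coef_size n a (mode k - mode l) * weight n r (mode l).
  by rewrite coupling_bound // ltW.
have off : off_resonant (mode_ix L 0) (mode_ix L N) (fun k => weight n r (mode k))
    (fun k => res_weight n N (mode k)) (fun k l => coupling n a t (mode k) (mode l)) c.
  move=> k k0 k1; apply: (@off_resonant_of_row R n m n_even n_gt2 a L N r t t 0 k) => //.
    by rewrite lexx ler01.
  by rewrite subr0 scale1r scale0r addr0 (sol k).
have N1 : (0 < N <= L)%N by rewrite NL andbT -(ltr0n R); lra.
have [w1 w2] := weight_resonant n ctr.
split.
  have := mass_le_resonant (mode_ix_neq N1) w0 h0 nA
     (fun l => column_sums r0 r8 NL (good_square ga L (mode l))) off tau2.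
  move=> /le_trans; apply; rewrite -mulrA ler_pM2l // mulrDr lerD // ler_wpM2r ?n1_ge0 //.
    by rewrite mode_ixE // oppr0.
  by rewrite mode_ixE.
move=> k k0 k1; rewrite (le_trans (off k k0 k1)) // ler_wpM2l //.
have := @image_bound R _ m _ (fun k l => coef_size n a (mode k - mode l)) _ nA predT c k.
move=> /le_trans; apply; rewrite /G /mass mulr_sumr ler_sum // => l _.
by rewrite ler_wpM2r ?mulr_ge0 ?n1_ge0 ?(ltW (w0 _)) // (good_size ga).
Qed.

End GalerkinExistence.

(** * Maps preserving Lebesgue measure and periodic integrals *)

Section LebesgueInvariance.
Context {R : realType}.
Local Notation mu := (@lebesgue_measure R).
Local Open Scope ereal_scope.

Definition preserving (phi : R -> R) : Prop :=
  measurable_fun setT phi /\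
  forall A, measurable A -> mu (phi @^-1` A) = mu A.

Lemma preserving_shift (c : R) : preserving (fun x => x + c)%R.
Proof.
have mphi : measurable_fun setT (fun x : R => (x + c)%R) by exact: measurable_funD.
split=> // A mA.
pose m := isMeasurableFun.Build _ _ (measurableTypeR R) (measurableTypeR R) _ mphi.
pose F : {mfun measurableTypeR R >-> measurableTypeR R} :=
  HB.pack (fun x : R => (x + c)%R) m.
apply/esym; apply: (@lebesgue_measure_unique R (pushforward mu F) _ A mA).
move=> _ [[a b]] _ <-.
rewrite [RHS](_ : _ = mu `](a - c)%R, (b - c)%R]); last first.
  congr (mu _); by apply/seteqP; split => x /=; rewrite !in_itv /= ltrBlDr lerBrDr.
rewrite !lebesgue_measure_itv /= !lte_fin ltrD2r.
by case: ifP => // _; rewrite -!EFinB; congr (_%:E); ring.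
Qed.

Lemma preserving_reflection (c : R) : preserving (fun x => c - x)%R.
Proof.
have mphi : measurable_fun setT (fun x : R => (c - x)%R) by exact: measurable_funB.
split=> // A mA; have [ms sA] := preserving_shift c.
have -> : (fun x : R => (c - x)%R) @^-1` A = -%R @^-1` ((fun x : R => (x + c)%R) @^-1` A).
  by apply/seteqP; split => x /=; rewrite addrC.
rewrite -(sA A mA); apply: (@lebesgue_measureN R).
by rewrite -[_ @^-1` _]setTI; exact: ms.
Qed.

Lemma preserving_integral phi (D : set R) (f : R -> \bar R) : preserving phi ->
  measurable D -> measurable_fun D f -> (forall x, D x -> 0 <= f x) ->
  \int[mu]_(x in phi @^-1` D) f (phi x) = \int[mu]_(x in D) f x.
Proof.
move=> [mphi phiE] mD mf f0; apply/esym.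
have := @ge0_integral_pushforward _ _ (measurableTypeR R) (measurableTypeR R) R phi mphi mu D f
  mD mf; rewrite /comp => <-; last by move=> x /set_mem; exact: f0.
by apply: eq_measure_integral => A mA AD; exact/esym/phiE.
Qed.

Lemma preserving_ae phi (P : R -> Prop) : preserving phi ->
  {ae mu, forall x, P x} -> {ae mu, forall x, P (phi x)}.
Proof.
move=> [mphi phiE] [N [mN N0 PN]]; exists (phi @^-1` N); split.
- by rewrite -[_ @^-1` _]setTI; exact: mphi.
- by rewrite -N0; exact: phiE.
- by move=> x /= nP; apply: PN.
Qed.

Lemma ae_imp2 (P Q S : R -> Prop) : (forall x, P x -> Q x -> S x) ->
  {ae mu, forall x, P x} -> {ae mu, forall x, Q x} -> {ae mu, forall x, S x}.
Proof.
move=> h hP hQ; have F := @ae_filter_ringOfSetsType _ _ _ mu.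
exact: (@filterS2 _ _ F _ _ _ h hP hQ).
Qed.

Lemma ae_imp (P S : R -> Prop) : (forall x, P x -> S x) ->
  {ae mu, forall x, P x} -> {ae mu, forall x, S x}.
Proof. by move=> h hP; apply: (@ae_imp2 P P S _ hP hP) => x px _; exact: h. Qed.

End LebesgueInvariance.

Section PeriodicIntegral.
Context {R : realType}.
Local Notation mu := (@lebesgue_measure R).
Local Open Scope ereal_scope.

Lemma periodic_int (T : Type) (f : R -> T) : (forall x, f (x + 1)%R = f x) ->
  forall (z : int) x, f (x + z%:~R)%R = f x.
Proof.
move=> fp; have pn (k : nat) x : f (x + k%:R)%R = f x.
  by elim: k x => [|k IH] x; rewrite ?addr0 // -natr1 addrA fp IH.
move=> [k|k] x; first exact: pn.
by rewrite NegzE intrN -[in RHS](subrK (k.+1%:R)%R x) pn.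
Qed.

Lemma periodic_cells (f : R -> R) (k : nat) (z : int) :
  measurable_fun setT f -> (forall x, 0 <= f x)%R -> (forall x, f (x + 1)%R = f x) ->
  \int[mu]_(x in `[(z%:~R : R), (z%:~R + k%:R)%R[) (f x)%:E
  = k%:R%:E * \int[mu]_(x in `[0%R, 1%R[) (f x)%:E.
Proof.
move=> mf f0 fp; have mfD (D : set R) : measurable_fun D (fun x => (f x)%:E).
  exact/measurable_EFinP/measurable_funTS.
elim: k => [|k IH]; first by rewrite addr0 set_itvco0 integral_set0 mul0e.
have cell (w : int) : \int[mu]_(x in `[(w%:~R : R), (w%:~R + 1)%R[) (f x)%:E
   = \int[mu]_(x in `[0%R, 1%R[) (f x)%:E.
  rewrite -(@preserving_integral R _ `[0%R, 1%R[%classic _ (preserving_shift (- w%:~R)%R)) //.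
    have -> : (fun x : R => (x - w%:~R)%R) @^-1` `[0%R, 1%R[%classic = `[w%:~R, (w%:~R + 1)%R[%classic.
      by apply/seteqP; split => x /=; rewrite !in_itv /= subr_ge0 ltrBlDl.
    apply: eq_integral => x _; congr (_%:E).
    by rewrite -[RHS](periodic_int fp w) subrK.
  by move=> x _; rewrite lee_fin.
have -> : `[z%:~R, (z%:~R + k.+1%:R)%R[%classic =
  `[z%:~R, (z%:~R + k%:R)%R[%classic `|` `[(z + k%:Z)%:~R, ((z + k%:Z)%:~R + 1)%R[%classic :> set R.
  apply/seteqP; split => x /=; rewrite !in_itv /= intrD -natr1 addrA -pmulrn.
    by case: (ltP x (z%:~R + k%:R)%R) => h /andP[h1 h2]; [left|right]; rewrite ?h1 ?h ?h2.
  have k0 : (0 <= k%:R :> R)%R by [].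
  by case=> /andP[h1 h2]; apply/andP; split; lra.
rewrite ge0_integral_setU //; last 3 first.
- exact: mfD.
- by move=> x xU; rewrite lee_fin.
- apply/disj_setPS => x /= [].
  rewrite !in_itv /= intrD -pmulrn => /andP[_ h1] /andP[h2 _].
  by move: h1; rewrite ltNge h2.
by rewrite IH cell -[in RHS]natr1 EFinD ge0_muleDl ?lee_fin // mul1e.
Qed.

End PeriodicIntegral.

(** * Uniform approximation by polynomials in a squared cosine *)

Section CosineWeierstrass.
Context {R : realType}.

(** This is the square of cos (pi x): a generator of the even functions of period 1 with
    values in the unit interval, where Bernstein polynomials converge. *)
Definition csq (x : R) : R := (1 + cos (2 * pi * x)) / 2.

Lemma csq01 x : 0 <= csq x <= 1.
Proof. by rewrite /csq; have := cos_geN1 (2 * pi * x); have := cos_le1 (2 * pi * x); lra. Qed.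

Lemma continuous_csq : continuous csq.
Proof.
move=> x; rewrite /csq; apply: cvgMl; apply: cvgD; first exact: cvg_cst.
apply: (@continuous_comp _ _ _ (fun x => 2 * pi * x) cos); last exact: continuous_cos.
by apply: cvgMr; exact: cvg_id.
Qed.

(** The Bernstein polynomial of the values f 0, ..., f N by the recursion of de Casteljau:
    in this form positivity and moments follow by induction, without binomial coefficients.
    *)
Fixpoint bern (N : nat) (f : nat -> R) : {poly R} :=
  if N is N'.+1 then 'X * bern N' (fun k => f k.+1) + (1 - 'X) * bern N' f
  else (f 0%N)%:P.

Lemma bern_close N f h (c s : R) : 0 <= s <= 1 ->
  (forall k, (k <= N)%N -> `|f k - c| <= h k) ->
  `|(bern N f).[s] - c| <= (bern N h).[s].
Proof.
move=> /andP[s0 s1]; elim: N f h => [|N IH] f h fh /=.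
  by rewrite !hornerC fh.
rewrite !hornerE.
have h1 := IH _ _ (fun k (kN : (k <= N)%N) => fh k.+1 kN).
have h2 := IH _ _ (fun k (kN : (k <= N)%N) => fh k (leqW kN)).
have -> : s * (bern N (fun k => f k.+1)).[s] + (1 - s) * (bern N f).[s] - c
  = s * ((bern N (fun k => f k.+1)).[s] - c) + (1 - s) * ((bern N f).[s] - c) by ring.
have s1' : 0 <= 1 - s by lra.
rewrite (le_trans (ler_normD _ _)) // !normrM (ger0_norm s0) (ger0_norm s1').
by rewrite lerD // ler_wpM2l.
Qed.

Lemma bern_ext N f h : f =1 h -> bern N f = bern N h.
Proof.
by elim: N f h => [|N IH] f h fh /=; rewrite ?fh // (IH _ _ fh) (IH _ (fun k => h k.+1)).
Qed.

(** The second moment of the binomial law about a: squared bias plus variance. *)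
Lemma bern_variance N (A M a s : R) :
  (bern N (fun k => A + M * (k%:R - a) ^+ 2)).[s]
  = A + M * ((N%:R * s - a) ^+ 2 + N%:R * s * (1 - s)).
Proof.
elim: N a => [|N IH] a /=; first by rewrite hornerC; ring.
rewrite (@bern_ext N _ (fun k => A + M * (k%:R - (a - 1)) ^+ 2)); last first.
  by move=> k; rewrite -natr1; ring.
by rewrite !hornerE !IH -natr1; ring.
Qed.

Lemma unif_continuous_itv (g : R -> R) (a b e : R) : continuous g -> 0 < e ->
  exists2 d, 0 < d & forall x y, a <= x <= b -> `|x - y| < d -> `|g x - g y| < e.
Proof.
move=> cg e0; have := @segment_compact R a b => /compact_near_coveringP cov.
have e20 : 0 < e / 2 by rewrite divr_gt0.
have {cov} := cov R (0 : R)^'+ (fun d x => forall y, `|x - y| < d -> `|g x - g y| < e) _ _.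
case=> [|].
  move=> x _; have := cg x => /cvgrPdist_lt /(_ _ e20).
  move=> [r /= r0 rP]; have r20 : 0 < r / 2 by rewrite divr_gt0.
  exists (ball x (r / 2), [set d | d < r / 2]) => /=.
    by split; [exact: nbhsx_ballx | exact: nbhs_right_lt].
  move=> [x' d] /= [xx' dr] y x'y.
  have h1 : `|x - x'| < r by rewrite (lt_trans xx') //; lra.
  have h2 : `|x - y| < r.
    have := ler_normD (x - x') (x' - y); rewrite addrA subrK.
    by move: xx'; rewrite /ball /=; lra.
  have := rP x' h1; have := rP y h2; have := ler_normD (g x' - g x) (g x - g y).
  rewrite addrA subrK [`|g x' - g x|]distrC; lra.
move=> d /= d0 dP; exists (d / 2); first by rewrite divr_gt0.
move=> x y xab; apply: (dP (d / 2)) => //=; rewrite ?divr_gt0 //.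
by rewrite sub0r normrN gtr0_norm ?divr_gt0 //; lra.
Qed.

(** The difference is sin (pi (x + y)) sin (pi (y - x)), and on half a period both arguments
    stay away from the multiples of pi. *)
Lemma csq_gap (d : R) : 0 < d -> exists2 c, 0 < c &
  forall x y, 0 <= x <= 2^-1 -> 0 <= y <= 2^-1 -> d <= `|x - y| -> c <= `|csq x - csq y|.
Proof.
move=> d0; pose d' := Num.min d 2^-1.
have d'0 : 0 < d' by rewrite lt_min d0 invr_gt0 ltr0n.
have d'd : d' <= d by rewrite ge_min lexx.
have d'h : d' <= 2^-1 by rewrite ge_min lexx orbT.
have pi0 := @pi_gt0 R.
pose sg := sin (pi * d').
have sg0 : 0 < sg.
  apply: sin_gt0_pi; rewrite mulr_gt0 //=.
  by rewrite -[ltRHS]mulr1 ltr_pM2l //; lra.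
have sin_ge u : pi * d' <= u <= pi - pi * d' -> sg <= sin u.
  have half : pi * d' <= pi / 2 by rewrite ler_pM2l.
  have pd0 : 0 < pi * d' by rewrite mulr_gt0.
  have mono v : pi * d' <= v -> v <= pi / 2 -> sg <= sin v.
    move=> v1 v2; rewrite /sg leNgt ltr_sin ?in_itv /=; last 2 first.
    - by apply/andP; split; lra.
    - by apply/andP; split; lra.
    by rewrite -leNgt.
  move=> /andP[u1 u2]; have [h|h] := leP u (pi / 2); first exact: mono.
  have -> : sin u = sin (pi - u) by rewrite sinB sinpi cospi; ring.
  by apply: mono; lra.
exists (sg * sg) => [|x y]; first by rewrite mulr_gt0.
wlog xy : x y / x <= y.
  move=> H hx hy; have [|/ltW] := leP x y; first by move/H; apply.
  by move/H; rewrite distrC [`|csq x - _|]distrC; apply.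
move=> /andP[x0 x1] /andP[y0 y1]; rewrite distrC ger0_norm ?subr_ge0 // => dxy.
have -> : csq x - csq y = sin (pi * (x + y)) * sin (pi * (y - x)).
  rewrite /csq; have -> : 2 * pi * x = pi * (x + y) - pi * (y - x) by ring.
  have -> : 2 * pi * y = pi * (x + y) + pi * (y - x) by ring.
  by rewrite cosB cosD; field.
rewrite (le_trans _ (ler_norm _)) // ler_pM ?(ltW sg0) // sin_ge //.
  apply/andP; split; first by rewrite ler_pM2l //; lra.
  have -> : pi - pi * d' = pi * (1 - d') by ring.
  by rewrite ler_pM2l //; lra.
apply/andP; split; first by rewrite ler_pM2l //; lra.
have -> : pi - pi * d' = pi * (1 - d') by ring.
  by rewrite ler_pM2l //; lra.
Qed.

Lemma csq_onto (s : R) : 0 <= s <= 1 -> exists2 x, 0 <= x <= 2^-1 & csq x = s.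
Proof.
move=> s01; have pi0 := @pi_gt0 R; have s11 : -1 <= 2 * s - 1 <= 1 by lra.
exists (acos (2 * s - 1) / (2 * pi)).
  rewrite divr_ge0 ?acos_ge0 ?mulr_ge0 ?(ltW pi0) //= ler_pdivrMr ?mulr_gt0 //.
  by have := acos_lepi s11; lra.
rewrite /csq; have -> : 2 * pi * (acos (2 * s - 1) / (2 * pi)) = acos (2 * s - 1).
  by rewrite mulrCA mulfV ?mulr1 // mulf_neq0 // gt_eqF.
by rewrite acosK ?in_itv //; field.
Qed.

(** Bernstein's argument: where x and y are close the oscillation of g is small, and
    elsewhere it is bounded by a multiple of (csq x - csq y) ^ 2, of which the Bernstein
    polynomial of degree N is of order 1 / N. *)
Lemma cosine_weierstrass (g : R -> R) (K e : R) : continuous g ->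
  (forall x, `|g x| <= K) -> 0 < e ->
  exists q : {poly R}, forall x, 0 <= x <= 2^-1 -> `|q.[csq x] - g x| <= e.
Proof.
move=> cg gK e0; have K0 : 0 <= K by rewrite (le_trans _ (gK 0)).
have e20 : 0 < e / 2 by rewrite divr_gt0.
have [d d0 dP] := unif_continuous_itv 0 2^-1 cg e20.
have [c c0 cP] := csq_gap d0.
pose M := 2 * K / c ^+ 2.
have M0 : 0 <= M by rewrite !mulr_ge0 // invr_ge0 exprn_ge0 // ltW.
have gM x y : 0 <= x <= 2^-1 -> 0 <= y <= 2^-1 ->
    `|g x - g y| <= e / 2 + M * (csq x - csq y) ^+ 2.
  move=> hx hy; have [dxy|dxy] := ltP `|x - y| d.
    by rewrite (le_trans (ltW (dP x y hx dxy))) // lerDl mulr_ge0 ?sqr_ge0.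
  apply: (@le_trans _ _ (2 * K)).
    by have := ler_normB (g x) (g y); have := gK x; have := gK y; lra.
  rewrite ler_wpDl ?(ltW e20) // /M mulrAC ler_pdivlMr ?exprn_gt0 //.
  rewrite ler_wpM2l ?mulr_ge0 // -[(_ - _) ^+ 2]real_normK ?num_real //.
  by rewrite lerXn2r ?nnegrE ?(ltW c0) // cP.
pose N := (Num.truncn (2 * M / e)).+1.
have N0 : 0 < N%:R :> R by rewrite ltr0n.
have NM : M / N%:R <= e / 2.
  have /andP[_ h] : (Num.truncn (2 * M / e))%:R <= 2 * M / e < N%:R.
    by apply: truncn_itv; apply: divr_ge0; [exact: mulr_ge0 | exact: ltW].
  rewrite ler_pdivrMr //; move: h; rewrite ltr_pdivrMr //; lra.
have node (k : nat) : exists x, (k <= N)%N -> 0 <= x <= 2^-1 /\ csq x = k%:R / N%:R.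
  have [kN|kN] := leqP k N; last by exists 0.
  have [|x x1 x2] := @csq_onto (k%:R / N%:R); last by exists x.
  by rewrite divr_ge0 //= ler_pdivrMr // mul1r ler_nat.
have [xs xsP] := choice node.
exists (bern N (fun k => g (xs k))) => x hx.
have := @bern_close N (fun k => g (xs k))
  (fun k => e / 2 + M / N%:R ^+ 2 * (k%:R - N%:R * csq x) ^+ 2) (g x) (csq x) (csq01 x).
rewrite bern_variance => /(_ _)/le_trans -> //.
  move=> k kN; have [xk1 xk2] := xsP k kN.
  rewrite (le_trans (gM _ _ xk1 hx)) // lerD2l xk2.
  rewrite le_eqVlt; apply/orP; left; apply/eqP; field; exact: lt0r_neq0.
have [s0 s1] := andP (csq01 x).
have -> : M / N%:R ^+ 2 * ((N%:R * csq x - N%:R * csq x) ^+ 2 + N%:R * csq x * (1 - csq x))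
   = (M / N%:R) * (csq x * (1 - csq x)) by field; exact: lt0r_neq0.
have : csq x * (1 - csq x) <= 1 by nra.
move=> h; have := ler_wpM2l (_ : 0 <= M / N%:R) h; rewrite mulr1 => /(_ _).
move=> /(_ (divr_ge0 M0 (ltW N0))); lra.
Qed.

End CosineWeierstrass.

(** * Mean square approximation on half a period *)

Section SquareIntegrals.
Context {R : realType}.
Local Notation mu := (@lebesgue_measure R).

Lemma measurable_square (D : set R) (f : R -> R) : measurable_fun D f ->
  measurable_fun D (fun x => (f x ^+ 2)%:E).
Proof. by move=> mf; apply/measurable_EFinP; exact: measurable_funX. Qed.

Lemma int_comb (D : set R) (u v : R -> R) (a b : R) : measurable D ->
  measurable_fun D u -> measurable_fun D v ->
  (forall x, D x -> 0 <= u x) -> (forall x, D x -> 0 <= v x) -> 0 <= a -> 0 <= b ->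
  (\int[mu]_(x in D) (a * u x + b * v x)%:E =
   a%:E * \int[mu]_(x in D) (u x)%:E + b%:E * \int[mu]_(x in D) (v x)%:E)%E.
Proof.
move=> mD mu' mv u0 v0 a0 b0.
under eq_integral do rewrite EFinD !EFinM.
rewrite ge0_integralD //.
- rewrite !ge0_integralZl_EFin //.
  + exact/measurable_EFinP.
  + exact/measurable_EFinP.
- by move=> x Dx; rewrite mule_ge0 ?lee_fin ?u0.
- by apply: measurable_funeM; exact/measurable_EFinP.
- by move=> x Dx; rewrite mule_ge0 ?lee_fin ?v0.
- by apply: measurable_funeM; exact/measurable_EFinP.
Qed.

Lemma int_le (D : set R) (u v : R -> R) : measurable D ->
  measurable_fun D u -> measurable_fun D v ->
  (forall x, D x -> 0 <= u x) -> (forall x, D x -> u x <= v x) ->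
  (\int[mu]_(x in D) (u x)%:E <= \int[mu]_(x in D) (v x)%:E)%E.
Proof.
move=> mD mu' mv u0 uv; apply: ge0_le_integral => //.
- exact/measurable_EFinP.
- exact/measurable_EFinP.
Qed.

Lemma int_const (D : set R) (c : R) : measurable D ->
  (\int[mu]_(x in D) c%:E = c%:E * mu D)%E.
Proof. by move=> mD; rewrite integral_cst. Qed.

Lemma ecvg0_small (u : nat -> \bar R) (e : R) : (forall k, (0 <= u k)%E) ->
  u @ \oo --> 0%E -> 0 < e -> exists k, (u k <= e%:E)%E.
Proof.
move=> u0 /fine_cvgP[fu cu] e0.
have : \forall k \near \oo, u k \is a fin_num /\ fine (u k) < e.
  apply: filterI => //; exact: (cvgr_lt _ cu).
move=> [k _ /(_ k (leqnn k))] [fk ke]; exists k.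
by rewrite -(fineK fk) lee_fin ltW.
Qed.

(** A continuous approximation in mean, truncated at height K: the square of the error is
    then at most 2 K times the error. *)
Lemma bounded_continuous_approx (D : set R) (f : R -> R) (K e : R) :
  measurable D -> (mu D < +oo)%E -> measurable_fun D f -> 0 < K ->
  (forall x, D x -> `|f x| <= K) -> 0 < e ->
  exists g : R -> R, [/\ continuous g, forall x, `|g x| <= K &
    (\int[mu]_(x in D) ((f x - g x) ^+ 2)%:E <= e%:E)%E].
Proof.
move=> mD fD mf K0 fK e0.
have intf : mu.-integrable D (EFin \o f).
  apply: (@le_integrable _ _ R mu D mD _ (EFin \o cst K)).
  - exact/measurable_EFinP.
  - by move=> x Dx /=; rewrite lee_fin (ger0_norm (ltW K0)) fK.
  - apply/integrableP; split; first exact/measurable_EFinP/measurable_cst.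
    rewrite (eq_integral (fun=> K%:E)); last by move=> x _ /=; rewrite (ger0_norm (ltW K0)).
    by rewrite int_const // lte_mul_pinfty // lee_fin ltW.
have [g_ [cg ig lim]] := approximation_continuous_integrable mD fD intf.
have e2 : 0 < e / (2 * K) by rewrite divr_gt0 // mulr_gt0.
have [|k hk] := @ecvg0_small _ (e / (2 * K)) _ lim e2.
  by move=> k; apply: integral_ge0 => x _; rewrite lee_fin.
pose g x := Num.max (- K) (Num.min K (g_ k x)).
have mgk : measurable_fun D (g_ k).
  by apply: measurable_funTS; exact: continuous_measurable_fun.
have cgc : continuous g.
  move=> x; apply: (@continuous_max R R (fun=> - K) (fun y => Num.min K (g_ k y)) x).
    exact: cst_continuous.
  apply: (@continuous_min R R (fun=> K) (g_ k) x); first exact: cst_continuous.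
  exact: cg.
have gK x : `|g x| <= K.
  rewrite /g ler_norml; apply/andP; split; first by rewrite le_max lexx.
  by rewrite ge_max ge_min lexx andbT; lra.
have fg x : D x -> (f x - g x) ^+ 2 <= 2 * K * `|f x - g_ k x|.
  move=> Dx; have h1 : `|f x - g x| <= `|f x - g_ k x|.
    have := fK x Dx; rewrite ler_norml /g => /andP[f1 f2].
    have [h|h] := leP K (g_ k x).
      rewrite max_r; last lra.
      rewrite distrC ger0_norm ?subr_ge0 // distrC ger0_norm; lra.
    have [h'|h'] := leP (- K) (g_ k x); first by [].
    rewrite ger0_norm ?subr_ge0 ?ger0_norm; lra.
  have h2 : `|f x - g x| <= 2 * K.
    by have := ler_normB (f x) (g x); have := fK x Dx; have := gK x; lra.
  rewrite -real_normK ?num_real // expr2; exact: ler_pM.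
exists g; split => //.
apply: (@le_trans _ _ (\int[mu]_(x in D) (2 * K * `|f x - g_ k x|)%:E)%E).
  apply: int_le => //.
  - apply: measurable_funX; apply: measurable_funB => //.
    by apply: measurable_funTS; exact: continuous_measurable_fun.
  - apply: measurable_funM; first exact: measurable_cst.
    by apply: measurableT_comp => //; exact: measurable_funB.
  - by move=> x _; rewrite sqr_ge0.
under eq_integral do rewrite EFinM.
rewrite ge0_integralZl_EFin //.
- have : ((2 * K)%:E * \int[mu]_(x in D) `|(f x - g_ k x)%:E| <= (2 * K)%:E * (e / (2 * K))%:E)%E.
    by rewrite lee_pmul2l ?lte_fin ?mulr_gt0.
  move=> /le_trans; apply; rewrite -EFinM lee_fin mulrC divfK // mulf_neq0 // gt_eqF //.
- by apply/measurable_EFinP; apply: measurableT_comp => //; exact: measurable_funB.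
- by rewrite mulr_ge0 // ltW.
Qed.

(** Replaced by zero where |f| > k w, the function f is w times a bounded function, for
    which continuous functions and then polynomials in csq are dense. The weight w serves
    for the odd functions, which are sines times even ones. *)
Lemma weighted_cosine_approx (f w : R -> R) (e : R) :
  let D : set R := `]0, 2^-1[%classic in
  measurable_fun D f -> (\int[mu]_(x in D) (f x ^+ 2)%:E < +oo)%E ->
  measurable_fun setT w -> (forall x, D x -> 0 < w x <= 1) -> 0 < e ->
  exists q : {poly R},
    (\int[mu]_(x in D) ((f x - w x * q.[csq x]) ^+ 2)%:E <= e%:E)%E.
Proof.
move=> D mf f2 mw w01 e0; have mD : measurable D by exact: measurable_itv.
have muD : mu D = (2^-1)%:E.
  by rewrite lebesgue_measure_itv /= lte_fin invr_gt0 ltr0n sube0.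
have mwD : measurable_fun D w by exact: measurable_funTS.
pose f_ (k : nat) x := if `|f x| <= k%:R * w x then f x else 0.
have mtest k : measurable_fun D (fun x => `|f x| <= k%:R * w x).
  apply: measurable_fun_ler; first exact: measurableT_comp.
  exact: measurable_funM.
have mf_ k : measurable_fun D (f_ k).
  apply: measurable_fun_if => //.
  apply: measurable_funS mf => //; exact: subIsetl.
have small x k : D x -> (f x - f_ k x) ^+ 2 <= f x ^+ 2.
  by move=> Dx; rewrite /f_; case: ifP => _; rewrite ?subr0 // subrr expr0n sqr_ge0.
have lim : (\int[mu]_(x in D) ((f x - f_ k x) ^+ 2)%:E)%E @[k --> \oo] --> 0%E.
  have -> : 0%E = (\int[mu]_(x in D) (cst 0%E x) : \bar R)%E by rewrite integral0.
  apply: (@dominated_cvg _ _ _ mu D mD _ _ (fun x => (f x ^+ 2)%:E)) => //.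
  - by move=> k; apply: measurable_square; exact: measurable_funB.
  - move=> x Dx; apply: cvg_near_cst; have /andP[w0 _] := w01 x Dx.
    exists (Num.truncn (`|f x| / w x)).+1 => // k /= hk; rewrite /f_.
    have /andP[_ h] := truncn_itv (divr_ge0 (normr_ge0 (f x)) (ltW w0)).
    rewrite ifT ?subrr ?expr0n //; rewrite -ler_pdivrMr // (le_trans (ltW h)) //.
    by rewrite ler_nat.
  - apply/integrableP; split; first exact: measurable_square.
    by under eq_integral do rewrite gee0_abs ?lee_fin ?sqr_ge0 //.
  - by move=> k x Dx; rewrite gee0_abs ?lee_fin ?sqr_ge0 // small.
have e8 : 0 < e / 8 by rewrite divr_gt0.
have e16 : 0 < e / 16 by rewrite divr_gt0.
have [|k hk] := @ecvg0_small _ (e / 8) _ lim e8.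
  by move=> k; apply: integral_ge0 => x _; rewrite lee_fin sqr_ge0.
(* The inverse is written as a real power, which is a measurable function of its base. *)
pose h x := f_ k x * (w x `^ (-1)).
have wV x : D x -> w x `^ (-1) = (w x)^-1.
  by move=> Dx; rewrite powR_inv1 //; have /andP[/ltW] := w01 x Dx.
have mh : measurable_fun D h.
  apply: measurable_funM => //.
  by apply: (measurableT_comp (measurable_powR (-1))).
have hb x : D x -> `|h x| <= k%:R + 1.
  move=> Dx; have /andP[w0 _] := w01 x Dx; rewrite /h wV // normrM normfV (gtr0_norm w0).
  rewrite ler_pdivrMr // /f_; case: ifP => [hx|_].
    by rewrite (le_trans hx) // ler_wpM2r ?(ltW w0) // lerDl.
  by rewrite normr0 mulr_ge0 ?(ltW w0) // addr_ge0.
have k1 : 0 < k%:R + 1 :> R by rewrite ltr_wpDl.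
have Dfin : (mu D < +oo)%E by rewrite muD ltry.
have [g [cg gK gh]] := bounded_continuous_approx mD Dfin mh k1 hb e16.
pose e' := Num.min 1 (e / 4).
have e'0 : 0 < e' by rewrite lt_min ltr01 divr_gt0.
have e'2 : e' ^+ 2 <= e / 4.
  have h1 : e' <= 1 by rewrite ge_min lexx.
  have h2 : e' <= e / 4 by rewrite ge_min lexx orbT.
  by rewrite expr2 (le_trans _ h2) // ler_piMr // ltW.
have [q qP] := cosine_weierstrass cg gK e'0.
exists q.
have mq : measurable_fun D (fun x => q.[csq x]).
  apply: measurable_funTS; apply: continuous_measurable_fun => x.
  apply: continuous_comp; [exact: continuous_csq | exact: continuous_horner].
have mg : measurable_fun D g.
  by apply: measurable_funTS; exact: continuous_measurable_fun.
have pt x : D x -> (f x - w x * q.[csq x]) ^+ 2 <=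
    2 * (f x - f_ k x) ^+ 2 + 4 * ((h x - g x) ^+ 2 + e' ^+ 2).
  move=> Dx; have /andP[w0 w1] := w01 x Dx.
  have fE : f_ k x = w x * h x by rewrite /h wV // mulrCA mulfV ?mulr1 // gt_eqF.
  have h1 : (g x - q.[csq x]) ^+ 2 <= e' ^+ 2.
    rewrite -real_normK ?num_real // lerXn2r ?nnegrE ?(ltW e'0) // distrC qP //.
    by move: Dx; rewrite /D /= in_itv /= => /andP[/ltW -> /ltW ->].
  have h2 : (w x * (h x - q.[csq x])) ^+ 2 <= (h x - q.[csq x]) ^+ 2.
    rewrite exprMn ler_piMl ?sqr_ge0 // expr_le1 // ltW //.
  have -> : f x - w x * q.[csq x] = (f x - f_ k x) + w x * (h x - q.[csq x]).
    by rewrite fE; ring.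
  have sq2 (a b : R) : (a + b) ^+ 2 <= 2 * a ^+ 2 + 2 * b ^+ 2.
    by rewrite -subr_ge0 (_ : _ - _ = (a - b) ^+ 2) ?sqr_ge0 //; ring.
  have := sq2 (f x - f_ k x) (w x * (h x - q.[csq x])).
  have := sq2 (h x - g x) (g x - q.[csq x]); rewrite addrA subrK; lra.
apply: (@le_trans _ _ (\int[mu]_(x in D)
   (2 * (f x - f_ k x) ^+ 2 + 4 * ((h x - g x) ^+ 2 + e' ^+ 2))%:E)%E).
  apply: int_le => //.
  - apply: measurable_funX; apply: measurable_funB => //; exact: measurable_funM.
  - apply: measurable_funD; apply: measurable_funM; rewrite ?measurable_cst //.
      by apply: measurable_funX; exact: measurable_funB.
    apply: measurable_funD; last exact: measurable_cst.
    by apply: measurable_funX; exact: measurable_funB.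
  - by move=> x _; rewrite sqr_ge0.
rewrite (int_comb mD) //; last 4 first.
- by apply: measurable_funX; exact: measurable_funB.
- apply: measurable_funD; last exact: measurable_cst.
  by apply: measurable_funX; exact: measurable_funB.
- by move=> x _; rewrite sqr_ge0.
- by move=> x _; rewrite addr_ge0 ?sqr_ge0.
have -> : (\int[mu]_(x in D) ((h x - g x) ^+ 2 + e' ^+ 2)%:E)%E =
   (\int[mu]_(x in D) ((h x - g x) ^+ 2)%:E + (e' ^+ 2)%:E * (2^-1)%:E)%E.
  under eq_integral do rewrite EFinD.
  rewrite ge0_integralD //.
  - by rewrite int_const // muD.
  - by move=> x _; rewrite lee_fin sqr_ge0.
  - by apply: measurable_square; exact: measurable_funB.
  - by move=> x _; rewrite lee_fin sqr_ge0.
apply: (@le_trans _ _ (2%:E * (e / 8)%:E + 4%:E * ((e / 16)%:E + (e' ^+ 2)%:E * (2^-1)%:E))%E).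
  by apply: leeD; rewrite lee_pmul2l //; apply: leeD.
by rewrite -!(EFinM, EFinD) lee_fin; lra.
Qed.

End SquareIntegrals.

(** * Trigonometric polynomials with real coefficients *)

Section TrigonometricSums.
Context {R : realType}.
Local Notation mu := (@lebesgue_measure R).

Definition ee (k x : R) : R[i] := cos (k * x) +i* sin (k * x).

Lemma eeD k l x : ee (k + l) x = ee k x * ee l x.
Proof. by rewrite /ee mulrDl cosD sinD; simpc; congr (_ +i* _); ring. Qed.

Lemma ee0 x : ee 0 x = 1.
Proof. by rewrite /ee mul0r cos0 sin0. Qed.

Lemma eeX k x i : ee k x ^+ i = ee (k * i%:R) x.
Proof.
elim: i => [|i IH]; first by rewrite expr0 mulr0 ee0.
by rewrite exprS IH -eeD -natr1; congr (ee _ x); ring.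
Qed.

Definition ceval (p : {poly R}) (z : R[i]) : R[i] := (map_poly (real_complex R) p).[z].

Lemma cevalD p q z : ceval (p + q) z = ceval p z + ceval q z.
Proof. by rewrite /ceval (rmorphD (map_poly (real_complex R))) hornerD. Qed.

Lemma cevalM p q z : ceval (p * q) z = ceval p z * ceval q z.
Proof. by rewrite /ceval (rmorphM (map_poly (real_complex R))) hornerM. Qed.

Lemma cevalC c z : ceval c%:P z = c%:C.
Proof. by rewrite /ceval map_polyC hornerC. Qed.

Lemma cevalX z : ceval 'X z = z.
Proof. by rewrite /ceval map_polyX hornerX. Qed.

Lemma cevalXn k z : ceval 'X^k z = z ^+ k.
Proof. by rewrite /ceval map_polyXn hornerXn. Qed.

(** The trigonometric polynomials with real coefficients: a polynomial in exp (2 pi i x),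
    divided by its power d. *)
Definition laurent (d : nat) (p : {poly R}) (x : R) : R[i] :=
  ee (- (2 * pi * d%:R)) x * ceval p (ee (2 * pi) x).

Definition lcoef (d : nat) (p : {poly R}) (z : int) : R :=
  if (z + d%:Z)%R is Posz i then p`_i else 0.

Lemma laurent_sum d p x :
  laurent d p x = \sum_(i < size p) (p`_i)%:C * ee (2 * pi * (i%:Z - d%:Z)%:~R) x.
Proof.
rewrite /laurent /ceval horner_coef size_map_poly mulr_sumr; apply: eq_bigr => i _.
rewrite coef_map /= eeX mulrCA -eeD; congr (_ * ee _ x).
by rewrite intrD intrN -!pmulrn; ring.
Qed.

Lemma window_sum (V : nmodType) (F : int -> V) (d K W : nat) (l : int) :
  (forall z, F z != 0 -> exists2 i, (i < K)%N & z = i%:Z - d%:Z) ->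
  (`|l| + d + K <= W)%N ->
  \sum_(k < W.*2.+1) F (mode k - l) = \sum_(i < K) F (i%:Z - d%:Z).
Proof.
move=> F0 lW; have [sh shE] : exists sh : nat, (W%:Z + l - d%:Z)%R = sh%:Z.
  by exists `|(W%:Z + l - d%:Z)%R|%N; lia.
pose G (k : nat) : V := F (k%:Z - W%:Z - l).
have GF i : G (i + sh)%N = F (i%:Z - d%:Z) by rewrite /G; congr F; lia.
have zero k : (forall i, (i < K)%N -> k != (i + sh)%N) -> G k = 0.
  move=> kio; apply/eqP; apply: contraT => /F0 [i iK h].
  have := kio i iK; rewrite (_ : k = (i + sh)%N) ?eqxx //; clear -h shE; lia.
transitivity (\sum_(0 <= k < W.*2.+1) G k); first by rewrite big_mkord.
have oW : (sh <= W.*2.+1)%N by lia.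
rewrite (big_cat_nat (leq0n sh) oW) /= big1_seq ?add0r; last first.
  move=> k /andP[_]; rewrite mem_index_iota => /andP[_ ko].
  by apply: zero => i iK; rewrite neq_ltn ltn_addl.
rewrite -{1}[sh]add0n big_addn; have KW : (K <= W.*2.+1 - sh)%N by lia.
rewrite (big_cat_nat (leq0n K) KW) /= [X in _ + X]big1_seq ?addr0; last first.
  move=> k /andP[_]; rewrite mem_index_iota => /andP[Kk _].
  by apply: zero => i iK; rewrite eqn_add2r neq_ltn (leq_trans iK) ?orbT.
by rewrite big_mkord; apply: eq_bigr => i _; exact: GF.
Qed.

Lemma lcoef_support d p z : lcoef d p z != 0 ->
  exists2 i, (i < size p)%N & z = i%:Z - d%:Z.
Proof.
rewrite /lcoef; case E : (z + d%:Z)%R => [i|i]; last by rewrite eqxx.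
move=> pi0; exists i; last by rewrite -E addrK.
by rewrite ltnNge; apply: contraNN pi0 => h; rewrite nth_default.
Qed.

Lemma lcoefE d p i : lcoef d p (i%:Z - d%:Z) = p`_i.
Proof. by rewrite /lcoef subrK. Qed.

Lemma laurent_window d (p : {poly R}) W (l : int) (x : R) : (`|l| + d + size p <= W)%N ->
  laurent d p x = \sum_(k < W.*2.+1)
    (lcoef d p (mode k - l))%:C * ee (2 * pi * (mode k - l)%:~R) x.
Proof.
move=> lW; rewrite laurent_sum.
rewrite (@window_sum _ (fun z => (lcoef d p z)%:C * ee (2 * pi * z%:~R) x) d (size p)) //.
  by apply: eq_bigr => i _; rewrite lcoefE.
by move=> z h; apply: lcoef_support; apply: contraNN h => /eqP ->; rewrite mul0r.
Qed.

Definition is_laurent (f : R -> R[i]) : Prop :=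
  exists d (p : {poly R}), forall x, f x = laurent d p x.

Lemma is_laurentD f g : is_laurent f -> is_laurent g -> is_laurent (fun x => f x + g x).
Proof.
move=> [d [p pE]] [d' [p' pE']]; exists (d + d')%N, (p * 'X^d' + p' * 'X^d) => x.
rewrite pE pE' /laurent cevalD !cevalM !cevalXn !eeX.
have -> : - (2 * pi * (d + d')%:R) = - (2 * pi * d%:R) + - (2 * pi * d'%:R) :> R.
  by rewrite natrD; ring.
have inv (k : R) : ee (- k) x * ee k x = 1 by rewrite -eeD addNr ee0.
have := inv (2 * pi * d%:R); have := inv (2 * pi * d'%:R); rewrite eeD.
set A := ee (- _) x; set A' := ee _ x; set B := ee (- _) x; set B' := ee _ x => hA hB.
set P := ceval p _; set P' := ceval p' _.
have -> : B * A * (P * A' + P' * B') = B * P * (A * A') + A * P' * (B * B') by ring.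
by rewrite hA hB !mulr1.
Qed.

Lemma is_laurentM f g : is_laurent f -> is_laurent g -> is_laurent (fun x => f x * g x).
Proof.
move=> [d [p pE]] [d' [p' pE']]; exists (d + d')%N, (p * p') => x.
rewrite pE pE' /laurent cevalM.
have -> : - (2 * pi * (d + d')%:R) = - (2 * pi * d%:R) + - (2 * pi * d'%:R) :> R.
  by rewrite natrD; ring.
by rewrite eeD; ring.
Qed.

Lemma is_laurentC (c : R) : is_laurent (fun=> c%:C).
Proof.
exists 0%N, c%:P => x; rewrite /laurent mulr0 oppr0 ee0 mul1r.
by rewrite cevalC.
Qed.

Lemma is_laurent_csq : is_laurent (fun x => (csq x)%:C).
Proof.
exists 1%N, ((4^-1)%:P * (('X + 1%:P) * ('X + 1%:P))) => x.
rewrite /laurent !(cevalM, cevalD, cevalC, cevalX) mulr1 /csq /ee mulNr cosN sinN; set c := cos _; set s := sin _.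
have := cos2Dsin2 (2 * pi * x); rewrite -/c -/s => cs.
have h1 : c * (c ^+ 2 + s ^+ 2) = c by rewrite cs mulr1.
have h2 : s * (c ^+ 2 + s ^+ 2) = s by rewrite cs mulr1.
by apply/eqP; rewrite eq_complex /=; apply/andP; split; apply/eqP; lra.
Qed.

(** The factor i makes the Fourier coefficients of an odd function real. *)
Lemma is_laurent_isin : is_laurent (fun x => 'i * (sin (2 * pi * x))%:C).
Proof.
exists 1%N, ((2^-1)%:P * ('X * 'X + (-1)%:P)) => x.
rewrite /laurent !(cevalM, cevalD, cevalC, cevalX) mulr1 /ee mulNr cosN sinN; set c := cos _; set s := sin _.
have := cos2Dsin2 (2 * pi * x); rewrite -/c -/s => cs.
have h1 : c * (c ^+ 2 + s ^+ 2) = c by rewrite cs mulr1.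
have h2 : s * (c ^+ 2 + s ^+ 2) = s by rewrite cs mulr1.
by apply/eqP; rewrite eq_complex /=; apply/andP; split; apply/eqP; lra.
Qed.

Lemma is_laurent_poly (q : {poly R}) : is_laurent (fun x => (q.[csq x])%:C).
Proof.
elim/poly_ind: q => [|q c IH].
  have -> : (fun x : R => ((0 : {poly R}).[csq x])%:C) = (fun=> 0%:C).
    by apply/funext => x; rewrite horner0.
  exact: is_laurentC.
have -> : (fun x : R => ((q * 'X + c%:P).[csq x])%:C)
   = (fun x => (q.[csq x])%:C * (csq x)%:C + c%:C).
  apply/funext => x; rewrite hornerMXaddC; apply/eqP; rewrite eq_complex /=.
  by apply/andP; split; apply/eqP; ring.
exact: is_laurentD (is_laurentM IH is_laurent_csq) (is_laurentC c).
Qed.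

End TrigonometricSums.

Section TrigonometricIntegrals.
Context {R : realType}.
Local Notation mu := (@lebesgue_measure R).

Lemma is_derive_cosM (k x : R) : is_derive x 1 (fun y => cos (k * y)) (- (k * sin (k * x))).
Proof.
have -> : (fun y : R => cos (k * y)) = cos \o ( *%R k) by [].
have h : is_derive x 1 ( *%R k) k.
  have := is_deriveZ k (is_derive_id x (1 : R)); rewrite /GRing.scale /= mulr1.
  exact.
by apply: is_derive_eq; rewrite /= mulNr mulrC.
Qed.

Lemma is_derive_sinM (k x : R) : is_derive x 1 (fun y => sin (k * y)) (k * cos (k * x)).
Proof.
have -> : (fun y : R => sin (k * y)) = sin \o ( *%R k) by [].
have h : is_derive x 1 ( *%R k) k.
  have := is_deriveZ k (is_derive_id x (1 : R)); rewrite /GRing.scale /= mulr1.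
  exact.
by apply: is_derive_eq; rewrite /= mulrC.
Qed.

Lemma is_derive_bigsum (I : Type) (r : seq I) (f : I -> R -> R) (df : I -> R) (x : R) :
  (forall i, is_derive x 1 (f i) (df i)) ->
  is_derive x 1 (fun y => \sum_(i <- r) f i y) (\sum_(i <- r) df i).
Proof.
move=> h; elim: r => [|i r IH].
  rewrite big_nil (_ : (fun y => _) = cst 0); first exact: is_derive_cst.
  by apply/funext => y; rewrite big_nil.
rewrite big_cons (_ : (fun y => _) = f i \+ (fun y => \sum_(j <- r) f j y)).
  exact: is_deriveD.
by apply/funext => y; rewrite big_cons.
Qed.

Lemma sin_2pi_int (z : int) : sin (2 * pi * z%:~R) = 0 :> R.
Proof.
have p : forall x, sin ((x + 1) * (2 * pi)) = sin (x * (2 * pi)) :> R.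
  by move=> x; rewrite mulrDl mul1r (mulr_natl pi 2) sinD2pi.
by have := periodic_int p z 0; rewrite add0r mul0r sin0 mulrC.
Qed.

Lemma cos_2pi_int (z : int) : cos (2 * pi * z%:~R) = 1 :> R.
Proof.
have p : forall x, cos ((x + 1) * (2 * pi)) = cos (x * (2 * pi)) :> R.
  by move=> x; rewrite mulrDl mul1r (mulr_natl pi 2) cosD2pi.
by have := periodic_int p z 0; rewrite add0r mul0r cos0 mulrC.
Qed.

Lemma trig_integral (I : finType) (al be : I -> R) (z : I -> int) :
  (\int[mu]_(x in `[0%R, 1%R])
    (\sum_j (al j * cos (2 * pi * (z j)%:~R * x) + be j * sin (2 * pi * (z j)%:~R * x)))%:E
   = (\sum_(j | z j == 0) al j)%:E)%E.
Proof.
pose k j : R := 2 * pi * (z j)%:~R.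
pose F (x : R) : R := \sum_j (if z j == 0 then al j * x
   else al j / k j * sin (k j * x) - be j / k j * cos (k j * x)).
pose f (x : R) : R := \sum_j (al j * cos (k j * x) + be j * sin (k j * x)).
have k0 j : z j != 0 -> k j != 0.
  by move=> zj; rewrite /k !mulf_neq0 ?intr_eq0 // gt_eqF // pi_gt0.
have dF (x : R) : is_derive x 1 F (f x).
  apply: is_derive_bigsum => j; case: (eqVneq (z j) 0) => [zj|zj].
    have -> : k j = 0 by rewrite /k zj mulr0.
    rewrite !mul0r cos0 sin0 mulr0 addr0 mulr1.
    have := is_deriveZ (al j) (is_derive_id x (1 : R)); rewrite /GRing.scale /= mulr1.
    exact.
  have d1 := is_deriveZ (al j / k j) (is_derive_sinM (k j) x).
  have d2 := is_deriveZ (be j / k j) (is_derive_cosM (k j) x).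
  apply: (is_derive_eq (is_deriveB d1 d2)); rewrite /GRing.scale /=.
  by field; exact: k0.
have cF : continuous F.
  by move=> x; apply: differentiable_continuous; apply/derivable1_diffP; apply: ex_derive.
have cf : continuous f.
  move=> x; apply: differentiable_continuous; apply/derivable1_diffP.
  have df := is_derive_bigsum (index_enum I) (fun j => is_deriveD
    (is_deriveZ (al j) (is_derive_cosM (k j) x)) (is_deriveZ (be j) (is_derive_sinM (k j) x))).
  exact: (@ex_derive _ _ _ _ _ _ _ df).
rewrite (continuous_FTC2 (F := F) (f := f)) //.
- rewrite -EFinB; congr (_%:E); rewrite /F -sumrB [RHS]big_mkcond; apply: eq_bigr => j _.
  case: ifPn => [_|zj]; first by rewrite mulr1 mulr0 subr0.
  rewrite !mulr1 !mulr0 sin0 cos0 /k sin_2pi_int cos_2pi_int; ring.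
- exact: continuous_subspaceT.
- split => [x _| |]; first by apply: ex_derive.
    exact: cvg_at_right_filter (cF 0).
  exact: cvg_at_left_filter (cF 1).
- by move=> x _; rewrite derive1E; apply: derive_val.
Qed.

Lemma parseval (I : finType) (c : I -> R) (t : R) (z : I -> int) : injective z ->
  (\int[mu]_(x in `[0%R, 1%R])
     (ComplexField.Normc.normc (\sum_j (c j)%:C * ee (t + 2 * pi * (z j)%:~R) x) ^+ 2)%:E
   = (\sum_j c j ^+ 2)%:E)%E.
Proof.
move=> zI; have := @trig_integral (I * I)%type (fun p => c p.1 * c p.2) (fun=> 0)
   (fun p => z p.1 - z p.2).
have -> : \sum_(p : I * I | z p.1 - z p.2 == 0) c p.1 * c p.2 = \sum_j c j ^+ 2.
  rewrite -(pair_big_dep predT (fun i j => z i - z j == 0) (fun i j => c i * c j)) /=.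
  apply: eq_bigr => i _; rewrite (bigD1 i) ?subrr //= big1 ?addr0 ?expr2 // => j.
  by rewrite subr_eq0 => /andP[/eqP /zI ->]; rewrite eqxx.
move=> <-; apply: eq_integral => x _; congr (_%:E).
set k := fun j => t + 2 * pi * (z j)%:~R.
have -> : \sum_j (c j)%:C * ee (k j) x
   = (\sum_j c j * cos (k j * x)) +i* (\sum_j c j * sin (k j * x)).
  apply/eqP; rewrite eq_complex !raddf_sum /=; apply/andP; split; apply/eqP; apply: eq_bigr => j _.
    by rewrite /ee; simpc.
  by rewrite /ee; simpc.
rewrite /= sqr_sqrtr ?addr_ge0 ?sqr_ge0 //.
rewrite !expr2 !mulr_suml -big_split /=.
rewrite -(pair_big predT predT (fun i j => c i * c j * cos (2 * pi * (z i - z j)%:~R * x) + 0 * sin (2 * pi * (z i - z j)%:~R * x))) /=.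
apply: eq_bigr => i _; rewrite !mulr_sumr -big_split /=; apply: eq_bigr => j _.
have -> : 2 * pi * (z i - z j)%:~R * x = k i * x - k j * x by rewrite /k intrB; ring.
by rewrite cosB; ring.
Qed.

End TrigonometricIntegrals.

(** * Approximation of PT-symmetric functions *)

Section PTApproximation.
Context {R : realType}.
Local Notation mu := (@lebesgue_measure R).
Local Notation normc := ComplexField.Normc.normc.

Lemma normc_sqr (z : R[i]) : normc z ^+ 2 = complex.Re z ^+ 2 + complex.Im z ^+ 2.
Proof. by case: z => a b; rewrite /= sqr_sqrtr ?addr_ge0 ?sqr_ge0. Qed.

Lemma csq_reflect (x : R) : csq (1 - x) = csq x.
Proof.
rewrite /csq; have -> : 2 * pi * (1 - x) = - (2 * pi * x) + pi *+ 2 by rewrite -mulr_natl; ring.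
by rewrite cosD2pi cosN.
Qed.

Lemma sin_reflect (x : R) : sin (2 * pi * (1 - x)) = - sin (2 * pi * x).
Proof.
have -> : 2 * pi * (1 - x) = - (2 * pi * x) + pi *+ 2 by rewrite -mulr_natl; ring.
by rewrite sinD2pi sinN.
Qed.

(** Periodicity and PT symmetry make the real part even and the imaginary part odd about 1 /
    2, so that half a period is enough. There the real part is approximated by polynomials
    in csq and the imaginary part by sin (2 pi x) times such polynomials; after
    multiplication by i the latter have real Fourier coefficients as well. *)
Lemma pt_approx (p : R -> R[i]) (e : R) : PT_periodic_L2 p -> 0 < e ->
  exists d (q : {poly R}),
    (\int[mu]_(x in `[0%R, 1%R]) (normc (p x - laurent d q x) ^+ 2)%:E <= e%:E)%E.
Proof.
move=> [per sym [mRe mIm L2]] e0.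
pose J : set R := `[0, 1]%classic; pose D : set R := `]0, 2^-1[%classic.
have mJ : measurable J by exact: measurable_itv.
have mD : measurable D by exact: measurable_itv.
have DJ : D `<=` J.
  by move=> x; rewrite /D /J /= !in_itv /= => /andP[h1 h2]; apply/andP; split; lra.
have mn2 : measurable_fun J (fun x => normc (p x) ^+ 2).
  rewrite (_ : (fun _ => _) = (fun x => complex.Re (p x) ^+ 2 + complex.Im (p x) ^+ 2)).
    by apply: measurable_funD; exact: measurable_funX.
  by apply/funext => x; exact: normc_sqr.
have L2D (f : R -> R) : measurable_fun J f -> (forall x, f x ^+ 2 <= normc (p x) ^+ 2) ->
    (\int[mu]_(x in D) (f x ^+ 2)%:E < +oo)%E.
  move=> mf fp; apply: le_lt_trans L2; apply: (@le_trans _ _ (\int[mu]_(x in J) (f x ^+ 2)%:E)%E).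
    apply: ge0_subset_integral => //; first exact: measurable_square.
    by move=> x _; rewrite lee_fin sqr_ge0.
  by apply: int_le => // [|x _]; [exact: measurable_funX|rewrite sqr_ge0].
have e4 : 0 < e / 4 by rewrite divr_gt0.
have [q1 hq1] : exists q : {poly R},
    (\int[mu]_(x in D) ((complex.Re (p x) - q.[csq x]) ^+ 2)%:E <= (e / 4)%:E)%E.
  have [q h] : exists q : {poly R},
      (\int[mu]_(x in D) ((complex.Re (p x) - cst 1 x * q.[csq x]) ^+ 2)%:E <= (e / 4)%:E)%E.
    apply: weighted_cosine_approx => //.
    - exact: measurable_funS mRe.
    - by apply: L2D => // x; rewrite normc_sqr lerDl sqr_ge0.
    - by move=> x _; rewrite ltr01 lexx.
  exists q; apply: le_trans h; rewrite le_eqVlt; apply/orP; left; apply/eqP.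
  by apply: eq_integral => x _; rewrite /cst mul1r.
have msin : measurable_fun setT (fun x : R => sin (2 * pi * x)).
  apply: continuous_measurable_fun => x; apply: differentiable_continuous.
  by apply/derivable1_diffP; exact: (@ex_derive _ _ _ _ _ _ _ (is_derive_sinM (2 * pi) x)).
have [q2 hq2] : exists q : {poly R},
    (\int[mu]_(x in D) ((complex.Im (p x) - sin (2 * pi * x) * q.[csq x]) ^+ 2)%:E <= (e / 4)%:E)%E.
  apply: weighted_cosine_approx => //.
  - exact: measurable_funS mIm.
  - by apply: L2D => // x; rewrite normc_sqr lerDr sqr_ge0.
  - move=> x; rewrite /D /= in_itv /= => /andP[x0 x1]; rewrite sin_le1 andbT.
    have pi0 := @pi_gt0 R; rewrite sin_gt0_pi // !mulr_gt0 //=.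
    by rewrite mulrAC -ltr_pdivlMr // divff ?gt_eqF //; lra.
pose A x : R[i] := (q1.[csq x])%:C + 'i * (sin (2 * pi * x))%:C * (q2.[csq x])%:C.
have [d [q qE]] : is_laurent A.
  apply: is_laurentD; first exact: is_laurent_poly.
  by apply: is_laurentM; [exact: is_laurent_isin|exact: is_laurent_poly].
exists d, q.
pose F x := (complex.Re (p x) - q1.[csq x]) ^+ 2
   + (complex.Im (p x) - sin (2 * pi * x) * q2.[csq x]) ^+ 2.
have FE x : normc (p x - laurent d q x) ^+ 2 = F x.
  rewrite -qE normc_sqr /F /A !raddfB !raddfD /=; congr (_ ^+ 2 + _ ^+ 2); ring.
under eq_integral do rewrite FE.
have mq (r : {poly R}) (E : set R) : measurable_fun E (fun x => r.[csq x]).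
  apply: measurable_funTS; apply: continuous_measurable_fun => x.
  by apply: continuous_comp; [exact: continuous_csq|exact: continuous_horner].
have mF : measurable_fun J F.
  apply: measurable_funD; apply: measurable_funX; apply: measurable_funB => //.
  apply: measurable_funM => //; exact: measurable_funTS.
have mFE (E : set R) : E `<=` J -> measurable_fun E (fun x => (F x)%:E).
  by move=> EJ; apply/measurable_EFinP; exact: measurable_funS mF.
have F0 x : 0 <= F x by rewrite addr_ge0 ?sqr_ge0.
have half : (\int[mu]_(x in D) (F x)%:E <= (e / 2)%:E)%E.
  have mD1 : measurable_fun D (fun x => (complex.Re (p x) - q1.[csq x]) ^+ 2).
    by apply: measurable_funX; apply: measurable_funB => //; exact: measurable_funS mRe.
  have mD2 : measurable_fun D (fun x => (complex.Im (p x) - sin (2 * pi * x) * q2.[csq x]) ^+ 2).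
    apply: measurable_funX; apply: measurable_funB; first exact: measurable_funS mIm.
    by apply: measurable_funM => //; exact: measurable_funTS.
  under eq_integral do rewrite EFinD.
  rewrite ge0_integralD //; try exact/measurable_EFinP.
  - apply: (le_trans (leeD hq1 hq2)); rewrite -EFinD lee_fin; lra.
  - by move=> x _; rewrite lee_fin sqr_ge0.
  - by move=> x _; rewrite lee_fin sqr_ge0.
have refl : {ae mu, forall x, p (1 - x) = (p x)^*}.
  have h1 := preserving_ae (preserving_reflection 0) per.
  apply: ae_imp2 h1 sym => x; rewrite sub0r => h <-.
  by rewrite -h addrC.
pose D' : set R := `]2^-1, 1[%classic.
have pre : (fun x : R => 1 - x) @^-1` D' = D.
  by apply/seteqP; split => x; rewrite /D /D' /= !in_itv /= => /andP[h1 h2]; apply/andP; split; lra.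
have D'J : D' `<=` J.
  by move=> x; rewrite /D' /J /= !in_itv /= => /andP[h1 h2]; apply/andP; split; lra.
have other : (\int[mu]_(x in D') (F x)%:E = \int[mu]_(x in D) (F x)%:E)%E.
  rewrite -(preserving_integral (preserving_reflection 1)) //; last 3 first.
  - exact: measurable_itv.
  - exact: mFE.
  - by move=> x _; rewrite lee_fin F0.
  rewrite pre; apply: ge0_ae_eq_integral => //.
  - apply/measurable_EFinP.
    apply: (@measurable_comp _ _ _ _ _ _ J) => //.
      by move=> _ [x Dx <-]; move: Dx; rewrite /D /J /= !in_itv /= => /andP[h1 h2]; apply/andP; split; lra.
    by apply: measurable_funTS; have [] := preserving_reflection (1 : R).
  - exact: mFE.
  - by move=> x _; rewrite lee_fin F0.
  - by move=> x _; rewrite lee_fin F0.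
  - apply: ae_imp refl => x pE _; congr (_%:E).
    rewrite /F pE csq_reflect sin_reflect; case: (p x) => a b /=; ring.
have -> : (\int[mu]_(x in `[0%R, 1%R]) (F x)%:E
   = \int[mu]_(x in D) (F x)%:E + \int[mu]_(x in D') (F x)%:E)%E.
  rewrite integral_itv_bndoo; last by apply: mFE => x; rewrite /J /= !in_itv /= => /andP[/ltW -> /ltW ->].
  have -> : `]0, 1[%classic = D `|` `[2^-1, 1[%classic :> set R.
    apply/seteqP; split => x; rewrite /D /= !in_itv /=.
      by case: (ltP x 2^-1) => h /andP[h1 h2]; [left|right]; rewrite ?h1 ?h ?h2.
    by case=> /andP[h1 h2]; apply/andP; split; lra.
  rewrite ge0_integral_setU //.
  - congr (_ + _)%E; apply: integral_itv_bndoo; exact: mFE.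
  - apply: mFE => x [/DJ//|]; rewrite /J /= !in_itv /= => /andP[h1 h2]; apply/andP; split; lra.
  - by move=> x _; rewrite lee_fin F0.
  - apply/disj_setPS => x /= []; rewrite /D /= !in_itv /= => /andP[_ h1] /andP[h2 _].
    by move: h1; rewrite ltNge h2.
rewrite other; apply: (le_trans (leeD half half)); rewrite -EFinD lee_fin; lra.
Qed.

(** Integrate |f - g| <= e / 2 + (f - g) ^ 2 / (2 e). *)
Lemma mean_close (f g : R -> R) (G e : R) : 0 < e ->
  let J : set R := `[0, 1]%classic in
  measurable_fun J f -> (\int[mu]_(x in J) (f x ^+ 2)%:E < +oo)%E ->
  continuous g -> (\int[mu]_(x in J) (g x)%:E = G%:E)%E ->
  (\int[mu]_(x in J) ((f x - g x) ^+ 2)%:E <= (e ^+ 2)%:E)%E ->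
  `| (\int[mu]_(x in J) f x)%R - G| <= e.
Proof.
move=> e0 J mf f2 cg gG fg; have mJ : measurable J by exact: measurable_itv.
have muJ : mu J = 1%:E by rewrite lebesgue_measure_itv /= lte_fin ltr01 sube0.
have mg : measurable_fun J g by apply: measurable_funTS; exact: continuous_measurable_fun.
have i1 : mu.-integrable J (EFin \o (fun x => 1 + f x ^+ 2)).
  apply/integrableP; split.
    apply/measurable_EFinP; apply: measurable_funD; first exact: measurable_cst.
    exact: measurable_funX.
  have -> : (\int[mu]_(x in J) `|(EFin \o (fun x => (1 + f x ^+ 2)%R)) x| =
      \int[mu]_(x in J) (1%:E + (f x ^+ 2)%:E))%E.
    by apply: eq_integral => x _ /=; rewrite ger0_norm // addr_ge0 ?sqr_ge0.
  rewrite ge0_integralD //; last 2 first.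
  - by move=> x _; rewrite lee_fin sqr_ge0.
  - exact: measurable_square.
  by rewrite int_const // muJ mule1 lte_add_pinfty // ltry.
have intf : mu.-integrable J (EFin \o f).
  apply: le_integrable i1 => //; first exact/measurable_EFinP.
  move=> x _ /=; rewrite lee_fin [leRHS]ger0_norm ?addr_ge0 ?sqr_ge0 //.
  rewrite -[f x ^+ 2]real_normK ?num_real //.
  have := sqr_ge0 (`|f x| - 1); have := normr_ge0 (f x); nra.
have intg : mu.-integrable J (EFin \o g).
  apply: continuous_compact_integrable; first exact: segment_compact.
  exact: continuous_subspaceT.
have -> : G = (\int[mu]_(x in J) g x)%R by rewrite /Rintegral gG.
rewrite -RintegralB // (le_trans (le_normr_Rintegral _ _)) //.
  have ifg := @integrableB _ _ R mu J mJ _ _ intf intg.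
  by rewrite (_ : EFin \o _ = ((EFin \o f) \- (EFin \o g))%E).
have h : (\int[mu]_(x in J) `|f x - g x|%:E <= e%:E)%E.
  have mfg : measurable_fun J (fun x => f x - g x) by exact: measurable_funB.
  apply: (@le_trans _ _ (\int[mu]_(x in J) (2^-1 * (fun=> e) x + (2 * e)^-1 * (f x - g x) ^+ 2)%:E)%E).
    apply: int_le => //.
    - exact: measurableT_comp.
    - apply: measurable_funD; apply: measurable_funM; rewrite ?measurable_cst //.
      exact: measurable_funX.
    - move=> x _; rewrite -[(f x - g x) ^+ 2]real_normK ?num_real //.
      set y := `|_|; rewrite -subr_ge0.
      have -> : 2^-1 * e + (2 * e)^-1 * y ^+ 2 - y = (2 * e)^-1 * (y - e) ^+ 2.
        by field; exact: lt0r_neq0.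
      by rewrite mulr_ge0 ?sqr_ge0 // invr_ge0 mulr_ge0 // ltW.
  rewrite (int_comb mJ) //; last 4 first.
  - exact: measurable_funX.
  - by move=> x _; exact: ltW.
  - by move=> x _; rewrite sqr_ge0.
  - by rewrite invr_ge0 mulr_ge0 // ltW.
  rewrite int_const // muJ mule1.
  apply: (@le_trans _ _ ((2^-1)%:E * e%:E + ((2 * e)^-1)%:E * (e ^+ 2)%:E)%E).
    by apply: leeD => //; rewrite lee_pmul2l // lte_fin invr_gt0 mulr_gt0.
  rewrite -!EFinM -EFinD lee_fin le_eqVlt; apply/orP; left; apply/eqP.
  by field; exact: lt0r_neq0.
have fn : (\int[mu]_(x in J) `|f x - g x|%:E)%E \is a fin_num.
  rewrite ge0_fin_numE; first exact: le_lt_trans h (ltry _).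
  by apply: integral_ge0 => x _; rewrite lee_fin.
by rewrite /Rintegral -lee_fin fineK.
Qed.

End PTApproximation.

(** * Cutoff functions *)

Section CutoffFunction.
Context {R : realType}.

Lemma is_derive_quadratic (f : R -> R) (x d C : R) :
  (forall h, `|f (h + x) - f x - h * d| <= C * h ^+ 2) -> is_derive x 1 f d.
Proof.
move=> fq.
have lim : h^-1 *: (f (h *: 1 + x) - f x) @[h --> 0^'] --> d.
  apply/cvgrPdist_le => e e0; near=> h.
  have h0 : h != 0 by near: h; exact: nbhs_dnbhs_neq.
  have hn : 0 < `|h| by rewrite normr_gt0.
  have hC : `|h| * (`|C| + 1) <= e.
    rewrite -ler_pdivlMr; last by rewrite ltr_wpDl.
    near: h.
    by apply: dnbhs0_le; rewrite divr_gt0 // ltr_wpDl.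
  rewrite distrC (_ : h *: 1 = h :> R); last by rewrite /GRing.scale /= mulr1.
  rewrite /GRing.scale /=.
  have -> : h^-1 * (f (h + x) - f x) - d = h^-1 * (f (h + x) - f x - h * d).
    by field.
  rewrite normrM normfV -ler_pdivlMl ?invr_gt0 // invrK (le_trans (fq h)) //.
  rewrite -[h ^+ 2]real_normK ?num_real // expr2 mulrA mulrC ler_pM2l // mulrC.
  rewrite (le_trans _ hC) // ler_pM2l //; have := ler_norm C; lra.
by apply: DeriveDef; [apply/cvg_ex; exists d|exact: cvg_lim].
Unshelve. all: by end_near. Qed.

Definition pos2 (v : R) : R := Num.max 0 v ^+ 2.

Lemma pos2_le0 v : v <= 0 -> pos2 v = 0.
Proof. by move=> v0; rewrite /pos2 max_l // expr0n. Qed.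

Lemma pos2_ge0 v : 0 <= v -> pos2 v = v ^+ 2.
Proof. by move=> v0; rewrite /pos2 max_r. Qed.

Lemma is_derive_pos2 (v : R) : is_derive v 1 pos2 (2 * Num.max 0 v).
Proof.
apply: (@is_derive_quadratic _ _ _ 1) => h; rewrite mul1r ler_norml.
have [v0|v0] := leP 0 v; have [w0|w0] := leP 0 (h + v);
  rewrite ?(pos2_ge0 v0) ?(pos2_ge0 w0) ?(pos2_le0 (ltW v0)) ?(pos2_le0 (ltW w0)).
- by apply/andP; split; nra.
- by apply/andP; split; nra.
- by apply/andP; split; nra.
- by apply/andP; split; nra.
Qed.

(** Every factor 1 - x ^ 2 allows for one more derivative at the ends of the support. *)
Definition bump (q : {poly R}) (a : nat) (x : R) : R :=
  (q * (1 - 'X^2) ^+ a).[x] * pos2 (1 - x ^+ 2).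

Lemma is_derive_bump (q : {poly R}) (a : nat) :
  exists q' : {poly R}, forall x : R, is_derive x 1 (bump q a.+1) (bump q' a x).
Proof.
pose r : {poly R} := 1 - 'X^2.
exists (q^`() * r + (q * r^`()) *+ a.+1 - 4%:P * 'X * q) => x.
have rx : r.[x] = 1 - x ^+ 2 by rewrite !hornerE.
have d1 : is_derive x 1 (fun y : R => 1 - y ^+ 2) (- (2 * x)).
  apply: (is_derive_eq (is_deriveB (is_derive_cst (1 : R) x 1) (is_deriveX 2 (is_derive_id x (1 : R))))).
  by rewrite /GRing.scale /=; ring.
have d2 : is_derive x 1 (fun y : R => pos2 (1 - y ^+ 2)) (2 * Num.max 0 (1 - x ^+ 2) * (- (2 * x))).
  have h := is_derive_pos2 (1 - x ^+ 2).
  exact: (@is_derive1_comp _ pos2 (fun y : R => 1 - y ^+ 2) x _ _ h d1).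
have d3 := is_derive_poly (q * r ^+ a.+1) x.
apply: (is_derive_eq (is_deriveM d3 d2)).
have pV : Num.max 0 (1 - x ^+ 2) * (1 - x ^+ 2) = pos2 (1 - x ^+ 2).
  have [v0|v0] := leP 0 (1 - x ^+ 2); first by rewrite pos2_ge0 // expr2.
  by rewrite mul0r pos2_le0 // ltW.
rewrite /bump -/r -pV /GRing.scale /=.
move: d3; clearbody r => _; rewrite derivM deriv_exp /= !(hornerM, hornerD, hornerN, hornerMn, horner_exp, hornerC, hornerX) rx.
rewrite exprS; move: ((1 - x ^+ 2) ^+ a) => U.
move: (Num.max 0 (1 - x ^+ 2)) (1 - x ^+ 2) q.[x] q^`().[x] r^`().[x] => V u y y' r'; ring.
Qed.

(** One bump serves for all derivatives at once: differentiating trades one power of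
    1 - x ^ 2 for a new polynomial factor, so every member of the chain is again a bump. *)
Lemma bump_chain (q : {poly R}) (a : nat) : exists2 F : nat -> {poly R}, F 0 = q &
  forall k, (k < a)%N -> forall x : R, is_derive x 1 (bump (F k) (a - k)) (bump (F k.+1) (a - k.+1) x).
Proof.
elim: a q => [|a IH] q; first by exists (fun=> q).
have [q' dq] := is_derive_bump q a; have [F F0 dF] := IH q'.
exists (fun k => if k is k'.+1 then F k' else q) => // -[|k] ka x.
  by rewrite subn0 subSS subn0 F0.
by rewrite !subSS; apply: dF.
Qed.

Lemma bump_support q a (x : R) : 1 <= `|x| -> bump q a x = 0.
Proof.
move=> x1; rewrite /bump pos2_le0 ?mulr0 // subr_le0 -[x ^+ 2]real_normK ?num_real //.
by rewrite exprn_ege1.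
Qed.

Lemma bump_bounded q a : exists2 K : R, 0 <= K & forall x : R, `|bump q a x| <= K.
Proof.
have cb : continuous (bump q a).
  move=> x; apply: (@continuousM R R (horner (q * (1 - 'X^2) ^+ a)) (fun x : R => pos2 (1 - x ^+ 2)) x).
    exact: continuous_horner.
  apply: (@continuous_comp _ _ _ (fun x : R => 1 - x ^+ 2) pos2 x).
    apply: (@continuousB R R R (fun=> 1) (fun x : R => x ^+ 2) x); first exact: cst_continuous.
    exact: exprn_continuous.
  apply: differentiable_continuous; apply/derivable1_diffP.
  exact: (@ex_derive _ _ _ _ _ _ _ (is_derive_pos2 _)).
have [| |c _ hc] := @EVT_max R (fun x => `|bump q a x|) (-1) 1; first by rewrite (le_trans (lerN10 _)).
  apply: continuous_subspaceT => x; apply: continuous_comp; first exact: cb.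
  exact: norm_continuous.
exists `|bump q a c| => // x; have [x1|x1] := lerP 1 `|x|; first by rewrite bump_support // normr0.
by apply: hc; rewrite in_itv /=; move: x1; rewrite ltr_norml => /andP[/ltW -> /ltW ->].
Qed.

(** One bump, stretched to the interval of radius 2 L; stretching divides each derivative by
    2 L. *)
Lemma cutoff_exists (n : nat) : exists2 K : R, 0 <= K & exists2 c0 : R, 0 < c0 &
  forall L : nat, (0 < L)%N -> exists phi : nat -> R -> R,
  [/\ forall k, (k <= n)%N -> forall x : R, is_derive x 1 (phi k) (phi k.+1 x),
      forall k x, (k <= n)%N -> `|phi k x| <= (if k == 0 then K else K / L%:R),
      forall k x, (2 * L)%:R <= `|x| -> phi k x = 0,
      forall x, 0 <= phi 0 x <= 1 &
      forall x, `|x| <= L%:R -> c0 <= phi 0 x].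
Proof.
have [F F0 dF] := bump_chain 1 n.+1.
pose B k := s2val (cid2 (bump_bounded (F k) (n.+1 - k))).
have B0 k : 0 <= B k by exact: (s2valP (cid2 (bump_bounded (F k) (n.+1 - k)))).
have BP k x : `|bump (F k) (n.+1 - k) x| <= B k.
  exact: (s2valP' (cid2 (bump_bounded (F k) (n.+1 - k)))).
pose K := \sum_(k < n.+1) B k; exists K; first by apply: sumr_ge0.
have BK k : (k <= n)%N -> B k <= K.
  by rewrite -ltnS => kn; rewrite /K (bigD1 (Ordinal kn)) //= lerDl sumr_ge0.
(* For |x| <= L the stretched argument is at most 1 / 2, where the polynomial 1 - x ^ 2 is
   at least 3 / 4. *)
exists ((3 / 4) ^+ n.+3); first by rewrite exprn_gt0 // divr_gt0.
move=> L L0; have L0' : 0 < (2 * L)%:R :> R by rewrite ltr0n muln_gt0.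
pose s : R := (2 * L)%:R^-1; have s0 : 0 < s by rewrite invr_gt0.
exists (fun k x => s ^+ k * bump (F k) (n.+1 - k) (s * x)).
have sx x : `|s * x| = `|x| / (2 * L)%:R by rewrite normrM gtr0_norm // mulrC.
have b0 x : bump (F 0%N) (n.+1 - 0) x = (1 - x ^+ 2) ^+ n.+1 * pos2 (1 - x ^+ 2).
  by rewrite F0 subn0 /bump mul1r horner_exp !hornerE.
split=> [k kn x|k x kn|k x xL|x|x xL].
- have d1 : is_derive x 1 ( *%R s) s.
    have := is_deriveZ s (is_derive_id x (1 : R)); rewrite /GRing.scale /= mulr1.
    exact.
  have d2 := @is_derive1_comp _ (bump (F k) (n.+1 - k)) ( *%R s) x _ _ (dF k kn (s * x)) d1.
  apply: (is_derive_eq (is_deriveZ (s ^+ k) d2)); rewrite /GRing.scale /= exprSr.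
  by rewrite -mulrA; congr (_ * _); rewrite mulrC.
- have := BP k (s * x); have := BK k kn.
  rewrite [in X in _ -> _ -> X]normrM [`|s ^+ k|]ger0_norm ?exprn_ge0 ?(ltW s0) //.
  case: eqP => [->|/eqP k0] h1 h2; first by rewrite expr0 mul1r (le_trans h2).
  have s1 : s <= 1 by rewrite invf_le1 // ler1n muln_gt0.
  have sk : s ^+ k <= L%:R^-1.
    apply: (@le_trans _ _ s).
      by rewrite -[leRHS]expr1 ler_wiXn2l ?(ltW s0) // lt0n.
    by rewrite /s lef_pV2 ?posrE ?ltr0n ?muln_gt0 // ler_nat leq_pmull.
  rewrite mulrC; apply: ler_pM => //; [exact: exprn_ge0 (ltW s0)|exact: le_trans h1].
- by rewrite bump_support ?mulr0 // sx ler_pdivlMr ?mul1r.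
- rewrite expr0 mul1r b0; set y := 1 - (s * x) ^+ 2.
  have y1 : y <= 1 by rewrite /y gerBl sqr_ge0.
  have [y0|y0] := leP 0 y; last by rewrite pos2_le0 ?(ltW y0) // mulr0 lexx ler01.
  by rewrite pos2_ge0 // -exprD exprn_ge0 // exprn_ile1.
- rewrite expr0 mul1r b0; set y := 1 - (s * x) ^+ 2.
  have y34 : 3 / 4 <= y.
    have h : `|s * x| <= 2^-1.
      by rewrite sx ler_pdivrMr // natrM mulKf.
    rewrite /y -real_normK ?num_real //; have := normr_ge0 (s * x); nra.
  rewrite pos2_ge0; last by lra.
  by rewrite -exprD addn2 lerXn2r ?nnegrE //; lra.
Qed.

End CutoffFunction.

(** * Complex derivatives of modulated exponentials *)

Section ComplexModulus.
Context {R : realType}.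
Local Notation normc := (@ComplexField.Normc.normc R).

Lemma normc_ge0 (z : R[i]) : 0 <= normc z.
Proof. by case: z => a b; exact: sqrtr_ge0. Qed.

Lemma normcD (u v : R[i]) : normc (u + v) <= normc u + normc v.
Proof. exact: le_normcD. Qed.

Lemma normcM (u v : R[i]) : normc (u * v) = normc u * normc v.
Proof. exact: ComplexField.Normc.normcM. Qed.

Lemma normc_real (r : R) : normc r%:C = `|r|.
Proof. by rewrite /= expr0n addr0 sqrtr_sqr. Qed.

Lemma normc_i : normc 'i = 1.
Proof. by rewrite /= expr0n expr1n add0r sqrtr1. Qed.

Lemma normcX (z : R[i]) k : normc (z ^+ k) = normc z ^+ k.
Proof.
elim: k => [|k IH]; first by rewrite !expr0 ComplexField.Normc.normc1.
by rewrite !exprS normcM IH.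
Qed.

Lemma normc_sum (I : Type) (r : seq I) (Q : pred I) (F : I -> R[i]) :
  normc (\sum_(i <- r | Q i) F i) <= \sum_(i <- r | Q i) normc (F i).
Proof.
elim/big_rec2: _ => [|i a b _ h]; first by rewrite ComplexField.Normc.normc0.
by rewrite (le_trans (normcD _ _)) // lerD2l.
Qed.

Lemma normc_ee (k x : R) : normc (ee k x) = 1.
Proof. by rewrite /= cos2Dsin2 sqrtr1. Qed.

Lemma Re_le_normc (z : R[i]) : `|complex.Re z| <= normc z.
Proof.
rewrite -(@ler_pXn2r R 2) ?nnegrE ?normc_ge0 // normc_sqr real_normK ?num_real //.
by rewrite lerDl sqr_ge0.
Qed.

Lemma Im_le_normc (z : R[i]) : `|complex.Im z| <= normc z.
Proof.
rewrite -(@ler_pXn2r R 2) ?nnegrE ?normc_ge0 // normc_sqr real_normK ?num_real //.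
by rewrite lerDr sqr_ge0.
Qed.

Lemma normc_sqrD (u v : R[i]) : normc (u + v) ^+ 2 <= 2 * normc u ^+ 2 + 2 * normc v ^+ 2.
Proof.
have h := normcD u v; have h0 := normc_ge0 (u + v).
have -> : 2 * normc u ^+ 2 + 2 * normc v ^+ 2
   = (normc u + normc v) ^+ 2 + (normc u - normc v) ^+ 2 by ring.
rewrite (le_trans _ (_ : (normc u + normc v) ^+ 2 <= _)) ?lerDl ?sqr_ge0 //.
by rewrite lerXn2r ?nnegrE ?addr_ge0 ?normc_ge0.
Qed.

End ComplexModulus.

Section ComplexDerivatives.
Context {R : realType}.
Local Notation normc := (@ComplexField.Normc.normc R).

Definition is_cderive (x : R) (f : R -> R[i]) (df : R[i]) : Prop :=
  is_derive x 1 (fun y => complex.Re (f y)) (complex.Re df) /\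
  is_derive x 1 (fun y => complex.Im (f y)) (complex.Im df).

Lemma is_cderive_eq x f df df' : is_cderive x f df -> df = df' -> is_cderive x f df'.
Proof. by move=> h <-. Qed.

Lemma is_cderiveD x f g df dg : is_cderive x f df -> is_cderive x g dg ->
  is_cderive x (fun y => f y + g y) (df + dg).
Proof.
case: df => a b; case: dg => a' b' [/= f1 f2] [/= g1 g2]; split => /=.
  rewrite (_ : (fun y => _) = (fun y => complex.Re (f y)) + (fun y => complex.Re (g y))).
    exact: is_deriveD.
  by apply/funext => y; rewrite raddfD.
rewrite (_ : (fun y => _) = (fun y => complex.Im (f y)) + (fun y => complex.Im (g y))).
  exact: is_deriveD.
by apply/funext => y; rewrite raddfD.
Qed.

Lemma complex_ReM (u v : R[i]) :
  complex.Re (u * v) = complex.Re u * complex.Re v - complex.Im u * complex.Im v.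
Proof. by case: u => a b; case: v. Qed.

Lemma complex_ImM (u v : R[i]) :
  complex.Im (u * v) = complex.Re u * complex.Im v + complex.Im u * complex.Re v.
Proof. by case: u => a b; case: v. Qed.

Lemma is_cderiveM x f g df dg : is_cderive x f df -> is_cderive x g dg ->
  is_cderive x (fun y => f y * g y) (df * g x + f x * dg).
Proof.
move=> [f1 f2] [g1 g2]; split.
  rewrite (_ : (fun y => _) = (fun y => complex.Re (f y)) * (fun y => complex.Re (g y))
     - (fun y => complex.Im (f y)) * (fun y => complex.Im (g y))); last first.
    by apply/funext => y; exact: complex_ReM.
  apply: (is_derive_eq (is_deriveB (is_deriveM f1 g1) (is_deriveM f2 g2))).
  rewrite /GRing.scale /=; case: (f x) df {f1 f2} => a b [a' b'].
  by case: (g x) dg {g1 g2} => c d [c' d'] /=; ring.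
rewrite (_ : (fun y => _) = (fun y => complex.Re (f y)) * (fun y => complex.Im (g y))
   + (fun y => complex.Im (f y)) * (fun y => complex.Re (g y))); last first.
  by apply/funext => y; exact: complex_ImM.
apply: (is_derive_eq (is_deriveD (is_deriveM f1 g2) (is_deriveM f2 g1))).
rewrite /GRing.scale /=; case: (f x) df {f1 f2} => a b [a' b'].
by case: (g x) dg {g1 g2} => c d [c' d'] /=; ring.
Qed.

Lemma is_cderiveC x (k : R[i]) : is_cderive x (fun=> k) 0.
Proof. by split; exact: is_derive_cst. Qed.

Lemma is_cderiveZ x (k : R[i]) f df : is_cderive x f df ->
  is_cderive x (fun y => k * f y) (k * df).
Proof.
by move=> h; apply: (is_cderive_eq (is_cderiveM (is_cderiveC x k) h)); rewrite mul0r add0r.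
Qed.

Lemma is_cderive_real (x : R) (f : R -> R) (df : R) : is_derive x 1 f df ->
  is_cderive x (fun y => (f y)%:C) df%:C.
Proof. by move=> h; split => //=; exact: is_derive_cst. Qed.

Lemma is_cderive_sum (I : Type) (r : seq I) (f : I -> R -> R[i]) (df : I -> R[i]) x :
  (forall i, is_cderive x (f i) (df i)) ->
  is_cderive x (fun y => \sum_(i <- r) f i y) (\sum_(i <- r) df i).
Proof.
move=> h; elim: r => [|i r IH].
  rewrite big_nil (_ : (fun y => _) = (fun=> 0)); first exact: is_cderiveC.
  by apply/funext => y; rewrite big_nil.
rewrite big_cons (_ : (fun y => _) = (fun y => f i y + \sum_(j <- r) f j y)).
  exact: is_cderiveD.
by apply/funext => y; rewrite big_cons.
Qed.

Lemma is_cderive_ee (k x : R) : is_cderive x (ee k) ('i * k%:C * ee k x).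
Proof.
split; rewrite /ee /=.
  by apply: (is_derive_eq (is_derive_cosM k x)); ring.
by apply: (is_derive_eq (is_derive_sinM k x)); ring.
Qed.

(** Conjugating a derivative by the exponential ee k turns d/dx into d/dx + i k.  Acting on
    a sequence of successive derivatives, that operator is a shift plus a multiple of the
    identity, so that no binomial expansion is needed. *)
Definition twist (k : R) (a : nat -> R[i]) (j : nat) : R[i] := a j.+1 + 'i * k%:C * a j.

Definition twisted (phi : nat -> R -> R) (k x : R) (e : nat) : nat -> R[i] :=
  iter e (twist k) (fun j => (phi j x)%:C).

Lemma is_cderive_twisted (phi : nat -> R -> R) (n : nat) (k x : R) (e j : nat) :
  (forall i, (i <= n)%N -> is_derive x 1 (phi i) (phi i.+1 x)) -> (e + j <= n)%N ->
  is_cderive x (fun y => twisted phi k y e j) (twisted phi k x e j.+1).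
Proof.
move=> dphi; elim: e j => [|e IH] j ejn; first exact/is_cderive_real/dphi.
apply: is_cderiveD; first by apply: IH; rewrite addnS.
by apply: is_cderiveZ; apply: IH; rewrite (leq_trans _ ejn) // leqnSn.
Qed.

Lemma is_cderive_wave (phi : nat -> R -> R) (n : nat) (k x : R) (e : nat) :
  (forall i, (i <= n)%N -> is_derive x 1 (phi i) (phi i.+1 x)) -> (e <= n)%N ->
  is_cderive x (fun y => ee k y * twisted phi k y e 0) (ee k x * twisted phi k x e.+1 0).
Proof.
move=> dphi en; have h : (e + 0 <= n)%N by rewrite addn0.
apply: (is_cderive_eq (is_cderiveM (is_cderive_ee k x) (is_cderive_twisted k dphi h))).
by rewrite /twisted iterS /twist; ring.
Qed.

Lemma twisted_bound (phi : nat -> R -> R) (k x : R) (e j : nat) (d : R) :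
  (forall i, (j <= i <= e + j)%N -> `|phi i x| <= d) ->
  normc (twisted phi k x e j) <= (1 + `|k|) ^+ e * d.
Proof.
elim: e j => [|e IH] j hd.
  by rewrite expr0 mul1r normc_real hd // leqnn.
apply: (le_trans (normcD _ _)); rewrite !normcM normc_i normc_real mul1r exprS -mulrA mulrDl mul1r.
apply: lerD.
  by apply: IH => i /andP[ji ie]; apply: hd; rewrite (ltnW ji) addSnnS.
by apply: ler_wpM2l => //; apply: IH => i /andP[ji ie]; apply: hd; rewrite ji (leq_trans ie) // leqnSn.
Qed.

(** Expanding the iterate, exactly one term contains no derivative of phi j; all others are
    bounded by d. *)
Lemma twisted_head (phi : nat -> R -> R) (k x : R) (e j : nat) (d : R) :
  (forall i, (j < i <= e + j)%N -> `|phi i x| <= d) -> 0 <= d ->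
  normc (twisted phi k x e j - ('i * k%:C) ^+ e * (phi j x)%:C) <= (1 + `|k|) ^+ e * d.
Proof.
move=> + d0; elim: e => [|e IH] hd.
  by rewrite !expr0 !mul1r subrr ComplexField.Normc.normc0.
have -> : twisted phi k x e.+1 j - ('i * k%:C) ^+ e.+1 * (phi j x)%:C =
  twisted phi k x e j.+1 + 'i * k%:C * (twisted phi k x e j - ('i * k%:C) ^+ e * (phi j x)%:C).
  by rewrite {1}/twisted iterS -/(twisted phi k x e) /twist exprS; ring.
apply: (le_trans (normcD _ _)); rewrite !normcM normc_i normc_real mul1r exprS -mulrA mulrDl mul1r.
apply: lerD.
  by apply: twisted_bound => i /andP[ji ie]; apply: hd; rewrite ji addSnnS.
apply: ler_wpM2l => //; apply: IH => i /andP[ji ie]; apply: hd.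
by rewrite ji (leq_trans ie) // leqnSn.
Qed.

Lemma twisted_zero (phi : nat -> R -> R) (k x : R) (e j : nat) :
  (forall i, phi i x = 0) -> twisted phi k x e j = 0.
Proof.
move=> h; elim: e j => [|e IH] j; first by rewrite /twisted /= h.
by rewrite /twisted iterS -/(twisted phi k x e) /twist !IH mulr0 addr0.
Qed.

End ComplexDerivatives.

Section Regularity.
Context {R : realType}.

Lemma derive1n_chain (F : nat -> R -> R) (n : nat) :
  (forall k, (k < n)%N -> forall x : R, is_derive x 1 (F k) (F k.+1 x)) ->
  forall k, (k <= n)%N -> derive1n k (F 0) = F k.
Proof.
move=> dF; elim=> [|k IH] kn; first by rewrite derive1n0.
rewrite derive1nS IH ?(ltnW kn) //; apply/funext => x; rewrite derive1E.
by have h := dF k kn x; apply: derive_val.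
Qed.

Lemma lipschitz_of_derive (f df : R -> R) (K : R) :
  (forall x : R, is_derive x 1 f (df x)) -> (forall x, `|df x| <= K) ->
  forall a b, a <= b -> `|f b - f a| <= K * (b - a).
Proof.
move=> dF dK a b ab; have [|c _ ->] := MVT_segment ab (fun x _ => dF x).
  apply: continuous_subspaceT => x; apply: differentiable_continuous; apply/derivable1_diffP.
  exact: (@ex_derive _ _ _ _ _ _ _ (dF x)).
by rewrite normrM [`|b - a|]ger0_norm ?subr_ge0 // ler_wpM2r ?subr_ge0.
Qed.

(** A bounded derivative of order n makes the derivative of order n - 1 Lipschitz, hence
    absolutely continuous. *)
Lemma real_regular_chain (F : nat -> R -> R) (n : nat) (K : R) : (0 < n)%N ->
  (forall k, (k < n)%N -> forall x : R, is_derive x 1 (F k) (F k.+1 x)) ->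
  (forall x, `|F n x| <= K) -> real_regular n (F 0%N).
Proof.
move=> n0 dF FK; split=> [k x kn|].
  rewrite (derive1n_chain dF) ?(leq_trans (ltnW kn)) ?leq_pred //.
  have kn' : (k < n)%N by rewrite (leq_trans kn) ?leq_pred.
  exact: (@ex_derive _ _ _ _ _ _ _ (dF k kn' x)).
rewrite (derive1n_chain dF) ?leq_pred // => a b _ e e0.
have K0 : 0 <= K by rewrite (le_trans _ (FK 0)).
have K1 : 0 < K + 1 by rewrite ltr_wpDl.
exists (e / (K + 1)); first by rewrite divr_gt0.
move=> N c d cd _ sm.
have n1n : (n.-1 < n)%N by rewrite prednK.
have lip i : `|F n.-1 (d i) - F n.-1 (c i)| <= K * (d i - c i).
  have [_ [cdi _]] := cd i; apply: (lipschitz_of_derive (dF n.-1 n1n)) => // x.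
  by rewrite prednK.
apply: (le_lt_trans (ler_sum _ (fun i _ => lip i))); rewrite -mulr_sumr.
have s0 : 0 <= \sum_i (d i - c i).
  by apply: sumr_ge0 => i _; rewrite subr_ge0; have [_ []] := cd i.
move: sm; rewrite ltr_pdivlMr //; apply: le_lt_trans; rewrite mulrC ler_wpM2l //.
by rewrite lerDl.
Qed.

End Regularity.

(** * Complex measurability, comparison with periodic functions, norms *)

Section ComplexMeasurability.
Context {R : realType}.
Local Notation mu := (@lebesgue_measure R).
Local Notation normc := (@ComplexField.Normc.normc R).

Definition cmeas (D : set R) (f : R -> R[i]) : Prop :=
  measurable_fun D (fun x => complex.Re (f x)) /\
  measurable_fun D (fun x => complex.Im (f x)).

Lemma cmeasD D f g : cmeas D f -> cmeas D g -> cmeas D (fun x => f x + g x).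
Proof.
move=> [f1 f2] [g1 g2]; split.
  rewrite (_ : (fun x => _) = fun x => complex.Re (f x) + complex.Re (g x)).
    exact: measurable_funD.
  by apply/funext => x; rewrite raddfD.
rewrite (_ : (fun x => _) = fun x => complex.Im (f x) + complex.Im (g x)).
  exact: measurable_funD.
by apply/funext => x; rewrite raddfD.
Qed.

Lemma cmeasM D f g : cmeas D f -> cmeas D g -> cmeas D (fun x => f x * g x).
Proof.
move=> [f1 f2] [g1 g2]; split.
  rewrite (_ : (fun x => complex.Re (f x * g x)) = fun x => complex.Re (f x) * complex.Re (g x)
     - complex.Im (f x) * complex.Im (g x)); last by apply/funext => x; exact: complex_ReM.
  by apply: measurable_funB; exact: measurable_funM.
rewrite (_ : (fun x => complex.Im (f x * g x)) = fun x => complex.Re (f x) * complex.Im (g x)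
   + complex.Im (f x) * complex.Re (g x)); last by apply/funext => x; exact: complex_ImM.
by apply: measurable_funD; exact: measurable_funM.
Qed.

Lemma cmeasC D k : cmeas D (fun=> k).
Proof. by split; exact: measurable_cst. Qed.

Lemma cmeas_sum D (I : Type) (r : seq I) (f : I -> R -> R[i]) :
  (forall i, cmeas D (f i)) -> cmeas D (fun x => \sum_(i <- r) f i x).
Proof.
move=> h; elim: r => [|i r IH].
  rewrite (_ : (fun x => _) = fun=> 0); first exact: cmeasC.
  by apply/funext => x; rewrite big_nil.
rewrite (_ : (fun x => _) = fun x => f i x + \sum_(j <- r) f j x); first exact: cmeasD.
by apply/funext => x; rewrite big_cons.
Qed.

Lemma cmeas_derive D f df : (forall x, is_cderive x f (df x)) -> cmeas D f.
Proof.
have h (g dg : R -> R) : (forall x : R, is_derive x 1 g (dg x)) -> measurable_fun D g.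
  move=> dgx; apply: measurable_funTS; apply: continuous_measurable_fun => x.
  apply: differentiable_continuous; apply/derivable1_diffP.
  exact: (@ex_derive _ _ _ _ _ _ _ (dgx x)).
by move=> dfx; split; [apply: h => x; exact: (dfx x).1|apply: h => x; exact: (dfx x).2].
Qed.

Lemma measurable_normc_sqr D f : cmeas D f -> measurable_fun D (fun x => normc (f x) ^+ 2).
Proof.
move=> [f1 f2].
rewrite (_ : (fun x => _) = (fun x => complex.Re (f x) ^+ 2 + complex.Im (f x) ^+ 2)).
  by apply: measurable_funD; exact: measurable_funX.
by apply/funext => x; exact: normc_sqr.
Qed.

Lemma ae_ord m (P : 'I_m -> R -> Prop) :
  (forall i, {ae mu, forall x, P i x}) -> {ae mu, forall x, forall i, P i x}.
Proof.
move=> h.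
have hk (k : nat) : {ae mu, forall x, if insub k is Some i then P i x else True}.
  by case: insubP => [i _ _|_]; [exact: h|apply: aeW].
by apply: (ae_imp _ (ae_foralln hk)) => x hx i; have := hx i; rewrite valK.
Qed.

Lemma ae_periodic (T : Type) (p : R -> T) : {ae mu, forall x, p (x + 1) = p x} ->
  {ae mu, forall x, forall z : int, p (x + z%:~R) = p x}.
Proof.
move=> per.
have up (k : nat) : {ae mu, forall x, p (x + k%:R) = p x}.
  elim: k => [|k IH]; first by apply: aeW => x; rewrite addr0.
  apply: ae_imp2 IH (preserving_ae (preserving_shift k%:R) per) => x <- <-.
  by rewrite -addrA natr1.
have down (k : nat) : {ae mu, forall x, p (x - k%:R) = p x}.
  by apply: ae_imp (preserving_ae (preserving_shift (- k%:R)) (up k)) => x; rewrite subrK.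
apply: ae_imp2 (ae_foralln up) (ae_foralln down) => x u d [k|k]; first exact: u.
by rewrite NegzE intrN; exact: d.
Qed.

Lemma periodic_rep (p : R -> R[i]) : PT_periodic_L2 p ->
  let q x := p (x - (Num.floor x)%:~R) in
  [/\ cmeas setT q, forall x, q (x + 1) = q x, forall x, 0 <= x < 1 -> q x = p x &
      {ae mu, forall x, p x = q x}].
Proof.
move=> [per _ [mRe mIm _]] q; split.
- have mg : measurable_fun setT (fun x : R => x - (Num.floor x)%:~R).
    apply: measurable_funB => //; apply: nondecreasing_measurable => // x y xy.
    by rewrite ler_int le_floor.
  have gI : range (fun x : R => x - (Num.floor x)%:~R) `<=` `[0%R, 1%R].
    move=> _ [x _ <-]; rewrite /= in_itv /=; have /andP[h1 h2] := floor_itv x.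
    by move: h2; rewrite intrD => h2; apply/andP; split; lra.
  have mI : measurable (`[0%R, 1%R]%classic : set R) by exact: measurable_itv.
  split.
    exact: (measurable_comp mI gI mRe mg).
  exact: (measurable_comp mI gI mIm mg).
- by move=> x; rewrite /q floorDrz ?rpred1 // floor1 intrD opprD addrACA subrr addr0.
- move=> x x01; rewrite /q (_ : Num.floor x = 0) ?subr0 //.
  by apply: floor_def; rewrite add0r.
- by apply: ae_imp (ae_periodic per) => x h; rewrite /q -intrN h.
Qed.

End ComplexMeasurability.

Section CellEstimates.
Context {R : realType}.
Local Notation mu := (@lebesgue_measure R).

Lemma cells_itv L : `[(- (2 * L)%:Z)%:~R, ((- (2 * L)%:Z)%:~R + (4 * L)%:R)[%classic
  = `[- (2 * L)%:R, (2 * L)%:R[%classic :> set R.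
Proof.
rewrite intrN -pmulrn (_ : - (2 * L)%:R + (4 * L)%:R = (2 * L)%:R :> R) //.
by rewrite !natrM; lra.
Qed.

(** A function supported in the interval of radius 2 L is compared with a periodic one on
    the 4 L periods covering that interval. *)
Lemma cells_above (F G : R -> R) (g : R) (L : nat) :
  measurable_fun setT F -> measurable_fun setT G -> (forall x, 0 <= F x) ->
  (forall x, G (x + 1) = G x) -> (forall x, F x <= G x) ->
  (forall x, (2 * L)%:R <= `|x| -> F x = 0) ->
  (\int[mu]_(x in `[0%R, 1%R[) (G x)%:E <= g%:E)%E ->
  (\int[mu]_x (F x)%:E <= ((4 * L)%:R * g)%:E)%E.
Proof.
move=> mF mG F0 Gp FG Fs Gg; have G0 x : 0 <= G x by exact: le_trans (FG x).
pose D : set R := `[- (2 * L)%:R, (2 * L)%:R[%classic.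
have mD : measurable D by exact: measurable_itv.
have -> : (\int[mu]_x (F x)%:E = \int[mu]_(x in D) (F x)%:E)%E.
  rewrite [RHS]integral_mkcond; apply: eq_integral => x _; rewrite patchE.
  case: ifPn => // /negP xD; rewrite Fs // leNgt; apply/negP; rewrite ltr_norml => /andP[x1 x2].
  by apply: xD; apply/mem_set; rewrite /D /= in_itv /= (ltW x1) x2.
apply: (@le_trans _ _ (\int[mu]_(x in D) (G x)%:E)%E).
  by apply: int_le => //; exact: measurable_funTS.
rewrite /D -cells_itv periodic_cells // EFinM lee_wpmul2l // lee_fin.
Qed.

Lemma cells_below (F G : R -> R) (g : R) (L : nat) :
  measurable_fun setT F -> measurable_fun setT G -> (forall x, 0 <= G x) ->
  (forall x, G (x + 1) = G x) -> (forall x, 0 <= F x) ->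
  (forall x, `|x| <= (2 * L)%:R -> G x <= F x) ->
  (\int[mu]_(x in `[0%R, 1%R[) (G x)%:E = g%:E)%E ->
  (((4 * L)%:R * g)%:E <= \int[mu]_x (F x)%:E)%E.
Proof.
move=> mF mG G0 Gp F0 GF Gg.
pose D : set R := `[- (2 * L)%:R, (2 * L)%:R[%classic.
have mD : measurable D by exact: measurable_itv.
apply: (@le_trans _ _ (\int[mu]_(x in D) (F x)%:E)%E); last first.
  apply: ge0_subset_integral => //; first exact/measurable_EFinP.
  by move=> x _; rewrite lee_fin.
apply: (@le_trans _ _ (\int[mu]_(x in D) (G x)%:E)%E).
  by rewrite /D -cells_itv periodic_cells // Gg EFinM.
apply: int_le => //; [exact: measurable_funTS|exact: measurable_funTS|].
move=> x; rewrite /D /= in_itv /= => /andP[x1 x2]; apply: GF.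
by rewrite ler_norml x1 ltW.
Qed.

End CellEstimates.

Section NormSquared.
Context {R : realType} {m : nat}.
Local Notation mu := (@lebesgue_measure R).
Local Notation normc := (@ComplexField.Normc.normc R).

Lemma vec_norm_sqr (v : 'cV[R[i]]_m) : vec_norm v ^+ 2 = \sum_i normc (v i ord0) ^+ 2.
Proof. by rewrite sqr_sqrtr // sumr_ge0 // => i _; rewrite sqr_ge0. Qed.

Lemma L2norm_sqr (f : R -> 'cV[R[i]]_m) :
  (L2norm f `^ 2 = \int[mu]_x (\sum_i normc (f x i ord0) ^+ 2)%:E)%E.
Proof.
rewrite /L2norm poweR_Lnorm //; apply: eq_integral => x _.
change ((`|vec_norm (f x)|%:E `^ 2)%E = (\sum_i normc (f x i ord0) ^+ 2)%:E).
by rewrite poweR_EFin powR_mulrn // real_normK ?num_real // vec_norm_sqr.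
Qed.

Lemma L2norm_le_sqr (f g : R -> 'cV[R[i]]_m) (M : R) :
  (L2norm f <= M%:E * L2norm g)%E ->
  (\int[mu]_x (\sum_i normc (f x i ord0) ^+ 2)%:E
   <= (M ^+ 2)%:E * \int[mu]_x (\sum_i normc (g x i ord0) ^+ 2)%:E)%E.
Proof.
move=> fg; rewrite -!L2norm_sqr.
have g0 : (0 <= L2norm g)%E by exact: Lnorm_ge0.
have f0 : (0 <= L2norm f)%E by exact: Lnorm_ge0.
have M0 : (0 <= `|M|%:E)%E by rewrite lee_fin.
have h : (L2norm f <= `|M|%:E * L2norm g)%E.
  by apply: (le_trans fg); apply: lee_wpmul2r => //; rewrite lee_fin ler_norm.
have -> : (M ^+ 2)%:E = (`|M|%:E `^ 2)%E.
  by rewrite poweR_EFin powR_mulrn // real_normK ?num_real.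
rewrite -poweRM //; apply: gt0_ler_poweR => //; rewrite in_itv /= leey andbT //.
exact: mule_ge0.
Qed.

End NormSquared.

(** * Sums of waves and their truncations *)

Section BlochSums.
Context {R : realType}.
Variables (n m : nat) (I : finType) (z : I -> int) (t : R) (c : I -> 'cV[R]_m).
Hypothesis n_gt1 : (1 < n)%N.
Local Notation normc := (@ComplexField.Normc.normc R).
Local Notation ka l := (freq t (z l)).

Definition bloch (i : 'I_m) (x : R) : R[i] := \sum_l (c l i ord0)%:C * ee (ka l) x.

(** The value at one point of a differential expression applied to the sum of the waves
    c l * e l, when T k l stands for the factor produced by k derivatives. *)
Definition assemble (Q : nat -> 'M[R[i]]_m) (e : I -> R[i]) (T : nat -> I -> R[i]) (i : 'I_m) :
    R[i] :=
  \sum_l e l * (T n l * (c l i ord0)%:C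
    + \sum_(2 <= nu < n.+1) \sum_j Q nu i j * (T (n - nu)%N l * (c l j ord0)%:C)).

Definition residual (Q : nat -> R -> 'M[R[i]]_m) (lam : R) (i : 'I_m) (x : R) : R[i] :=
  assemble (fun nu => Q nu x) (fun l => ee (ka l) x) (fun k l => (ka l ^+ k)%:C) i
  - lam%:C * bloch i x.

(** A crude constant that depends on the sum of waves but not on the cutoff, so that the
    cutoff can be made long afterwards. *)
Definition size_const : R :=
  \sum_l (1 + `|ka l|) ^+ n * (n.+1%:R * (1 + \sum_j `|c l j ord0|)).

Lemma size_const_ge0 : 0 <= size_const.
Proof.
apply: sumr_ge0 => l _; rewrite mulr_ge0 ?exprn_ge0 ?addr_ge0 // mulr_ge0 // addr_ge0 //.
exact: sumr_ge0.
Qed.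

Lemma assemble_scale Q e T (u : R[i]) i :
  assemble Q (fun l => u * e l) T i = u * assemble Q e T i.
Proof. by rewrite /assemble mulr_sumr; apply: eq_bigr => l _; rewrite mulrA. Qed.

Lemma assembleB Q e T T' (u : R[i]) i :
  assemble Q e (fun k l => T k l - T' k l * u) i = assemble Q e T i - u * assemble Q e T' i.
Proof.
rewrite /assemble mulr_sumr -sumrB; apply: eq_bigr => l _.
rewrite [u * _]mulrCA -mulrBr; congr (_ * _).
rewrite [u * (_ + _)]mulrDr opprD addrACA; congr (_ + _); first by ring.
rewrite mulr_sumr -sumrB; apply: eq_bigr => nu _.
by rewrite mulr_sumr -sumrB; apply: eq_bigr => j _; ring.
Qed.

Lemma eq_assemble Q Q' e T i : (forall nu, (2 <= nu <= n)%N -> Q nu = Q' nu) ->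
  assemble Q e T i = assemble Q' e T i.
Proof.
move=> QQ; rewrite /assemble; apply: eq_bigr => l _; congr (_ * (_ + _)).
by apply: eq_big_nat => nu nun; rewrite QQ.
Qed.

Lemma assemble_bound (Q : nat -> 'M[R[i]]_m) (e : I -> R[i]) T (i : 'I_m) (w d : R) :
  (forall l, normc (e l) = 1) -> 1 <= w -> 0 <= d ->
  (forall nu j, (2 <= nu <= n)%N -> normc (Q nu i j) <= w) ->
  (forall k l, (k <= n)%N -> normc (T k l) <= (1 + `|ka l|) ^+ k * d) ->
  normc (assemble Q e T i) <= size_const * (d * w).
Proof.
move=> e1 w1 d0 Qw Td; apply: (le_trans (normc_sum _ _ _)); rewrite mulr_suml.
apply: ler_sum => l _; rewrite normcM e1 mul1r; set S := \sum_j _.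
have S0 : 0 <= S by apply: sumr_ge0.
have w0 : 0 <= w by lra.
have cS j : `|c l j ord0| <= S by rewrite /S (bigD1 j) //= lerDl sumr_ge0.
have kap (k : nat) : (k <= n)%N -> normc (T k l) <= (1 + `|ka l|) ^+ n * d.
  move=> kn; apply: (le_trans (Td k l kn)); rewrite ler_wpM2r // ler_weXn2l //.
  by rewrite lerDl.
have E0 : 0 <= (1 + `|ka l|) ^+ n * d by rewrite mulr_ge0 // exprn_ge0 // addr_ge0.
apply: (@le_trans _ _ ((1 + `|ka l|) ^+ n * d * S * w + \sum_(2 <= nu < n.+1) (1 + `|ka l|) ^+ n * d * S * w)).
  apply: (le_trans (normcD _ _)); apply: lerD.
    rewrite normcM normc_real -[leLHS]mulr1; apply: ler_pM => //.
      by rewrite mulr_ge0 ?normc_ge0.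
    by apply: ler_pM => //; rewrite ?normc_ge0 ?kap ?cS.
  apply: (le_trans (normc_sum _ _ _)); apply: ler_sum_nat => nu /andP[n2 nun].
  apply: (le_trans (normc_sum _ _ _)); rewrite /S mulr_sumr mulr_suml; apply: ler_sum => j _.
  rewrite !normcM normc_real mulrC; apply: ler_pM; rewrite ?mulr_ge0 ?normc_ge0 //.
    by apply: ler_wpM2r => //; apply: kap; exact: leq_subr.
  by apply: Qw; rewrite n2.
rewrite sumr_const_nat -mulrS (_ : (n.+1 - 2).+1 = n)%N; last by lia.
rewrite -[leLHS]mulr_natr.
have -> : (1 + `|ka l|) ^+ n * (n.+1%:R * (1 + S)) * (d * w)
   = (1 + `|ka l|) ^+ n * d * w * ((1 + S) * n.+1%:R) by ring.
have -> : (1 + `|ka l|) ^+ n * d * S * w * n%:R = (1 + `|ka l|) ^+ n * d * w * (S * n%:R) by ring.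
apply: ler_wpM2l; first exact: mulr_ge0.
by apply: ler_pM => //; [lra|rewrite ler_nat].
Qed.

Lemma bloch_bound i x : normc (bloch i x) <= size_const.
Proof.
apply: (le_trans (normc_sum _ _ _)); apply: ler_sum => l _.
rewrite normcM normc_ee normc_real mulr1.
apply: (@le_trans _ _ (1 + \sum_j `|c l j ord0|)).
  by rewrite (bigD1 i) //= addrCA lerDl addr_ge0 // sumr_ge0.
have S0 : 0 <= 1 + \sum_j `|c l j ord0| by rewrite addr_ge0 // sumr_ge0.
rewrite mulrA ler_peMl //; apply: (@le_trans _ _ (1 * 1)); first by rewrite mulr1.
by apply: ler_pM => //; [rewrite exprn_ege1 // lerDl|rewrite ler1n].
Qed.

Lemma ee_period l x : ee (ka l) (x + 1) = ee t 1 * ee (ka l) x.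
Proof.
have -> : ee (ka l) (x + 1) = ee (ka l) 1 * ee (ka l) x.
  by rewrite {1 2 3}/ee !mulrDr cosD sinD !mulr1; simpc; congr (_ +i* _); ring.
by congr (_ * _); rewrite /freq eeD /ee !mulr1 cos_2pi_int sin_2pi_int; simpc.
Qed.

Lemma bloch_period i x : normc (bloch i (x + 1)) = normc (bloch i x).
Proof.
have -> : bloch i (x + 1) = ee t 1 * bloch i x.
  rewrite /bloch mulr_sumr; apply: eq_bigr => l _; rewrite ee_period; ring.
by rewrite normcM normc_ee mul1r.
Qed.

Lemma residual_period Q lam i x : (forall nu, (2 <= nu <= n)%N -> Q nu (x + 1) = Q nu x) ->
  normc (residual Q lam i (x + 1)) = normc (residual Q lam i x).
Proof.
move=> Qp.
have -> : residual Q lam i (x + 1) = ee t 1 * residual Q lam i x.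
  rewrite /residual mulrBr -assemble_scale; congr (_ - _).
    rewrite (eq_assemble (Q' := fun nu => Q nu x)) //.
    by rewrite /assemble; apply: eq_bigr => l _; rewrite ee_period.
  rewrite /bloch !mulr_sumr; apply: eq_bigr => l _; rewrite ee_period; ring.
by rewrite normcM normc_ee mul1r.
Qed.

Lemma cmeas_bloch D i : cmeas D (bloch i).
Proof.
apply: cmeas_sum => l; apply: cmeasM; first exact: cmeasC.
by apply: cmeas_derive => x; exact: is_cderive_ee.
Qed.

Lemma cmeas_residual D (Q : nat -> R -> 'M[R[i]]_m) lam (i : 'I_m) : (forall nu i j, cmeas D (fun x => Q nu x i j)) ->
  cmeas D (residual Q lam i).
Proof.
move=> mQ; rewrite /residual.
rewrite (_ : (fun x => _) = (fun x => assemble (fun nu => Q nu x) (fun l => ee (ka l) x)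
   (fun k l => (ka l ^+ k)%:C) i + (- lam%:C) * bloch i x)); last first.
  by apply/funext => x; rewrite mulNr.
apply: cmeasD; last by apply: cmeasM; [exact: cmeasC|exact: cmeas_bloch].
apply: cmeas_sum => l; apply: cmeasM; first by apply: cmeas_derive => x; exact: is_cderive_ee.
apply: cmeasD; first exact: cmeasC.
apply: cmeas_sum => nu; apply: cmeas_sum => j; apply: cmeasM => //; exact: cmeasC.
Qed.

Section Truncated.
Variables (phi : nat -> R -> R).
Hypothesis dphi : forall k, (k <= n)%N -> forall x : R, is_derive x 1 (phi k) (phi k.+1 x).

Definition wave (i : 'I_m) (k : nat) (x : R) : R[i] :=
  \sum_l (c l i ord0)%:C * (ee (ka l) x * twisted phi (ka l) x k 0).

Definition truncated (x : R) : 'cV[R[i]]_m := \col_i wave i 0 x.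

Lemma truncatedE i x : truncated x i ord0 = (phi 0 x)%:C * bloch i x.
Proof.
rewrite mxE /wave /bloch mulr_sumr; apply: eq_bigr => l _.
by rewrite /twisted /=; ring.
Qed.

Lemma wave_derive i k x : (k <= n)%N -> is_cderive x (wave i k) (wave i k.+1 x).
Proof.
move=> kn; apply: is_cderive_sum => l; apply: is_cderiveZ.
by apply: (is_cderive_wave (ka l) (fun k kn => dphi kn x) kn).
Qed.

Lemma wave_vec_deriv k x : (k <= n)%N -> vec_deriv k truncated x = \col_i wave i k x.
Proof.
move=> kn; apply/matrixP => i j; rewrite !mxE.
have -> : (fun s => complex.Re (truncated s i ord0)) = (fun s => complex.Re (wave i 0 s)).
  by apply/funext => s; rewrite mxE.
have -> : (fun s => complex.Im (truncated s i ord0)) = (fun s => complex.Im (wave i 0 s)).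
  by apply/funext => s; rewrite mxE.
have dRe := @derive1n_chain R (fun k s => complex.Re (wave i k s)) n
  (fun k kn s => (wave_derive i s (ltnW kn)).1) k kn.
have dIm := @derive1n_chain R (fun k s => complex.Im (wave i k s)) n
  (fun k kn s => (wave_derive i s (ltnW kn)).2) k kn.
rewrite dRe dIm.
by case: (wave i k x).
Qed.

Lemma truncated_expr Q i x :
  diff_expr n Q truncated x i ord0 =
  assemble (fun nu => Q nu x) (fun l => ee (ka l) x)
    (fun k l => (0 -i* 1) ^+ k * twisted phi (ka l) x k 0) i.
Proof.
rewrite /diff_expr /assemble mxE summxE wave_vec_deriv // !mxE.
under [RHS]eq_bigr do rewrite mulrDr.
rewrite big_split /=; congr (_ + _).
  rewrite /wave mulr_sumr; apply: eq_bigr => l _; ring.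
under [RHS]eq_bigr do rewrite mulr_sumr.
rewrite exchange_big /=; apply: eq_bigr => nu _.
rewrite wave_vec_deriv ?leq_subr // !mxE mulr_sumr.
under [RHS]eq_bigr do rewrite mulr_sumr.
rewrite exchange_big /=; apply: eq_bigr => j _.
rewrite mxE /wave !mulr_sumr; apply: eq_bigr => l _; ring.
Qed.

(** If no derivative falls on the cutoff one finds the cutoff times the residual; every term
    collected in the second summand contains a derivative of the cutoff and is therefore
    small. *)
Lemma truncated_remainder Q lam i x :
  diff_expr n Q truncated x i ord0 - lam%:C * truncated x i ord0 =
  (phi 0 x)%:C * residual Q lam i x +
  assemble (fun nu => Q nu x) (fun l => ee (ka l) x)
   (fun k l => (0 -i* 1) ^+ k * (twisted phi (ka l) x k 0 - ('i * (ka l)%:C) ^+ k * (phi 0 x)%:C)) i.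
Proof.
have E k l : (0 -i* 1) ^+ k * (twisted phi (ka l) x k 0 - ('i * (ka l)%:C) ^+ k * (phi 0 x)%:C)
   = (0 -i* 1) ^+ k * twisted phi (ka l) x k 0 - (ka l ^+ k)%:C * (phi 0 x)%:C.
  rewrite mulrBr; congr (_ - _); rewrite mulrA -exprMn; congr (_ * _).
  by rewrite rmorphXn; congr (_ ^+ _); apply/eqP; rewrite eq_complex /=; apply/andP; split; apply/eqP; ring.
have -> : assemble (fun nu => Q nu x) (fun l => ee (ka l) x)
   (fun k l => (0 -i* 1) ^+ k * (twisted phi (ka l) x k 0 - ('i * (ka l)%:C) ^+ k * (phi 0 x)%:C)) i
  = assemble (fun nu => Q nu x) (fun l => ee (ka l) x)
   (fun k l => (0 -i* 1) ^+ k * twisted phi (ka l) x k 0 - (ka l ^+ k)%:C * (phi 0 x)%:C) i.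
  rewrite /assemble; apply: eq_bigr => l _; rewrite E; congr (_ * (_ + _)).
  by apply: eq_bigr => nu _; apply: eq_bigr => j _; rewrite E.
rewrite assembleB truncated_expr truncatedE /residual; ring.
Qed.

Lemma truncated_regular (K : R) : 0 <= K ->
  (forall k x, (k <= n)%N -> `|phi k x| <= K) -> vec_regular n truncated.
Proof.
move=> K0 pK i; pose B := \sum_l normc (c l i ord0)%:C * ((1 + `|ka l|) ^+ n * K).
have wB x : normc (wave i n x) <= B.
  apply: (le_trans (normc_sum _ _ _)); apply: ler_sum => l _.
  rewrite !normcM normc_ee mul1r ler_wpM2l ?normc_ge0 //; apply: twisted_bound => k.
  by rewrite addn0 => /andP[_ kn]; exact: pK.
have n0 : (0 < n)%N by exact: ltnW.
have E (f : R[i] -> R) : (fun x => f (truncated x i ord0)) = (fun x => f (wave i 0 x)).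
  by apply/funext => x; rewrite mxE.
rewrite !E; split.
  apply: (@real_regular_chain _ (fun k x => complex.Re (wave i k x)) n B n0).
    by move=> k kn x; exact: (wave_derive i x (ltnW kn)).1.
  by move=> x; apply: le_trans (Re_le_normc _) (wB x).
apply: (@real_regular_chain _ (fun k x => complex.Im (wave i k x)) n B n0).
  by move=> k kn x; exact: (wave_derive i x (ltnW kn)).2.
by move=> x; apply: le_trans (Im_le_normc _) (wB x).
Qed.

Lemma cmeas_truncated D i : cmeas D (fun x => truncated x i ord0).
Proof.
rewrite (_ : (fun x => _) = wave i 0); last by apply/funext => x; rewrite mxE.
by apply: cmeas_derive => x; exact: wave_derive.
Qed.

Lemma cmeas_expr (D : set R) (Q : nat -> R -> 'M[R[i]]_m) (i : 'I_m) : (forall nu i j, cmeas D (fun x => Q nu x i j)) ->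
  cmeas D (fun x => diff_expr n Q truncated x i ord0).
Proof.
move=> mQ.
have mw j k : (k <= n)%N -> cmeas D (wave j k).
  by move=> kn; apply: cmeas_derive => x; exact: wave_derive.
rewrite (_ : (fun x => _) = (fun x => (0 -i* 1) ^+ n * wave i n x + \sum_(2 <= nu < n.+1)
   (0 -i* 1) ^+ (n - nu) * \sum_j Q nu x i j * wave j (n - nu) x)); last first.
  apply/funext => x; rewrite /diff_expr mxE summxE wave_vec_deriv // !mxE; congr (_ + _).
  apply: eq_bigr => nu _; rewrite wave_vec_deriv ?leq_subr // !mxE; congr (_ * _).
  by apply: eq_bigr => j _; rewrite mxE.
apply: cmeasD; first by apply: cmeasM; [exact: cmeasC|exact: mw].
apply: cmeas_sum => nu; apply: cmeasM; first exact: cmeasC.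
by apply: cmeas_sum => j; apply: cmeasM => //; apply: mw; exact: leq_subr.
Qed.

End Truncated.

End BlochSums.

(** * Approximate solutions and the spectrum *)

Section PeriodicCoefficients.
Context {R : realType} {n m : nat}.
Variable (P : nat -> R -> 'M[R[i]]_m).
Hypothesis P_pt : forall k, (2 <= k <= n)%N ->
  forall i j : 'I_m, PT_periodic_L2 (fun x => P k x i j).
Local Notation mu := (@lebesgue_measure R).
Local Notation normc := (@ComplexField.Normc.normc R).

(** The coefficients are only almost everywhere periodic, and measurable only on [0, 1];
    repeating the values taken on [0, 1) gives equivalent ones that are both everywhere. *)
Definition periodized (nu : nat) (x : R) : 'M[R[i]]_m :=
  if (2 <= nu <= n)%N then P nu (x - (Num.floor x)%:~R) else 0.

Lemma periodized_cmeas nu i j : cmeas setT (fun x => periodized nu x i j).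
Proof.
rewrite /periodized; case: (boolP (2 <= nu <= n)%N) => [nun|_].
  by have [] := periodic_rep (P_pt nun i j).
rewrite (_ : (fun _ => _) = (fun=> 0)); first exact: cmeasC.
by apply/funext => x; rewrite mxE.
Qed.

Lemma periodized_period nu x : periodized nu (x + 1) = periodized nu x.
Proof.
rewrite /periodized; case: ifP => // nun; congr (P nu _).
by rewrite floorDrz ?rpred1 // floor1 intrD opprD addrACA subrr addr0.
Qed.

Lemma periodized_on_cell nu x : (2 <= nu <= n)%N -> 0 <= x < 1 -> periodized nu x = P nu x.
Proof.
move=> nun x01; rewrite /periodized nun (_ : Num.floor x = 0) ?subr0 //.
by apply: floor_def; rewrite add0r.
Qed.

Lemma periodized_ae : {ae mu, forall x, forall nu, (2 <= nu <= n)%N -> P nu x = periodized nu x}.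
Proof.
apply: ae_foralln => nu; have [nun|nun] := boolP (2 <= nu <= n)%N; last exact: aeW.
have h : {ae mu, forall x, forall i j, P nu x i j = periodized nu x i j}.
  apply: ae_ord => i; apply: ae_ord => j.
  rewrite /periodized nun; have [_ _ _ h] := periodic_rep (P_pt nun i j).
  exact: h.
by apply: ae_imp h => x h _; apply/matrixP.
Qed.

(** One periodic, locally integrable majorant for the squares of all entries. *)
Definition coef_weight (x : R) : R :=
  1 + \sum_(a : 'I_n.+1 * 'I_m * 'I_m) normc (periodized a.1.1 x a.1.2 a.2) ^+ 2.

Lemma coef_weight_ge1 x : 1 <= coef_weight x.
Proof. by rewrite lerDl sumr_ge0 // => a _; rewrite sqr_ge0. Qed.

Lemma coef_weight_period x : coef_weight (x + 1) = coef_weight x.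
Proof. by congr (_ + _); apply: eq_bigr => a _; rewrite periodized_period. Qed.

Lemma coef_weight_bound nu x i j : (2 <= nu <= n)%N ->
  normc (periodized nu x i j) <= Num.sqrt (coef_weight x).
Proof.
move=> /andP[_ nun]; have w0 : 0 <= coef_weight x by rewrite (le_trans ler01) // coef_weight_ge1.
rewrite -(@ler_pXn2r R 2) ?nnegrE ?normc_ge0 ?sqrtr_ge0 // sqr_sqrtr //.
rewrite /coef_weight (bigD1 (Ordinal (nun : (nu < n.+1)%N), i, j)) //= addrCA lerDl.
by rewrite addr_ge0 // sumr_ge0 // => a _; rewrite sqr_ge0.
Qed.

Lemma coef_weight_measurable : measurable_fun setT coef_weight.
Proof.
apply: measurable_funD; first exact: measurable_cst.
apply: measurable_sum => a; apply: measurable_normc_sqr; exact: periodized_cmeas.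
Qed.

Lemma coef_weight_integral :
  exists2 W : R, 0 <= W & (\int[mu]_(x in `[0%R, 1%R[) (coef_weight x)%:E <= W%:E)%E.
Proof.
have mD : measurable (`[0%R, 1%R[%classic : set R) by exact: measurable_itv.
have muD : mu `[0%R, 1%R[%classic = 1%:E by rewrite lebesgue_measure_itv /= lte_fin ltr01 sube0.
suff h : (\int[mu]_(x in `[0%R, 1%R[) (coef_weight x)%:E < +oo)%E.
  exists (fine (\int[mu]_(x in `[0%R, 1%R[) (coef_weight x)%:E)%E).
    by apply/fine_ge0/integral_ge0 => x _; rewrite lee_fin (le_trans ler01) // coef_weight_ge1.
  rewrite fineK // ge0_fin_numE //; apply: integral_ge0 => x _.
  by rewrite lee_fin (le_trans ler01) // coef_weight_ge1.
under eq_integral do rewrite /coef_weight EFinD -sumEFin.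
have mq (a : 'I_n.+1 * 'I_m * 'I_m) : measurable_fun (`[0%R, 1%R[%classic : set R) (fun x => (normc (periodized a.1.1 x a.1.2 a.2) ^+ 2)%:E).
  apply/measurable_EFinP/measurable_funTS; apply: measurable_normc_sqr; exact: periodized_cmeas.
rewrite ge0_integralD //; last 2 first.
- by move=> x _; apply: sume_ge0 => a _; rewrite lee_fin sqr_ge0.
- exact: emeasurable_sum.
rewrite int_const // muD mule1 ge0_integral_sum //; last first.
  by move=> a x _; rewrite lee_fin sqr_ge0.
rewrite lte_add_pinfty ?ltry //; apply: lte_sum_pinfty => a _.
have [nun|nun] := boolP (2 <= a.1.1 <= n)%N; last first.
  rewrite (eq_integral (cst 0%E)) ?integral0 ?ltry // => x _.
  by rewrite /periodized (negbTE nun) mxE ComplexField.Normc.normc0 expr0n.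
have [_ _ [mRe mIm fin]] := P_pt nun a.1.2 a.2; apply: le_lt_trans fin.
have mP : measurable_fun (`[0%R, 1%R]%classic : set R) (fun x => normc (P a.1.1 x a.1.2 a.2) ^+ 2).
  by apply: measurable_normc_sqr; split.
have sub : `[0%R, 1%R[%classic `<=` (`[0%R, 1%R]%classic : set R).
  by move=> x; rewrite /= !in_itv /= => /andP[-> /ltW ->].
apply: (@le_trans _ _ (\int[mu]_(x in `[0%R, 1%R[) (normc (P a.1.1 x a.1.2 a.2) ^+ 2)%:E)%E).
  rewrite le_eqVlt; apply/orP; left; apply/eqP; apply: eq_integral => x /set_mem; rewrite /= in_itv /= => x01.
  by rewrite periodized_on_cell.
apply: ge0_subset_integral => //; first exact/measurable_EFinP.
by move=> x _; rewrite lee_fin sqr_ge0.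
Qed.

End PeriodicCoefficients.

Section Criterion.
Context {R : realType} {n m : nat}.
Variable (P : nat -> R -> 'M[R[i]]_m).
Hypothesis n_gt1 : (1 < n)%N.
Hypothesis P_pt : forall k, (2 <= k <= n)%N ->
  forall i j : 'I_m, PT_periodic_L2 (fun x => P k x i j).
Local Notation mu := (@lebesgue_measure R).
Local Notation normc := (@ComplexField.Normc.normc R).
Local Notation Q := (periodized (n := n) P).

Lemma cmeas_residual_cell (I : finType) (z : I -> int) t (c : I -> 'cV[R]_m) lam i :
  cmeas `[0, 1]%classic (residual n z t c P lam i).
Proof.
pose P0 nu x := if (2 <= nu <= n)%N then P nu x else 0.
rewrite (_ : residual n z t c P lam i = residual n z t c P0 lam i).
  apply: cmeas_residual => nu j k; rewrite /P0; case: (boolP (2 <= nu <= n)%N) => [nun|_].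
    by have [_ _ [mRe mIm _]] := P_pt nun j k; split.
  rewrite (_ : (fun _ => _) = (fun=> 0)); first exact: cmeasC.
  by apply/funext => x; rewrite mxE.
apply/funext => x; congr (_ - _); apply: eq_assemble => nu nun.
by rewrite /P0 nun.
Qed.

Section OneSum.
Variables (I : finType) (z : I -> int) (t : R) (c : I -> 'cV[R]_m).
Variables (phi : nat -> R -> R) (K d c0 : R) (L : nat).
Hypothesis dphi : forall k, (k <= n)%N -> forall x : R, is_derive x 1 (phi k) (phi k.+1 x).
Hypothesis phi_size : forall k x, (k <= n)%N -> `|phi k x| <= (if k == 0%N then K else d).
Hypothesis dK : 0 <= d <= K.
Hypothesis phi_supp : forall k x, (2 * L)%:R <= `|x| -> phi k x = 0.
Hypothesis phi01 : forall x, 0 <= phi 0%N x <= 1.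
Local Notation y := (truncated z t c phi).
Local Notation S := (size_const n z t c).

Let d0 : 0 <= d. Proof. by case/andP: dK. Qed.
Let K0 : 0 <= K. Proof. by case/andP: dK; exact: le_trans. Qed.

Let phiK k x : (k <= n)%N -> `|phi k x| <= K.
Proof.
move=> kn; apply: (le_trans (phi_size x kn)); case: ifP => // _.
by case/andP: dK.
Qed.

Lemma expr_supp i x : (2 * L)%:R <= `|x| -> diff_expr n Q y x i ord0 = 0.
Proof.
move=> xL; rewrite truncated_expr // /assemble; apply: big1 => l _.
have tz k : twisted phi (freq t (z l)) x k 0 = 0 by apply: twisted_zero => k'; exact: phi_supp.
rewrite tz mulr0 mul0r add0r big1 ?mulr0 // => nu _; rewrite big1 // => j _.
by rewrite tz mulr0 mul0r mulr0.
Qed.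

Lemma expr_bound i x : normc (diff_expr n Q y x i ord0) <= S * (K * Num.sqrt (coef_weight (n := n) P x)).
Proof.
rewrite truncated_expr //; apply: assemble_bound => //.
- by move=> l; exact: normc_ee.
- by rewrite -[leLHS]sqrtr1 ler_wsqrtr // coef_weight_ge1.
- by move=> nu j nun; exact: coef_weight_bound.
- move=> k l kn; rewrite normcM normcX (_ : normc (0 -i* 1) = 1); last first.
    by rewrite /= expr0n sqrrN expr1n add0r sqrtr1.
  rewrite expr1n mul1r; apply: twisted_bound => i'; rewrite addn0 => /andP[_ ik].
  by apply: phiK; exact: leq_trans kn.
Qed.

Lemma remainder_bound lam i x :
  normc (diff_expr n Q y x i ord0 - lam%:C * y x i ord0) ^+ 2 <=
  2 * normc (residual n z t c Q lam i x) ^+ 2 + 2 * (S * d) ^+ 2 * coef_weight (n := n) P x.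
Proof.
rewrite truncated_remainder //; apply: (le_trans (normc_sqrD _ _)).
have w0 : 0 <= coef_weight (n := n) P x by rewrite (le_trans ler01) // coef_weight_ge1.
apply: lerD; last rewrite -[in leRHS]mulrA; rewrite ler_pM2l //.
  rewrite normcM normc_real exprMn ler_piMl ?sqr_ge0 //.
  by have /andP[p0 p1] := phi01 x; rewrite exprn_ile1 // ger0_norm.
have -> : (S * d) ^+ 2 * coef_weight (n := n) P x = (S * (d * Num.sqrt (coef_weight (n := n) P x))) ^+ 2.
  by rewrite mulrA [RHS]exprMn sqr_sqrtr.
rewrite ler_pXn2r ?nnegrE ?normc_ge0 //; last first.
  by rewrite mulr_ge0 ?size_const_ge0 // mulr_ge0 ?sqrtr_ge0.
apply: assemble_bound => //.
- by move=> l; exact: normc_ee.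
- by rewrite -[leLHS]sqrtr1 ler_wsqrtr // coef_weight_ge1.
- by move=> nu j nun; exact: coef_weight_bound.
- move=> k l kn; rewrite normcM normcX (_ : normc (0 -i* 1) = 1); last first.
    by rewrite /= expr0n sqrrN expr1n add0r sqrtr1.
  rewrite expr1n mul1r; apply: twisted_head => // i'; rewrite addn0 => /andP[i0 ik].
  by have := phi_size x (leq_trans ik kn); rewrite gtn_eqF.
Qed.

Lemma truncated_supp i x : (2 * L)%:R <= `|x| -> y x i ord0 = 0.
Proof. by move=> xL; rewrite truncatedE phi_supp // mul0r. Qed.

Lemma truncated_bound i x : normc (y x i ord0) <= S.
Proof.
rewrite truncatedE normcM normc_real; have /andP[p0 p1] := phi01 x.
by rewrite (ger0_norm p0) -[leRHS]mul1r ler_pM ?normc_ge0 // bloch_bound.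
Qed.

Lemma truncated_in_domain : operT n P y (diff_expr n Q y).
Proof.
have [W W0 hW] := coef_weight_integral P_pt.
have mW := coef_weight_measurable P_pt.
have my i : cmeas setT (fun x => y x i ord0) by exact: cmeas_truncated.
have mh i : cmeas setT (fun x => diff_expr n Q y x i ord0).
  by apply: cmeas_expr => // nu a b; exact: periodized_cmeas.
split.
- move=> i; split; [exact: (my i).1|exact: (my i).2|].
  have : (\int[mu]_x (normc (y x i ord0) ^+ 2)%:E <= ((4 * L)%:R * S ^+ 2)%:E)%E.
    apply: (@cells_above _ _ (fun=> S ^+ 2)) => //.
    + exact: measurable_normc_sqr.
    + by move=> x; rewrite sqr_ge0.
    + by move=> x; rewrite ler_pXn2r ?nnegrE ?normc_ge0 ?size_const_ge0 ?truncated_bound.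
    + by move=> x xL; rewrite truncated_supp // ComplexField.Normc.normc0 expr0n.
    + by rewrite int_const // lebesgue_measure_itv /= lte_fin ltr01 sube0 mule1.
  by move=> /le_lt_trans; apply; rewrite ltry.
- by apply: (truncated_regular z t c n_gt1 dphi K0) => k x; exact: phiK.
- move=> i; split; [exact: (mh i).1|exact: (mh i).2|].
  have : (\int[mu]_x (normc (diff_expr n Q y x i ord0) ^+ 2)%:E
     <= ((4 * L)%:R * ((S * K) ^+ 2 * W))%:E)%E.
    apply: (@cells_above _ _ (fun x => (S * K) ^+ 2 * coef_weight (n := n) P x)) => //.
    + exact: measurable_normc_sqr.
    + by apply: measurable_funM => //; exact: measurable_cst.
    + by move=> x; rewrite sqr_ge0.
    + by move=> x; rewrite coef_weight_period.
    + move=> x; have w0 : 0 <= coef_weight (n := n) P x by rewrite (le_trans ler01) // coef_weight_ge1.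
      have -> : (S * K) ^+ 2 * coef_weight (n := n) P x
        = (S * (K * Num.sqrt (coef_weight (n := n) P x))) ^+ 2.
        by rewrite mulrA [RHS]exprMn sqr_sqrtr.
      rewrite ler_pXn2r ?nnegrE ?normc_ge0 ?expr_bound //.
      by rewrite mulr_ge0 ?size_const_ge0 // mulr_ge0 ?sqrtr_ge0.
    + by move=> x xL; rewrite expr_supp // ComplexField.Normc.normc0 expr0n.
    + under eq_integral do rewrite EFinM.
      rewrite ge0_integralZl_EFin ?sqr_ge0 //; last 2 first.
      * by move=> x _; rewrite lee_fin (le_trans ler01) // coef_weight_ge1.
      * exact/measurable_EFinP/measurable_funTS.
      by rewrite [leRHS]EFinM lee_wpmul2l // lee_fin sqr_ge0.
  by move=> /le_lt_trans; apply; rewrite ltry.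
- apply: ae_imp (periodized_ae P_pt) => x PQ; rewrite /diff_expr; congr (_ + _).
  by apply: eq_big_nat => nu nun; rewrite PQ.
Qed.

Lemma residual_integral lam (r W : R) :
  (\int[mu]_(x in `[0%R, 1%R]) (\sum_i normc (residual n z t c P lam i x) ^+ 2)%:E <= r%:E)%E ->
  (\int[mu]_(x in `[0%R, 1%R[) (coef_weight (n := n) P x)%:E <= W%:E)%E ->
  (\int[mu]_x (\sum_i normc ((diff_expr n Q y x - lam%:C *: y x) i ord0) ^+ 2)%:E
   <= ((4 * L)%:R * (2 * r + m%:R * (2 * (S * d) ^+ 2) * W))%:E)%E.
Proof.
move=> hr hW.
have mD : measurable (`[0%R, 1%R[%classic : set R) by exact: measurable_itv.
have mW := coef_weight_measurable P_pt.
have mres i : measurable_fun setT (fun x => normc (residual n z t c Q lam i x) ^+ 2).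
  by apply: measurable_normc_sqr; apply: cmeas_residual => nu a b; exact: periodized_cmeas.
have mdiff i : cmeas setT (fun x => diff_expr n Q y x i ord0 - lam%:C * y x i ord0).
  rewrite (_ : (fun x => _) = (fun x => diff_expr n Q y x i ord0 + (- lam%:C) * y x i ord0)).
    apply: cmeasD; first by apply: cmeas_expr => // nu a b; exact: periodized_cmeas.
    by apply: cmeasM; [exact: cmeasC|exact: cmeas_truncated].
  by apply/funext => x; rewrite mulNr.
pose G x := 2 * (\sum_i normc (residual n z t c Q lam i x) ^+ 2)
   + m%:R * (2 * (S * d) ^+ 2) * coef_weight (n := n) P x.
have msum : measurable_fun setT (fun x => \sum_i normc (residual n z t c Q lam i x) ^+ 2).
  exact: measurable_sum.
have sd0 : 0 <= m%:R * (2 * (S * d) ^+ 2) by rewrite mulr_ge0 // mulr_ge0 // sqr_ge0.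
have eqF x : \sum_i normc ((diff_expr n Q y x - lam%:C *: y x) i ord0) ^+ 2 =
   \sum_i normc (diff_expr n Q y x i ord0 - lam%:C * y x i ord0) ^+ 2.
  by apply: eq_bigr => i _; rewrite !mxE.
under eq_integral do rewrite eqF.
apply: (@cells_above _ _ G) => //.
- by apply: measurable_sum => i; exact: measurable_normc_sqr.
- by apply: measurable_funD; apply: measurable_funM => //; exact: measurable_cst.
- by move=> x; apply: sumr_ge0 => i _; rewrite sqr_ge0.
- move=> x; rewrite /G coef_weight_period; congr (_ * _ + _); apply: eq_bigr => i _.
  by rewrite residual_period // => nu _; exact: periodized_period.
- move=> x; rewrite /G mulr_sumr.
  have -> : m%:R * (2 * (S * d) ^+ 2) * coef_weight (n := n) P x
    = \sum_(i < m) 2 * (S * d) ^+ 2 * coef_weight (n := n) P x.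
    by rewrite sumr_const card_ord -mulr_natl; ring.
  by rewrite -big_split /=; apply: ler_sum => i _; exact: remainder_bound.
- move=> x xL; apply: big1 => i _.
  by rewrite expr_supp // truncated_supp // mulr0 subr0 ComplexField.Normc.normc0 expr0n.
- rewrite int_comb //; last 4 first.
  + exact: measurable_funTS.
  + exact: measurable_funTS.
  + by move=> x _; apply: sumr_ge0 => i _; rewrite sqr_ge0.
  + by move=> x _; rewrite (le_trans ler01) // coef_weight_ge1.
  rewrite [leRHS]EFinD [X in (_ <= X + _)%E]EFinM [X in (_ <= _ + X)%E]EFinM.
  apply: leeD; rewrite lee_wpmul2l ?lee_fin //.
  apply: le_trans hr; apply: (@le_trans _ _ (\int[mu]_(x in `[0%R, 1%R[)
    (\sum_i normc (residual n z t c P lam i x) ^+ 2)%:E)%E); last first.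
    apply: ge0_subset_integral => //.
    * apply/measurable_EFinP/measurable_sum => i; apply: measurable_normc_sqr.
      exact: cmeas_residual_cell.
    * by move=> x _; rewrite lee_fin sumr_ge0 // => i _; rewrite sqr_ge0.
    * by move=> x; rewrite /= !in_itv /= => /andP[-> /ltW ->].
  rewrite le_eqVlt; apply/orP; left; apply/eqP; apply: eq_integral => x /set_mem.
  rewrite /= in_itv /= => x01; congr (_%:E); apply: eq_bigr => i _.
  congr (normc (_ - _) ^+ 2); apply: eq_assemble => nu nun.
  exact: periodized_on_cell.
Qed.

Lemma mass_integral (A : R) (L' : nat) : (2 * L')%N = L -> 0 < c0 ->
  (forall x, `|x| <= L%:R -> c0 <= phi 0%N x) ->
  (\int[mu]_(x in `[0%R, 1%R]) (\sum_i normc (bloch z t c i x) ^+ 2)%:E = A%:E)%E ->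
  (((4 * L')%:R * (c0 ^+ 2 * A))%:E <= \int[mu]_x (\sum_i normc (y x i ord0) ^+ 2)%:E)%E.
Proof.
move=> LL c00 phi_low hA.
have mb D : measurable_fun D (fun x => \sum_i normc (bloch z t c i x) ^+ 2).
  by apply: measurable_sum => i; apply: measurable_normc_sqr; exact: cmeas_bloch.
have b0 x : 0 <= \sum_i normc (bloch z t c i x) ^+ 2.
  by apply: sumr_ge0 => i _; rewrite sqr_ge0.
apply: (@cells_below _ _ (fun x => c0 ^+ 2 * \sum_i normc (bloch z t c i x) ^+ 2)).
- apply: measurable_sum => i; apply: measurable_normc_sqr; exact: cmeas_truncated.
- by apply: measurable_funM => //; exact: measurable_cst.
- by move=> x; rewrite mulr_ge0 ?sqr_ge0.
- by move=> x; congr (_ * _); apply: eq_bigr => i _; rewrite bloch_period.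
- by move=> x; apply: sumr_ge0 => i _; rewrite sqr_ge0.
- move=> x; rewrite LL => xL; rewrite mulr_sumr; apply: ler_sum => i _.
  rewrite truncatedE normcM normc_real exprMn ler_wpM2r ?sqr_ge0 //.
  have h := phi_low x xL; rewrite ger0_norm; last by case/andP: (phi01 x).
  by rewrite ler_pXn2r // nnegrE ?(ltW c00) //; case/andP: (phi01 x).
- under eq_integral do rewrite EFinM.
  rewrite ge0_integralZl_EFin ?sqr_ge0 //; last first.
  + by apply/measurable_EFinP; exact: mb.
  + by move=> x _; rewrite lee_fin.
  rewrite [RHS]EFinM; congr (_ * _)%E; rewrite -hA integral_itv_bndo_bndc //.
  by apply/measurable_EFinP; exact: mb.
Qed.

End OneSum.

(** A bounded resolvent would dominate the cut-off Bloch sums.  Over a cut-off of length L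
    their squared norm grows like L, while the error made by cutting off stays bounded, so
    only the residual per unit length matters in the limit, and it can be made small. *)
Theorem spectrum_of_approximate_solutions (lam : R) :
  (forall eta : R, 0 < eta -> exists (k : nat) (z : 'I_k -> int) (t : R) (c : 'I_k -> 'cV[R]_m)
     (A : R), [/\ 0 < A,
     (\int[mu]_(x in `[0%R, 1%R]) (\sum_i normc (bloch z t c i x) ^+ 2)%:E = A%:E)%E &
     (\int[mu]_(x in `[0%R, 1%R]) (\sum_i normc (residual n z t c P lam i x) ^+ 2)%:E
       <= (eta * A)%:E)%E]) ->
  spectrum (operT n P) lam%:C.
Proof.
move=> appr [_ _ [M HM]]; have [K K0 [c0 c00 cut]] := @cutoff_exists R n.
have M1 : 0 < 16 * (M ^+ 2 + 1) by rewrite mulr_gt0 // ltr_wpDl ?sqr_ge0.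
have c02 : 0 < c0 ^+ 2 by rewrite exprn_gt0.
have [|k [z [t [c [A [A0 YA rA]]]]]] := appr (c0 ^+ 2 / (16 * (M ^+ 2 + 1))).
  by rewrite divr_gt0.
have [W W0 hW] := coef_weight_integral P_pt.
set S := size_const n z t c; have S0 : 0 <= S by exact: size_const_ge0.
pose X := 16 * M ^+ 2 * m%:R * (S * K) ^+ 2 * W / (c0 ^+ 2 * A).
have X0 : 0 <= X.
  apply: divr_ge0; last exact/ltW/mulr_gt0.
  by do 4! (apply: mulr_ge0 => //); rewrite sqr_ge0.
pose L := (Num.truncn X).+1; have XL : X < L%:R by have /andP[] := truncn_itv X0.
have L1 : 1 <= L%:R :> R by rewrite ler1n.
have L20 : (0 < 2 * L)%N by rewrite muln_gt0.
have [phi [dphi psize psupp p01 plow]] := cut (2 * L)%N L20.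
pose d := K / (2 * L)%:R; have L2 : 1 <= (2 * L)%:R :> R by rewrite ler1n.
have dK : 0 <= d <= K.
  by rewrite /d divr_ge0 //= ler_pdivrMr ?(lt_le_trans ltr01) // ler_peMr.
have dom := truncated_in_domain z t c dphi psize dK psupp p01.
have := L2norm_le_sqr (HM _ _ dom).
have lower := mass_integral dphi p01 (erefl (2 * L)%N) c00 plow YA.
have upper := residual_integral dphi psize dK psupp p01 rA hW.
move=> /(le_trans lower) /le_trans /(_ (lee_wpmul2l _ upper)); rewrite lee_fin sqr_ge0.
move=> /(_ isT); rewrite -EFinM lee_fin; apply/negP; rewrite -ltNge.
have Lp : 0 < L%:R :> R by rewrite (lt_le_trans ltr01).
have e1 : M ^+ 2 * (c0 ^+ 2 / (16 * (M ^+ 2 + 1))) <= c0 ^+ 2 / 16.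
  have -> : c0 ^+ 2 / (16 * (M ^+ 2 + 1)) = c0 ^+ 2 / 16 * (M ^+ 2 + 1)^-1.
    by field; rewrite gt_eqF // ltr_wpDl ?sqr_ge0.
  rewrite mulrCA ler_piMr //; first by rewrite divr_ge0 // ltW.
  by rewrite ler_pdivrMr ?mul1r ?lerDl // ltr_wpDl ?sqr_ge0.
have e2 : 16 * (M ^+ 2 * (m%:R * ((S * K) ^+ 2 * W))) <= L%:R * (c0 ^+ 2 * A).
  have := ltW XL; rewrite /X ler_pdivrMr ?mulr_gt0 // => h.
  by rewrite (le_trans _ h) // le_eqVlt; apply/orP; left; apply/eqP; ring.
have e3 : (S * d) ^+ 2 <= (S * K) ^+ 2 / L%:R.
  have dL : d <= K / L%:R.
    by rewrite ler_wpM2l // lef_pV2 ?posrE ?(lt_le_trans ltr01 L2) // ler_nat leq_pmull.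
  have d2 : d ^+ 2 <= K ^+ 2 / L%:R.
    have /andP[d0' dK'] := dK.
    rewrite expr2 (le_trans (ler_pM d0' d0' dK' dL)) // mulrA -expr2 //.
  by rewrite (exprMn _ S d) (exprMn _ S K) -[leRHS]mulrA ler_wpM2l ?sqr_ge0.
have e4 : 16 * (M ^+ 2 * (m%:R * ((S * d) ^+ 2 * W))) <= c0 ^+ 2 * A.
  rewrite -(ler_pM2l Lp) (le_trans _ e2) //.
  have -> : L%:R * (16 * (M ^+ 2 * (m%:R * ((S * d) ^+ 2 * W))))
     = 16 * (M ^+ 2 * (m%:R * (L%:R * (S * d) ^+ 2 * W))) by ring.
  apply: ler_wpM2l => //; apply: ler_wpM2l; first exact: sqr_ge0.
  apply: ler_wpM2l => //; apply: ler_wpM2r => //.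
  by rewrite mulrC -ler_pdivlMr.
have e5 : M ^+ 2 * (c0 ^+ 2 / (16 * (M ^+ 2 + 1)) * A) <= c0 ^+ 2 / 16 * A.
  by rewrite mulrA ler_wpM2r // ltW.
have cA : 0 < c0 ^+ 2 * A by rewrite mulr_gt0.
set E := c0 ^+ 2 / (16 * (M ^+ 2 + 1)) * A in e5 *.
set V := (S * d) ^+ 2 in e4 *.
rewrite mulnCA natrM.
have -> : M ^+ 2 * (2 * (4 * L)%:R * (2 * E + m%:R * (2 * V) * W))
   = (4 * L)%:R * (4 * (M ^+ 2 * E) + 4 * (M ^+ 2 * (m%:R * (V * W)))) by ring.
rewrite ltr_pM2l ?ltr0n ?muln_gt0 //; clear -e4 e5 cA.
move: (M ^+ 2 * E) (M ^+ 2 * _) e4 e5 => u v e4 e5; move: (c0 ^+ 2) cA e4 e5 => w cA e4 e5; nra.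
Qed.

End Criterion.

(** * Fourier coefficients of approximants *)

Section FourierCoefficients.
Context {R : realType}.
Local Notation mu := (@lebesgue_measure R).
Local Notation normc := (@ComplexField.Normc.normc R).
Local Notation J := (`[0%R, 1%R]%classic : set R).

Lemma window_restrict (V : nmodType) (F : int -> V) (L W : nat) : (L <= W)%N ->
  \sum_(k < L.*2.+1) F (mode k) = \sum_(k < W.*2.+1 | (`|mode k| <= L)%N) F (mode k).
Proof.
move=> LW; pose h (k : 'I_(L.*2.+1)) : 'I_(W.*2.+1) := inord (k + (W - L)).
pose g (k : 'I_(W.*2.+1)) : 'I_(L.*2.+1) := inord (k - (W - L)).
have hE k : h k = (k + (W - L))%N :> nat by rewrite /h inordK //; have := ltn_ord k; lia.
have gE (k : 'I_(W.*2.+1)) : (`|mode k| <= L)%N -> g k = (k - (W - L))%N :> nat.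
  by rewrite /mode => kL; rewrite /g inordK //; have := ltn_ord k; lia.
have hm k : mode (h k) = mode k by rewrite /mode hE; clear -LW; lia.
have ml (k : 'I_(L.*2.+1)) : (`|mode k| <= L)%N.
  by rewrite /mode; have := ltn_ord k; clear; lia.
rewrite [RHS](reindex_onto h g) => [|k kL]; last first.
  apply: val_inj => /=; rewrite hE gE //; move: kL; rewrite /mode; have := ltn_ord k; clear -LW; lia.
apply: eq_big => [k|k _]; last by rewrite hm.
rewrite hm ml /=; apply/esym/eqP/val_inj => /=; rewrite gE ?hm // hE; clear; lia.
Qed.

Lemma sqr_sum_le (I : Type) (r : seq I) (x : I -> R) :
  (\sum_(i <- r) x i) ^+ 2 <= (size r)%:R * \sum_(i <- r) x i ^+ 2.
Proof.
elim: r => [|i r IH]; first by rewrite !big_nil expr0n mulr0.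
rewrite !big_cons /= -natr1; move: IH; set s := \sum_(j <- r) x j.
set T := \sum_(j <- r) _; set k : R := (size r)%:R => IH.
have T0 : 0 <= T by apply: sumr_ge0 => j _; rewrite sqr_ge0.
case: (posnP (size r)) => [r0|r0].
  have s0 : s ^+ 2 <= 0 by move: IH; rewrite /k r0 mul0r.
  have -> : s = 0 by apply/eqP; rewrite -sqrf_eq0 eq_le s0 sqr_ge0.
  by rewrite /k r0; lra.
have k0 : 0 < k by rewrite ltr0n.
have h : 0 <= k * (k * x i ^+ 2 + T - 2 * (x i * s)).
  have := sqr_ge0 (k * x i - s); lra.
by rewrite pmulr_rge0 // in h; lra.
Qed.

Lemma cmeas_laurent D d (q : {poly R}) : cmeas D (laurent d q).
Proof.
rewrite (_ : laurent d q = fun x => \sum_(i < size q) (q`_i)%:C * ee (2 * pi * (i%:Z - d%:Z)%:~R) x).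
  apply: cmeas_sum => i; apply: cmeasM; first exact: cmeasC.
  by apply: cmeas_derive => x; exact: is_cderive_ee.
by apply/funext => x; exact: laurent_sum.
Qed.

Lemma cmeasB D (f g : R -> R[i]) : cmeas D f -> cmeas D g -> cmeas D (fun x => f x - g x).
Proof.
move=> mf mg; rewrite (_ : (fun x => _) = (fun x => f x + (-1) * g x)).
  by apply: cmeasD => //; apply: cmeasM => //; exact: cmeasC.
by apply/funext => x; rewrite mulN1r.
Qed.

Lemma L2_triangle (D : set R) (u v : R -> R[i]) (a b : R) : measurable D ->
  cmeas D u -> cmeas D v ->
  (\int[mu]_(x in D) (normc (u x) ^+ 2)%:E <= a%:E)%E ->
  (\int[mu]_(x in D) (normc (v x) ^+ 2)%:E <= b%:E)%E ->
  (\int[mu]_(x in D) (normc (u x + v x) ^+ 2)%:E <= (2 * a + 2 * b)%:E)%E.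
Proof.
move=> mD mu' mv ua vb.
apply: (@le_trans _ _ (\int[mu]_(x in D) (2 * normc (u x) ^+ 2 + 2 * normc (v x) ^+ 2)%:E)%E).
  apply: int_le => //.
  - by apply: measurable_normc_sqr; exact: cmeasD.
  - by apply: measurable_funD; apply: measurable_funM; rewrite ?measurable_cst //; exact: measurable_normc_sqr.
  - by move=> x _; rewrite sqr_ge0.
  - by move=> x _; exact: normc_sqrD.
rewrite int_comb //; last 4 first.
- exact: measurable_normc_sqr.
- exact: measurable_normc_sqr.
- by move=> x _; rewrite sqr_ge0.
- by move=> x _; rewrite sqr_ge0.
rewrite [leRHS]EFinD [X in (_ <= X + _)%E]EFinM [X in (_ <= _ + X)%E]EFinM.
by apply: leeD; rewrite lee_wpmul2l ?lee_fin.
Qed.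

Lemma laurent_energy d (q : {poly R}) :
  (\int[mu]_(x in J) (normc (laurent d q x) ^+ 2)%:E = (\sum_(i < size q) q`_i ^+ 2)%:E)%E.
Proof.
rewrite -(@parseval R _ (fun i : 'I_(size q) => q`_i) 0 (fun i => i%:Z - d%:Z)).
  apply: eq_integral => x _; rewrite laurent_sum; congr ((normc _ ^+ 2)%:E).
  by apply: eq_bigr => j _; rewrite add0r.
by move=> i j /addIr [] /val_inj.
Qed.

(** Bessel's inequality, uniform in the window and in the shift. *)
Lemma lcoef_energy d (q : {poly R}) L (l : int) :
  \sum_(k < L.*2.+1) lcoef d q (mode k - l) ^+ 2 <= \sum_(i < size q) q`_i ^+ 2.
Proof.
pose W := (L + (`|l| + d + size q))%N.
rewrite (window_restrict (fun z => lcoef d q (z - l) ^+ 2) (leq_addr _ _ : L <= W)%N).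
have -> : \sum_(i < size q) q`_i ^+ 2 = \sum_(k < W.*2.+1) lcoef d q (mode k - l) ^+ 2.
  rewrite (@window_sum _ (fun z => lcoef d q z ^+ 2) d (size q)) ?leq_addl //.
    by apply: eq_bigr => i _; rewrite lcoefE.
  by move=> z; rewrite sqrf_eq0; exact: lcoef_support.
rewrite [leRHS](bigID (fun k => `|mode k| <= L)%N) /= lerDl.
by apply: sumr_ge0 => k _; rewrite sqr_ge0.
Qed.

Lemma laurent_mean d (q : {poly R}) :
  (\int[mu]_(x in J) (complex.Re (laurent d q x))%:E = (lcoef d q 0)%:E)%E /\
  (\int[mu]_(x in J) (complex.Im (laurent d q x))%:E = 0%:E)%E.
Proof.
have ReE x : complex.Re (laurent d q x) =
  \sum_(i < size q) (q`_i * cos (2 * pi * (i%:Z - d%:Z)%:~R * x) + 0 * sin (2 * pi * (i%:Z - d%:Z)%:~R * x)).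
  rewrite laurent_sum raddf_sum; apply: eq_bigr => i _.
  by etransitivity; [exact: complex_ReM|rewrite /ee /=; ring].
have ImE x : complex.Im (laurent d q x) =
  \sum_(i < size q) (0 * cos (2 * pi * (i%:Z - d%:Z)%:~R * x) + q`_i * sin (2 * pi * (i%:Z - d%:Z)%:~R * x)).
  rewrite laurent_sum raddf_sum; apply: eq_bigr => i _.
  by etransitivity; [exact: complex_ImM|rewrite /ee /=; ring].
split; [under eq_integral do rewrite ReE|under eq_integral do rewrite ImE]; rewrite trig_integral.
  congr (_%:E); rewrite /lcoef add0r.
  have [dq|dq] := ltnP d (size q).
    rewrite (big_pred1 (Ordinal dq)) // => i; rewrite subr_eq0.
    by apply/eqP/eqP => [[] h|->//]; exact: val_inj.
  rewrite nth_default // big1 // => i; rewrite subr_eq0 => /eqP [] h.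
  by have := ltn_ord i; rewrite h ltnNge dq.
by rewrite big1.
Qed.

Section Approximants.
Variables (p : R -> R[i]) (e : R).
Hypothesis p_meas : cmeas J p.

Definition approximant d (q : {poly R}) : Prop :=
  (\int[mu]_(x in J) (normc (p x - laurent d q x) ^+ 2)%:E <= e%:E)%E.

Let mJ : measurable J. Proof. exact: measurable_itv. Qed.

Lemma approximant_energy (E : R) d (q : {poly R}) : approximant d q ->
  (\int[mu]_(x in J) (normc (p x) ^+ 2)%:E <= E%:E)%E ->
  \sum_(i < size q) q`_i ^+ 2 <= 2 * E + 2 * e.
Proof.
move=> pq pE; rewrite -lee_fin -(laurent_energy d).
have mv : cmeas J (fun x => laurent d q x - p x).
  by apply: cmeasB => //; exact: cmeas_laurent.
have vE : (\int[mu]_(x in J) (normc (laurent d q x - p x) ^+ 2)%:E <= e%:E)%E.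
  by under eq_integral do rewrite -opprB normcN.
have := L2_triangle mJ p_meas mv pE vE.
by under eq_integral do rewrite addrC subrK.
Qed.

(** Parseval for the difference of the two polynomials, whose norm is bounded by the
    triangle inequality through p. *)
Lemma approximant_coef_close d q d' q' z : approximant d q -> approximant d' q' ->
  (lcoef d q z - lcoef d' q' z) ^+ 2 <= 4 * e.
Proof.
move=> pq pq'.
pose W := (`|z| + (d + size q) + (d' + size q'))%N.
have win (x : R) : laurent d q x - laurent d' q' x =
  \sum_(k < W.*2.+1) (lcoef d q (mode k) - lcoef d' q' (mode k))%:C * ee (0 + 2 * pi * (mode k)%:~R) x.
  have h1 : (`|0%Z| + d + size q <= W)%N by rewrite /W; lia.
  have h2 : (`|0%Z| + d' + size q' <= W)%N by rewrite /W; lia.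
  rewrite (laurent_window x h1) (laurent_window x h2) -sumrB; apply: eq_bigr => k _.
  by rewrite !subr0 add0r -mulrBl; congr (_ * _); rewrite rmorphB.
have mp d0 q0 : cmeas J (fun x => p x - laurent d0 q0 x).
  by apply: cmeasB => //; exact: cmeas_laurent.
have mp' : cmeas J (fun x => laurent d q x - p x).
  by apply: cmeasB => //; exact: cmeas_laurent.
have vE : (\int[mu]_(x in J) (normc (laurent d q x - p x) ^+ 2)%:E <= e%:E)%E.
  by under eq_integral do rewrite -opprB normcN.
have := L2_triangle mJ mp' (mp d' q') vE pq'.
under eq_integral do rewrite addrA subrK win.
rewrite (parseval (fun k => lcoef d q (mode k) - lcoef d' q' (mode k)) 0 (@mode_inj W)) lee_fin.
have [k kz] : exists k : 'I_(W.*2.+1), mode k = z.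
  have kW : (`|(z + W%:Z)%R| < W.*2.+1)%N by rewrite /W; lia.
  by exists (Ordinal kW); rewrite /mode /=; rewrite /W; lia.
rewrite (bigD1 k) //= kz => h; apply: le_trans (_ : 2 * e + 2 * e <= _); last lra.
by apply: le_trans h; rewrite lerDl sumr_ge0 // => j _; rewrite sqr_ge0.
Qed.

End Approximants.

Lemma approximant_mean (p : R -> R[i]) (e : R) d (q : {poly R}) : cmeas J p -> 0 < e ->
  (\int[mu]_(x in J) (normc (p x) ^+ 2)%:E < +oo)%E ->
  approximant p (e ^+ 2) d q ->
  `| (\int[mu]_(x in J) complex.Re (p x))%R - lcoef d q 0| <= e /\
  `| (\int[mu]_(x in J) complex.Im (p x))%R| <= e.
Proof.
move=> [mRe mIm] e0 fin pq; have mJ : measurable J by exact: measurable_itv.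
have mn : measurable_fun J (fun x => normc (p x) ^+ 2).
  by apply: measurable_normc_sqr; split.
have fR : (\int[mu]_(x in J) (complex.Re (p x) ^+ 2)%:E < +oo)%E.
  apply: le_lt_trans fin; apply: int_le => //; first exact: measurable_funX.
    by move=> x _; rewrite sqr_ge0.
  by move=> x _; rewrite normc_sqr lerDl sqr_ge0.
have fI : (\int[mu]_(x in J) (complex.Im (p x) ^+ 2)%:E < +oo)%E.
  apply: le_lt_trans fin; apply: int_le => //; first exact: measurable_funX.
    by move=> x _; rewrite sqr_ge0.
  by move=> x _; rewrite normc_sqr lerDr sqr_ge0.
have [LR LI] := laurent_mean d q.
have md : cmeas J (fun x => p x - laurent d q x).
  by apply: cmeasB; [split|exact: cmeas_laurent].
have cont (f : R -> R) (df : R -> R) : (forall x : R, is_derive x 1 f (df x)) -> continuous f.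
  move=> h x; apply: differentiable_continuous; apply/derivable1_diffP.
  exact: (@ex_derive _ _ _ _ _ _ _ (h x)).
have dl (x : R) : is_cderive x (laurent d q) (\sum_(i < size q)
    (q`_i)%:C * ('i * (2 * pi * (i%:Z - d%:Z)%:~R)%:C * ee (2 * pi * (i%:Z - d%:Z)%:~R) x)).
  have -> : laurent d q = (fun x => \sum_(i < size q) (q`_i)%:C * ee (2 * pi * (i%:Z - d%:Z)%:~R) x).
    by apply/funext => s; exact: laurent_sum.
  by apply: is_cderive_sum => i; apply: is_cderiveZ; exact: is_cderive_ee.
split.
  apply: (mean_close (g := fun x => complex.Re (laurent d q x))) => //.
    exact: (cont _ _ (fun x => (dl x).1)).
  apply: le_trans pq; apply: int_le => //.
  - apply: measurable_funX; apply: measurable_funB => //; exact: (cmeas_laurent J d q).1.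
  - exact: measurable_normc_sqr.
  - by move=> x _; rewrite sqr_ge0.
  - by move=> x _; rewrite normc_sqr raddfB lerDl sqr_ge0.
rewrite -[X in `|X|]subr0.
apply: (mean_close (g := fun x => complex.Im (laurent d q x))) => //.
  exact: (cont _ _ (fun x => (dl x).2)).
apply: le_trans pq; apply: int_le => //.
- apply: measurable_funX; apply: measurable_funB => //; exact: (cmeas_laurent J d q).2.
- exact: measurable_normc_sqr.
- by move=> x _; rewrite sqr_ge0.
- by move=> x _; rewrite normc_sqr !raddfB /= lerDr sqr_ge0.
Qed.

End FourierCoefficients.

(** * Approximation of the matrix coefficients *)

Section ApproximatedCoefficients.
Context {R : realType} {n m : nat}.
Variable (P : nat -> R -> 'M[R[i]]_m).
Hypothesis P_pt : forall k, (2 <= k <= n)%N ->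
  forall i j : 'I_m, PT_periodic_L2 (fun x => P k x i j).
Local Notation mu := (@lebesgue_measure R).
Local Notation normc := (@ComplexField.Normc.normc R).
Local Notation J := (`[0%R, 1%R]%classic : set R).

Definition entry (u : nat * 'I_m * 'I_m) (x : R) : R[i] := P u.1.1 x u.1.2 u.2.

Definition approximates (e : R) (f : nat * 'I_m * 'I_m -> nat * {poly R}) : Prop :=
  forall u, (2 <= u.1.1 <= n)%N -> approximant (entry u) e (f u).1 (f u).2.

Definition coefs (f : nat * 'I_m * 'I_m -> nat * {poly R}) (nu : nat) (z : int) : 'M[R]_m :=
  \matrix_(i, j) lcoef (f (nu, i, j)).1 (f (nu, i, j)).2 z.

Definition mean_coef : 'M[R]_m :=
  \matrix_(i, j) (\int[mu]_(x in J) complex.Re (P 2%N x i j))%R.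

Lemma entry_cmeas u : (2 <= u.1.1 <= n)%N -> cmeas J (entry u).
Proof. by move=> un; have [_ _ [mRe mIm _]] := P_pt un u.1.2 u.2; split. Qed.

Lemma entry_fin u : (2 <= u.1.1 <= n)%N -> (\int[mu]_(x in J) (normc (entry u x) ^+ 2)%:E < +oo)%E.
Proof. by move=> un; have [_ _ [_ _]] := P_pt un u.1.2 u.2. Qed.

Lemma approximates_exists (e : R) : 0 < e -> exists f, approximates e f.
Proof.
move=> e0; have h u : exists v : nat * {poly R},
    (2 <= u.1.1 <= n)%N -> approximant (entry u) e v.1 v.2.
  have [un|un] := boolP (2 <= u.1.1 <= n)%N; last by exists (0%N, 0).
  by have [d [q h]] := pt_approx (P_pt un u.1.2 u.2) e0; exists (d, q).
by have [f hf] := choice h; exists f.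
Qed.

Lemma approximatesW e e' f : e <= e' -> approximates e f -> approximates e' f.
Proof. by move=> ee' fe u un; apply: le_trans (fe u un) _; rewrite lee_fin. Qed.

Lemma n1_sqr_le p q (A : 'M[R]_(p, q)) : n1 A ^+ 2 <= (p * q)%:R * \sum_i \sum_j A i j ^+ 2.
Proof.
have sz k : size (index_enum 'I_k) = k by rewrite -sum1_size sum1_card card_ord.
rewrite /n1 (le_trans (sqr_sum_le _ _)) // sz natrM -mulrA ler_wpM2l // mulr_sumr.
apply: ler_sum => i _; rewrite (le_trans (sqr_sum_le _ _)) // sz ler_wpM2l //.
by apply: ler_sum => j _; rewrite real_normK ?num_real.
Qed.

Definition energy (u : nat * 'I_m * 'I_m) : R := fine (\int[mu]_(x in J) (normc (entry u x) ^+ 2)%:E)%E.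

Lemma energyE u : (2 <= u.1.1 <= n)%N ->
  (\int[mu]_(x in J) (normc (entry u x) ^+ 2)%:E <= (energy u)%:E)%E.
Proof.
move=> un; rewrite /energy fineK // ge0_fin_numE ?entry_fin //.
by apply: integral_ge0 => x _; rewrite lee_fin sqr_ge0.
Qed.

(** Depends on the norms of the coefficients only: an approximant of accuracy at most 1 has
    energy at most 2 energy + 2. *)
Definition coef_energy : R :=
  ((n.+1 - 2) * (m * m))%:R * \sum_(2 <= nu < n.+1) \sum_i \sum_j (2 * energy (nu, i, j) + 2).

Lemma coef_energy_ge0 : 0 <= coef_energy.
Proof.
rewrite /coef_energy mulr_ge0 // sumr_ge0 // => nu _; do 2 (apply: sumr_ge0 => ? _).
rewrite addr_ge0 // mulr_ge0 // fine_ge0 //; apply: integral_ge0 => x _.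
by rewrite lee_fin sqr_ge0.
Qed.

Lemma coefs_square f (e : R) L l : 0 <= e <= 1 -> approximates e f ->
  \sum_(k < L.*2.+1) coef_size n (coefs f) (mode k - l) ^+ 2 <= coef_energy.
Proof.
move=> /andP[e0 e1] fe.
have h z : coef_size n (coefs f) z ^+ 2 <= ((n.+1 - 2) * (m * m))%:R *
    \sum_(2 <= nu < n.+1) \sum_i \sum_j coefs f nu z i j ^+ 2.
  rewrite /coef_size (le_trans (sqr_sum_le _ _)) // size_iota natrM -mulrA ler_wpM2l // mulr_sumr.
  by apply: ler_sum => nu _; exact: n1_sqr_le.
apply: (le_trans (ler_sum _ (fun k _ => h _))); rewrite -mulr_sumr ler_wpM2l //.
rewrite exchange_big /=; apply: ler_sum_nat => nu nun.
rewrite exchange_big /=; apply: ler_sum => i _.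
rewrite exchange_big /=; apply: ler_sum => j _.
under eq_bigr do rewrite mxE.
apply: (le_trans (lcoef_energy _ _ _ _)).
have un : (2 <= (nu, i, j).1.1 <= n)%N by [].
rewrite (le_trans (approximant_energy (entry_cmeas un) (fe _ un) (energyE un))) //.
by rewrite lerD2l; lra.
Qed.

Lemma coefs_size f (e : R) z : 0 <= e <= 1 -> approximates e f ->
  coef_size n (coefs f) z <= 1 + coef_energy.
Proof.
move=> e01 fe; have := coefs_square `|z|%N 0 e01 fe.
have [k kz] : exists k : 'I_(`|z|%N.*2.+1), mode k = z.
  have kW : (`|(z + `|z|%N%:Z)%R| < `|z|%N.*2.+1)%N by lia.
  by exists (Ordinal kW); rewrite /mode /=; lia.
rewrite (bigD1 k) //= kz subr0; set s := coef_size _ _ _; set T := \sum_(_ | _) _ => h.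
have T0 : 0 <= T by apply: sumr_ge0 => j _; rewrite sqr_ge0.
have := sqr_ge0 (s - 1); nra.
Qed.

Lemma n1_le_const (A : 'M[R]_m) (b : R) : (forall i j, `|A i j| <= b) -> n1 A <= (m * m)%:R * b.
Proof.
move=> Ab; rewrite /n1; apply: (le_trans (ler_sum _ (fun i _ => ler_sum _ (fun j _ => Ab i j)))).
by rewrite !sumr_const !card_ord -mulrnA mulr_natl.
Qed.

(** The bounds on the size depend on the norms of the coefficients only. A threshold N0
    common to all approximations is read off a fixed one, whose coefficients vanish beyond
    its degree: those of any other approximation of the same accuracy are close to them. *)
Lemma good_coefs_of_approximation (eta : R) : (1 < n)%N -> 0 < eta ->
  exists2 s0 : R, 0 < s0 & exists N0 : nat, forall s f, 0 < s <= s0 -> approximates (s ^+ 2) f ->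
    good_coefs n mean_coef (1 + coef_energy) eta N0 (coefs f).
Proof.
move=> n1n eta0; pose M : R := 2 * ((m * m)%:R + 1).
have M0 : 0 < M by rewrite mulr_gt0 // ltr_wpDl.
pose s0 := Num.min 1 (eta / M).
have s00 : 0 < s0 by rewrite lt_min ltr01 divr_gt0.
have s01 : s0 <= 1 by rewrite ge_min lexx.
have sM : (m * m)%:R * (2 * s0) <= eta.
  have h : s0 * M <= eta by rewrite -ler_pdivlMr // ge_min lexx orbT.
  by move: h; rewrite /M; lra.
exists s0 => //; have [f0 f0P] := approximates_exists (exprn_gt0 2 s00).
exists (\sum_i \sum_j ((f0 (2, i, j)).1 + size (f0 (2, i, j)).2))%N => s f /andP[sp ss] fs.
have two : (2 <= 2 <= n)%N by [].
have ss2 : s ^+ 2 <= s0 ^+ 2 by rewrite ler_pXn2r // nnegrE ltW.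
have e01 : 0 <= s ^+ 2 <= 1 by rewrite sqr_ge0 /= (le_trans ss2) // exprn_ile1 // ltW.
split.
- by move=> z; exact: coefs_size e01 fs.
- by move=> L l; rewrite (le_trans (coefs_square L l e01 fs)) // lerDr.
- apply: le_trans sM; apply: n1_le_const => i j; rewrite !mxE.
  have [h _] := approximant_mean (@entry_cmeas (2, i, j)%N two) sp (@entry_fin (2, i, j)%N two) (fs (2, i, j)%N two).
  by move: h; rewrite distrC /entry /=; lra.
- move=> z Nz; apply: le_trans sM; apply: n1_le_const => i j; rewrite mxE.
  have z0 : lcoef (f0 (2, i, j)%N).1 (f0 (2, i, j)%N).2 z = 0.
    apply/eqP; apply: contraT => /lcoef_support [k ks zk].
    have h : ((f0 (2, i, j)).1 + size (f0 (2, i, j)).2 <= `|z|)%N.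
      by apply: leq_trans Nz; rewrite (bigD1 i) //= (bigD1 j) //= -addnA leq_addr.
    move: ks zk h; move: (f0 _).1 (size _) => d0 s1; clear; lia.
  have fs' := approximatesW ss2 fs.
  have := approximant_coef_close (@entry_cmeas (2, i, j)%N two) z (fs' (2, i, j)%N two) (f0P (2, i, j)%N two).
  rewrite z0 subr0 (_ : 4 * s0 ^+ 2 = (2 * s0) ^+ 2); last by ring.
  by rewrite -[X in X <= _]real_normK ?num_real // ler_pXn2r // nnegrE // mulr_ge0 // ltW.
Qed.

End ApproximatedCoefficients.

(** * The residual of the solutions of finite systems *)

Section GalerkinResidual.
Context {R : realType} {n m : nat}.
Variable (P : nat -> R -> 'M[R[i]]_m).
Hypothesis P_pt : forall k, (2 <= k <= n)%N ->
  forall i j : 'I_m, PT_periodic_L2 (fun x => P k x i j).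
Local Notation mu := (@lebesgue_measure R).
Local Notation normc := (@ComplexField.Normc.normc R).
Local Notation J := (`[0%R, 1%R]%classic : set R).

Let mJ : measurable J. Proof. exact: measurable_itv. Qed.

Lemma int_sum_le (I : Type) (s : seq I) (F : I -> R -> R) (b : I -> R) :
  (forall i, measurable_fun J (F i)) -> (forall i x, 0 <= F i x) ->
  (forall i, (\int[mu]_(x in J) (F i x)%:E <= (b i)%:E)%E) ->
  (\int[mu]_(x in J) (\sum_(i <- s) F i x)%:E <= (\sum_(i <- s) b i)%:E)%E.
Proof.
move=> mF F0 Fb; under eq_integral do rewrite -sumEFin.
rewrite ge0_integral_sum //; last 2 first.
- by move=> i; apply/measurable_EFinP; exact: mF.
- by move=> i x _; rewrite lee_fin.
by rewrite -sumEFin; apply: lee_sum => i _; exact: Fb.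
Qed.

Variables (f : nat * 'I_m * 'I_m -> nat * {poly R}) (e : R) (D L : nat) (t r : R).
Variable (c : 'I_(L.*2.+1) -> 'cV[R]_m).
Hypothesis fe : approximates (n := n) P e f.
Hypothesis f_degree : forall u, (2 <= u.1.1 <= n)%N -> ((f u).1 + size (f u).2 <= D)%N.
Hypothesis c_sol : galerkin_solution n (coefs f) r t c.
Local Notation W := (L + D)%N.
Local Notation ka l := (freq t (mode l)).

(** Multiplication by the coefficients moves part of the sum to modes outside the window
    that the finite system controls. *)
Definition spill (z : int) : 'cV[R]_m := \sum_l coupling n (coefs f) t z (mode l) *m c l.

Definition approximation_error (i : 'I_m) (x : R) : R[i] :=
  \sum_l ee (ka l) x * \sum_(2 <= nu < n.+1) \sum_j
    (entry P (nu, i, j) x - laurent (f (nu, i, j)).1 (f (nu, i, j)).2 x)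
      * ((ka l ^+ (n - nu))%:C * (c l j ord0)%:C).

Lemma spill_entry z i : spill z i ord0 = \sum_l \sum_(2 <= nu < n.+1) \sum_j
  lcoef (f (nu, i, j)).1 (f (nu, i, j)).2 (z - mode l) * (ka l ^+ (n - nu) * c l j ord0).
Proof.
rewrite /spill summxE; apply: eq_bigr => l _; rewrite mxE /coupling.
under eq_bigr do rewrite summxE mulr_suml.
rewrite exchange_big /=; apply: eq_bigr => nu _; apply: eq_bigr => j _.
by rewrite !mxE; ring.
Qed.

Lemma laurent_action i x :
  \sum_l ee (ka l) x * \sum_(2 <= nu < n.+1) \sum_j
    laurent (f (nu, i, j)).1 (f (nu, i, j)).2 x * ((ka l ^+ (n - nu))%:C * (c l j ord0)%:C)
  = \sum_(k < W.*2.+1) (spill (mode k) i ord0)%:C * ee (ka k) x.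
Proof.
have rhs (k : 'I_(W.*2.+1)) : (spill (mode k) i ord0)%:C * ee (ka k) x =
   \sum_l \sum_(2 <= nu < n.+1) \sum_j ee (ka l) x *
     ((lcoef (f (nu, i, j)).1 (f (nu, i, j)).2 (mode k - mode l))%:C
       * ee (2 * pi * (mode k - mode l)%:~R) x * ((ka l ^+ (n - nu))%:C * (c l j ord0)%:C)).
  rewrite spill_entry rmorph_sum mulr_suml; apply: eq_bigr => l _.
  rewrite rmorph_sum mulr_suml; apply: eq_bigr => nu _.
  rewrite rmorph_sum mulr_suml; apply: eq_bigr => j _.
  have -> : ee (ka k) x = ee (ka l) x * ee (2 * pi * (mode k - mode l)%:~R) x.
    by rewrite -eeD /freq intrB; congr (ee _ x); ring.
  by rewrite !rmorphM; ring.
under [RHS]eq_bigr do rewrite rhs.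
rewrite exchange_big /=; apply: eq_bigr => l _.
rewrite [RHS]exchange_big /= mulr_sumr; apply: eq_big_nat => nu nun.
rewrite [RHS]exchange_big /= mulr_sumr; apply: eq_bigr => j _.
rewrite -mulr_sumr -mulr_suml; congr (_ * (_ * _)).
apply: laurent_window; have := f_degree (u := (nu, i, j)) nun; rewrite /mode.
have := ltn_ord l; move: (f _).1 (size _) => d0 s1; clear; lia.
Qed.

(** Inside the window the finite system cancels the action of the approximated coefficients.
    What remains is the spill outside the window and the error of the approximation. *)
Lemma residual_split i x : residual n (@mode L) t c P (r ^+ n) i x =
  \sum_(k < W.*2.+1) (if (`|mode k| <= L)%N then 0 else spill (mode k) i ord0)%:C * ee (ka k) x
  + approximation_error i x.
Proof.
have main : residual n (@mode L) t c P (r ^+ n) i x =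
  \sum_l ((ka l ^+ n - r ^+ n) * c l i ord0)%:C * ee (ka l) x
  + \sum_l ee (ka l) x * \sum_(2 <= nu < n.+1) \sum_j
    laurent (f (nu, i, j)).1 (f (nu, i, j)).2 x * ((ka l ^+ (n - nu))%:C * (c l j ord0)%:C)
  + approximation_error i x.
  rewrite /residual /assemble /bloch /approximation_error mulr_sumr -sumrB -!big_split /=.
  apply: eq_bigr => l _; rewrite rmorphM rmorphB.
  have -> : \sum_(2 <= nu < n.+1) \sum_j P nu x i j * ((ka l ^+ (n - nu))%:C * (c l j ord0)%:C)
    = \sum_(2 <= nu < n.+1) \sum_j laurent (f (nu, i, j)).1 (f (nu, i, j)).2 x
        * ((ka l ^+ (n - nu))%:C * (c l j ord0)%:C)
    + \sum_(2 <= nu < n.+1) \sum_j (entry P (nu, i, j) x - laurent (f (nu, i, j)).1 (f (nu, i, j)).2 x)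
        * ((ka l ^+ (n - nu))%:C * (c l j ord0)%:C).
    rewrite -big_split /=; apply: eq_bigr => nu _; rewrite -big_split /=; apply: eq_bigr => j _.
    by rewrite /entry /=; ring.
  ring.
rewrite main laurent_action; congr (_ + _).
have -> : \sum_l ((ka l ^+ n - r ^+ n) * c l i ord0)%:C * ee (ka l) x
   = - \sum_(l < L.*2.+1) (spill (mode l) i ord0)%:C * ee (ka l) x.
  rewrite -sumrN; apply: eq_bigr => l _; rewrite -mulNr -rmorphN; congr (_%:C * _).
  have /(congr1 (fun A : 'cV[R]_m => A i ord0)) := c_sol l.
  by rewrite !mxE => /eqP; rewrite addr_eq0 => /eqP ->; rewrite /spill.
rewrite (window_restrict (fun z => (spill z i ord0)%:C * ee (freq t z) x) (leq_addr D L)).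
rewrite [X in _ + X](bigID (fun k => `|mode k| <= L)%N) /= addKr.
rewrite [RHS](bigID (fun k => `|mode k| <= L)%N) /= [X in _ = X + _]big1 ?add0r; last first.
  by move=> k ->; rewrite mul0r.
by apply: eq_bigr => k /negbTE ->.
Qed.

Let G : R := mass (fun k => weight n r (mode k)) c.

Hypothesis r_ge0 : 0 <= r.
Hypothesis tr : `|t - r| <= 1.

Lemma freq_le_weight nu z : (2 <= nu <= n)%N -> `|freq t z ^+ (n - nu)| <= weight n r z.
Proof.
move=> /andP[nu2 nun]; rewrite normrX.
apply: (@le_trans _ _ ((`|freq r z| + r + 1) ^+ (n - nu))).
  rewrite lerXn2r ?nnegrE ?addr_ge0 //.
  by rewrite (le_trans (freq_close _ tr)) // lerD2r lerDl.
by rewrite /weight ler_weXn2l ?lerDr ?addr_ge0 // leq_sub2l.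
Qed.

Let G_ge0 : 0 <= G.
Proof.
by apply: sumr_ge0 => l _; rewrite mulr_ge0 ?n1_ge0 // exprn_ge0 // !addr_ge0.
Qed.

Let defect (u : nat * 'I_m * 'I_m) (x : R) : R :=
  normc (entry P u x - laurent (f u).1 (f u).2 x).

Lemma approximation_error_bound i x : normc (approximation_error i x) ^+ 2 <=
  G ^+ 2 * ((n.+1 - 2) * m)%:R * \sum_(2 <= nu < n.+1) \sum_j defect (nu, i, j) x ^+ 2.
Proof.
have h : normc (approximation_error i x) <= G * \sum_(2 <= nu < n.+1) \sum_j defect (nu, i, j) x.
  rewrite /approximation_error (le_trans (normc_sum _ _ _)) // /G /mass mulr_suml.
  apply: ler_sum => l _; rewrite normcM normc_ee mul1r.
  rewrite (le_trans (normc_sum _ _ _)) // mulr_sumr; apply: ler_sum_nat => nu nun.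
  rewrite (le_trans (normc_sum _ _ _)) // mulr_sumr; apply: ler_sum => j _.
  rewrite !normcM !normc_real mulrC ler_wpM2r ?normc_ge0 //.
  by apply: ler_pM => //; [exact: freq_le_weight|exact: n1_entry].
have h2 : (\sum_(2 <= nu < n.+1) \sum_j defect (nu, i, j) x) ^+ 2
   <= ((n.+1 - 2) * m)%:R * \sum_(2 <= nu < n.+1) \sum_j defect (nu, i, j) x ^+ 2.
  rewrite (le_trans (sqr_sum_le _ _)) // size_iota natrM -mulrA ler_wpM2l // mulr_sumr.
  apply: ler_sum => nu _; rewrite (le_trans (sqr_sum_le _ _)) // ler_wpM2r //.
    by apply: sumr_ge0 => j _; rewrite sqr_ge0.
  by rewrite -sum1_size sum1_card card_ord.
have s0 : 0 <= \sum_(2 <= nu < n.+1) \sum_j defect (nu, i, j) x.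
  by apply: sumr_ge0 => nu _; apply: sumr_ge0 => j _; exact: normc_ge0.
apply: (@le_trans _ _ ((G * \sum_(2 <= nu < n.+1) \sum_j defect (nu, i, j) x) ^+ 2)).
  by rewrite ler_pXn2r ?nnegrE ?normc_ge0 // mulr_ge0.
by rewrite exprMn -mulrA ler_wpM2l ?sqr_ge0.
Qed.

Lemma cmeas_defect u : (2 <= u.1.1 <= n)%N ->
  cmeas J (fun x => entry P u x - laurent (f u).1 (f u).2 x).
Proof. by move=> un; apply: cmeasB; [exact: (entry_cmeas P_pt)|exact: cmeas_laurent]. Qed.

Lemma cmeas_approximation_error i : cmeas J (approximation_error i).
Proof.
apply: cmeas_sum => l; apply: cmeasM; first by apply: cmeas_derive => x; exact: is_cderive_ee.
rewrite (_ : (fun x => _) = (fun x => \sum_(nu <- index_iota 2 n.+1) \sum_j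
    (if (2 <= nu <= n)%N then entry P (nu, i, j) x - laurent (f (nu, i, j)).1 (f (nu, i, j)).2 x else 0)
     * ((ka l ^+ (n - nu))%:C * (c l j ord0)%:C))).
  apply: cmeas_sum => nu; apply: cmeas_sum => j; apply: cmeasM; last exact: cmeasC.
  case: (boolP (2 <= nu <= n)%N) => nun; last exact: cmeasC.
  exact: (cmeas_defect (u := (nu, i, j))).
apply/funext => x; apply: eq_big_nat => nu nun; apply: eq_bigr => j _.
by rewrite (nun : (2 <= nu <= n)%N).
Qed.

Lemma approximation_error_integral i : 0 <= e ->
  (\int[mu]_(x in J) (normc (approximation_error i x) ^+ 2)%:E
   <= (G ^+ 2 * ((n.+1 - 2) * m)%:R ^+ 2 * e)%:E)%E.
Proof.
move=> e0; have K0 : 0 <= G ^+ 2 * ((n.+1 - 2) * m)%:R by rewrite mulr_ge0 ?sqr_ge0.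
pose H nu j x : R := if (2 <= nu <= n)%N then defect (nu, i, j) x ^+ 2 else 0.
have H0 nu j x : 0 <= H nu j x by rewrite /H; case: ifP => // _; rewrite sqr_ge0.
have mH nu j : measurable_fun J (H nu j).
  rewrite /H; case: (boolP (2 <= nu <= n)%N) => nun; last exact: measurable_cst.
  by apply: measurable_normc_sqr; exact: (cmeas_defect (u := (nu, i, j))).
have HE x : \sum_(2 <= nu < n.+1) \sum_j defect (nu, i, j) x ^+ 2
    = \sum_(nu <- index_iota 2 n.+1) \sum_j H nu j x.
  by apply: eq_big_nat => nu nun; apply: eq_bigr => j _; rewrite /H (nun : (2 <= nu <= n)%N).
have mS : measurable_fun J (fun x => \sum_(nu <- index_iota 2 n.+1) \sum_j H nu j x).
  by apply: measurable_sum => nu; exact: measurable_sum.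
have S0 x : 0 <= \sum_(nu <- index_iota 2 n.+1) \sum_j H nu j x.
  by apply: sumr_ge0 => nu _; exact: sumr_ge0.
have hS : (\int[mu]_(x in J) (\sum_(nu <- index_iota 2 n.+1) \sum_j H nu j x)%:E
    <= (((n.+1 - 2) * m)%:R * e)%:E)%E.
  have -> : ((n.+1 - 2) * m)%:R * e = \sum_(nu <- index_iota 2 n.+1) \sum_(j < m) e.
    rewrite [RHS]sumr_const_nat sumr_const card_ord -mulrnA mulnC.
    by rewrite [RHS](esym (mulr_natl _ _)).
  apply: int_sum_le => [nu|nu x|nu]; [exact: measurable_sum|exact: sumr_ge0|].
  apply: int_sum_le => // j; rewrite /H; case: (boolP (2 <= nu <= n)%N) => nun.
    exact: (fe (u := (nu, i, j))).
  by rewrite integral0 lee_fin.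
apply: (@le_trans _ _ (\int[mu]_(x in J) (G ^+ 2 * ((n.+1 - 2) * m)%:R *
    \sum_(nu <- index_iota 2 n.+1) \sum_j H nu j x)%:E)%E).
  apply: int_le => //.
  - by apply: measurable_normc_sqr; exact: cmeas_approximation_error.
  - by apply: measurable_funM => //; exact: measurable_cst.
  - by move=> x _; rewrite sqr_ge0.
  - by move=> x _; rewrite -HE; exact: approximation_error_bound.
under eq_integral do rewrite EFinM.
rewrite ge0_integralZl_EFin //; last 2 first.
- by move=> x _; rewrite lee_fin.
- exact/measurable_EFinP.
have -> : G ^+ 2 * ((n.+1 - 2) * m)%:R ^+ 2 * e
   = G ^+ 2 * ((n.+1 - 2) * m)%:R * (((n.+1 - 2) * m)%:R * e) by rewrite expr2 !mulrA.
by rewrite [leRHS]EFinM lee_wpmul2l // lee_fin.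
Qed.

End GalerkinResidual.

Section ApproximateSolutions.
Context {R : realType} {n m : nat}.
Variable (P : nat -> R -> 'M[R[i]]_m).
Hypothesis P_pt : forall k, (2 <= k <= n)%N ->
  forall i j : 'I_m, PT_periodic_L2 (fun x => P k x i j).
Hypothesis n_gt2 : (2 < n)%N.
Hypothesis n_even : ~~ odd n.
Local Notation mu := (@lebesgue_measure R).
Local Notation normc := (@ComplexField.Normc.normc R).
Local Notation J := (`[0%R, 1%R]%classic : set R).

Lemma coefs_zero (f : nat * 'I_m * 'I_m -> nat * {poly R}) (D : nat) z :
  (forall u, (2 <= u.1.1 <= n)%N -> ((f u).1 + size (f u).2 <= D)%N) -> (D <= `|z|)%N ->
  coef_size n (coefs f) z = 0.
Proof.
move=> fD Dz; rewrite /coef_size big_nat_cond big1 // => nu /andP[nun _].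
have -> : coefs f nu z = 0; last exact: n10.
apply/matrixP => i j; rewrite !mxE; apply/eqP; apply: contraT => /lcoef_support [k ks zk].
have := fD (nu, i, j) nun; move: ks zk; move: (f _).1 (size _) => d0 s1 ks zk h.
by clear -ks zk h Dz; lia.
Qed.

Section OneWindow.
Variables (f : nat * 'I_m * 'I_m -> nat * {poly R}) (D L N N0 : nat) (t r : R).
Variables (C : 'M[R]_m) (B eta : R) (c : 'I_(L.*2.+1) -> 'cV[R]_m).
Hypothesis f_degree : forall u, (2 <= u.1.1 <= n)%N -> ((f u).1 + size (f u).2 <= D)%N.
Hypothesis f_good : good_coefs n C B eta N0 (coefs f).
Hypothesis ctr : center_ok r N.
Hypothesis small : tau n B r <= 2^-1.
Hypothesis tr : `|t - r| <= 1.
Hypothesis L_large : (2 * (D + N) + 2 <= L)%N.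
Hypothesis c_sol : galerkin_solution n (coefs f) r t c.
Local Notation G := (mass (fun k => weight n r (mode k)) c).

Let NL : (N <= L)%N. Proof. by clear -L_large; lia. Qed.
Let L0 : 0 < L%:R :> R. Proof. by rewrite ltr0n; clear -L_large; lia. Qed.
Let r0 : 0 <= r. Proof. by have [r10 _ _] := ctr; rewrite (le_trans _ r10). Qed.
Let B0 : 0 <= B. Proof. exact: le_trans (coef_size_ge0 n (coefs f) 0) (good_size f_good 0). Qed.
Let w0 z : 0 <= weight n r z. Proof. by rewrite exprn_ge0 // !addr_ge0. Qed.
Let G0 : 0 <= G. Proof. by apply: sumr_ge0 => l _; rewrite mulr_ge0 ?n1_ge0. Qed.

(** The modes within D of the edge are at distance at least L / 2 from both resonant modes,
    so that z (z + N) is of order L ^ 2. *)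
Lemma edge_component (l : 'I_(L.*2.+1)) : (L < `|mode l|%N + D)%N ->
  weight n r (mode l) * n1 (c l) <= 4 ^+ n.+1 * B * G / L%:R ^+ 2.
Proof.
move=> lL; have [_ off] := galerkin_mass n_even n_gt2 f_good ctr NL tr small c_sol.
have l0 : l != mode_ix L 0.
  by apply: contraTneq lL => ->; rewrite mode_ixE //; clear -L_large; lia.
have lN : l != mode_ix L N.
  by apply: contraTneq lL => ->; rewrite mode_ixE //; clear -L_large; lia.
apply: (le_trans (off l l0 lN)).
have big : L%:R ^+ 2 <= 4 * `|(mode l)%:~R * (mode l + N%:Z)%:~R| :> R.
  rewrite normrM -!intr_norm -!abszE -!pmulrn -!natrM -natrX ler_nat.
  have h1 : (L <= 2 * `|mode l|)%N by clear -lL L_large; lia.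
  have h2 : (L <= 2 * `|(mode l + N%:Z)%R|)%N by clear -lL L_large; lia.
  by rewrite expnS expn1; have := leq_mul h1 h2; clear; nia.
have BG : 0 <= B * G by rewrite mulr_ge0.
have L2 : 0 < L%:R ^+ 2 :> R by rewrite exprn_gt0.
have X0 : 0 < `|(mode l)%:~R * (mode l + N%:Z)%:~R| :> R by lra.
have -> : 4 ^+ n.+1 * B * G / L%:R ^+ 2 = 4 ^+ n.+1 / L%:R ^+ 2 * (B * G) by ring.
rewrite ler_wpM2r // /res_weight ler_pdivrMr // mulrAC.
by rewrite ler_pdivlMr // [4 ^+ n.+1]exprSr -mulrA ler_wpM2l ?exprn_ge0.
Qed.

(** At most 2 L + 1 components contribute, each of order 1 / L ^ 2. The resulting bound is
    small enough for the sum of its squares over the window to tend to 0 as L grows. *)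
Lemma spill_bound z : (L < `|z|)%N ->
  n1 (spill (n := n) f t c z) <= 3 * 4 ^+ n.+1 * B ^+ 2 * G / L%:R.
Proof.
move=> zL; rewrite (le_trans (n1_sum _ _ _)) //.
set X := 4 ^+ n.+1 * B * G / L%:R ^+ 2.
have X0 : 0 <= X by rewrite divr_ge0 ?sqr_ge0 // !mulr_ge0 ?exprn_ge0.
have each (l : 'I_(L.*2.+1)) : n1 (coupling n (coefs f) t z (mode l) *m c l) <= B * X.
  rewrite (le_trans (n1M _ _)) //.
  apply: (@le_trans _ _ (coef_size n (coefs f) (z - mode l) * (weight n r (mode l) * n1 (c l)))).
    by rewrite mulrA ler_wpM2r ?n1_ge0 // coupling_bound.
  have [Dz|Dz] := leqP D `|(z - mode l)%R|.
    by rewrite (coefs_zero f_degree Dz) mul0r mulr_ge0.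
  apply: ler_pM; rewrite ?coef_size_ge0 ?mulr_ge0 ?n1_ge0 ?(good_size f_good) //.
  by apply: edge_component; clear -Dz zL; lia.
apply: (le_trans (ler_sum _ (fun l _ => each l))); rewrite sumr_const card_ord -[leLHS]mulr_natl.
have L3 : L.*2.+1%:R <= 3 * L%:R :> R by rewrite -natrM ler_nat; clear -L_large; lia.
apply: (@le_trans _ _ (3 * L%:R * (B * X))); first by rewrite ler_wpM2r // mulr_ge0.
rewrite le_eqVlt; apply/orP; left; apply/eqP; rewrite /X; field; exact: lt0r_neq0.
Qed.

(** The mass is controlled by the two resonant components, and these by the energy of the
    whole sum. *)
Lemma resonant_part : (0 < m)%N -> (exists k, c k != 0) ->
  0 < G /\ G ^+ 2 <= 2 * m%:R * (2 * (4 ^+ n * r ^+ (n - 2))) ^+ 2 *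
    \sum_i \sum_k c k i ord0 ^+ 2.
Proof.
move=> m0 [k ck].
have [Gle _] := galerkin_mass n_even n_gt2 f_good ctr NL tr small c_sol.
have [r10 _ r8] := ctr; have rp : 0 < r by lra.
split.
  rewrite /mass (bigD1 k) //= ltr_wpDr ?sumr_ge0 // => [l _|].
    by rewrite mulr_ge0 ?n1_ge0.
  rewrite mulr_gt0 //; first by rewrite exprn_gt0 // ltr_wpDl // addr_ge0.
  rewrite lt0r n1_ge0 andbT; apply: contraNneq ck => /n1_eq0 ->; exact: eqxx.
have N0' : (0 < N)%N.
  by rewrite lt0n; apply: contraTneq r8 => ->; rewrite mulr0 -ltNge.
have diff : mode_ix L 0 != mode_ix L N by apply: mode_ix_neq; rewrite N0'.
set K := 2 * _ in Gle *; set S := \sum_i _.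
set a := n1 (c (mode_ix L 0)) in Gle *; set b := n1 (c (mode_ix L N)) in Gle *.
have a0 : 0 <= a by exact: n1_ge0.
have b0 : 0 <= b by exact: n1_ge0.
have K0 : 0 <= K by rewrite mulr_ge0 // mulr_ge0 ?exprn_ge0.
have sq (l : 'I_(L.*2.+1)) : n1 (c l) ^+ 2 <= m%:R * \sum_i c l i ord0 ^+ 2.
  have := n1_sqr_le (c l); rewrite muln1; congr (_ <= _ * _).
  by apply: eq_bigr => i _; rewrite big_ord1.
have abS : a ^+ 2 + b ^+ 2 <= m%:R * S.
  rewrite (le_trans (lerD (sq _) (sq _))) // -mulrDr ler_wpM2l // /S exchange_big /=.
  rewrite (bigD1 (mode_ix L 0)) //= (bigD1 (mode_ix L N)) 1?eq_sym //= addrA lerDl.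
  by apply: sumr_ge0 => l _; apply: sumr_ge0 => i _; rewrite sqr_ge0.
apply: (@le_trans _ _ ((K * (a + b)) ^+ 2)).
  by rewrite ler_pXn2r // nnegrE mulr_ge0 // addr_ge0.
have -> : 2 * m%:R * K ^+ 2 * S = K ^+ 2 * (2 * (m%:R * S)) by ring.
rewrite exprMn ler_wpM2l ?sqr_ge0 //; have := sqr_ge0 (a - b); lra.
Qed.

Lemma residual_small (e : R) : approximates (n := n) P e f -> 0 <= e ->
  (\int[mu]_(x in J) (\sum_i normc (residual n (@mode L) t c P (r ^+ n) i x) ^+ 2)%:E
   <= (m%:R * (10 * (3 * 4 ^+ n.+1 * B ^+ 2) ^+ 2 / L%:R
        + 2 * (((n.+1 - 2) * m)%:R ^+ 2 * e)) * G ^+ 2)%:E)%E.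
Proof.
move=> fe e0; set Kb := 3 * 4 ^+ n.+1 * B ^+ 2; set K := ((n.+1 - 2) * m)%:R.
pose W := (L + D)%N.
pose g (i : 'I_m) (k : 'I_(W.*2.+1)) : R := if (`|mode k| <= L)%N then 0 else spill (n := n) f t c (mode k) i ord0.
pose main i x : R[i] := \sum_(k < W.*2.+1) (g i k)%:C * ee (freq t (mode k)) x.
have mmain i : cmeas J (main i).
  apply: cmeas_sum => k; apply: cmeasM; first exact: cmeasC.
  by apply: cmeas_derive => x; exact: is_cderive_ee.
have mJ : measurable J by exact: measurable_itv.
have mainE i : (\int[mu]_(x in J) (normc (main i x) ^+ 2)%:E <= (5 * Kb ^+ 2 * G ^+ 2 / L%:R)%:E)%E.
  rewrite (parseval (g i) t (@mode_inj W)) lee_fin.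
  have each k : g i k ^+ 2 <= (Kb * G / L%:R) ^+ 2.
    have q0 : 0 <= Kb * G / L%:R.
      by rewrite divr_ge0 ?(ltW L0) // mulr_ge0 // !mulr_ge0 ?exprn_ge0 // sqr_ge0.
    rewrite /g; case: leqP => kL; first by rewrite expr0n sqr_ge0.
    rewrite -real_normK ?num_real // ler_pXn2r ?nnegrE //.
    by rewrite (le_trans (n1_entry _ _ _)) // spill_bound.
  apply: (le_trans (ler_sum _ (fun k _ => each k))); rewrite sumr_const card_ord -[leLHS]mulr_natl.
  have W5 : W.*2.+1%:R <= 5 * L%:R :> R by rewrite -natrM ler_nat /W; clear -L_large; lia.
  apply: (le_trans (ler_wpM2r (sqr_ge0 _) W5)).
  by rewrite le_eqVlt; apply/orP; left; apply/eqP; field; exact: lt0r_neq0.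
have each i : (\int[mu]_(x in J) (normc (residual n (@mode L) t c P (r ^+ n) i x) ^+ 2)%:E
   <= (2 * (5 * Kb ^+ 2 * G ^+ 2 / L%:R) + 2 * (G ^+ 2 * K ^+ 2 * e))%:E)%E.
  under eq_integral do rewrite (residual_split P f_degree c_sol).
  apply: (L2_triangle mJ (mmain i) _ (mainE i)).
    exact: (cmeas_approximation_error P_pt).
  exact: (approximation_error_integral P_pt c fe r0 tr).
have mres i : measurable_fun J (fun x => normc (residual n (@mode L) t c P (r ^+ n) i x) ^+ 2).
  by apply: measurable_normc_sqr; exact: (cmeas_residual_cell P_pt).
apply: (le_trans (int_sum_le _ mres (fun i x => sqr_ge0 _) each)).
rewrite sumr_const card_ord lee_fin -mulr_natl le_eqVlt; apply/orP; left; apply/eqP.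
by field; exact: lt0r_neq0.
Qed.

End OneWindow.
End ApproximateSolutions.

(** * Large numbers in the spectrum *)

Section Conclusion.
Context {R : realType} {n m : nat}.
Variable (P : nat -> R -> 'M[R[i]]_m).
Hypothesis P_pt : forall k, (2 <= k <= n)%N ->
  forall i j : 'I_m, PT_periodic_L2 (fun x => P k x i j).
Hypothesis n_gt2 : (2 < n)%N.
Hypothesis n_even : ~~ odd n.
Hypothesis m_gt0 : (0 < m)%N.
Local Notation mu := (@lebesgue_measure R).
Local Notation normc := (@ComplexField.Normc.normc R).
Local Notation J := (`[0%R, 1%R]%classic : set R).

Lemma degree_bound (f : nat * 'I_m * 'I_m -> nat * {poly R}) :
  exists D, forall u, (2 <= u.1.1 <= n)%N -> ((f u).1 + size (f u).2 <= D)%N.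
Proof.
exists (\sum_(nu < n.+1) \sum_i \sum_j ((f (nat_of_ord nu, i, j)).1 + size (f (nat_of_ord nu, i, j)).2))%N.
move=> [[nu i] j] /= /andP[_ nun].
by rewrite (bigD1 (Ordinal (nun : (nu < n.+1)%N))) //= (bigD1 i) //= (bigD1 j) //= -!addnA addnA leq_addr.
Qed.

(** The accuracy s of the approximation is fixed first, in terms of r and of the required
    relative error; the approximants have some degree D, and the window L is taken large
    with respect to it. *)
Lemma spectrum_near_resonance (C : 'M[R]_m) (B eta s0 r : R) (N0 N : nat) : 0 < s0 ->
  (forall s f, 0 < s <= s0 -> approximates (n := n) P (s ^+ 2) f -> good_coefs n C B eta N0 (coefs f)) ->
  center_ok r N -> tau n B r <= 2^-1 ->
  (forall a, good_coefs n C B eta N0 a -> forall L, (N <= L)%N ->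
    exists t (c : 'I_(L.*2.+1) -> 'cV[R]_m),
      [/\ `|t - r| <= 1, exists k, c k != 0 & galerkin_solution n a r t c]) ->
  spectrum (operT n P) (r ^+ n)%:C.
Proof.
move=> s00 good ctr small solve.
apply: (spectrum_of_approximate_solutions (ltnW n_gt2) P_pt) => et et0.
have rp : 0 < r by have [r10 _ _] := ctr; rewrite (lt_le_trans _ r10).
pose Kb := 3 * 4 ^+ n.+1 * B ^+ 2; pose K : R := ((n.+1 - 2) * m)%:R.
pose Kg : R := 2 * m%:R * (2 * (4 ^+ n * r ^+ (n - 2))) ^+ 2.
have Kg0 : 0 <= Kg by rewrite mulr_ge0 ?sqr_ge0 // mulr_ge0.
pose Q1 := m%:R * (10 * Kb ^+ 2) * Kg; pose Q2 := m%:R * (2 * K ^+ 2) * Kg.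
have Q10 : 0 <= Q1 by rewrite mulr_ge0 // mulr_ge0 // mulr_ge0 // sqr_ge0.
have Q20 : 0 <= Q2 by rewrite mulr_ge0 // mulr_ge0 // mulr_ge0 // sqr_ge0.
have Q2p : 0 < 2 * Q2 + 1 by lra.
pose s := Num.min s0 (Num.min 1 (et / (2 * Q2 + 1))).
have s_gt0 : 0 < s by rewrite !lt_min s00 ltr01 divr_gt0.
have ss0 : s <= s0 by rewrite ge_min lexx.
have s1 : s <= 1 by rewrite !ge_min lexx orbT.
have sQ : s * (2 * Q2 + 1) <= et by rewrite -ler_pdivlMr // !ge_min lexx !orbT.
have s2 : 2 * (Q2 * s ^+ 2) <= et.
  have h : s ^+ 2 <= s by rewrite expr2 ler_piMl // ltW.
  have h2 : Q2 * s ^+ 2 <= Q2 * s by rewrite ler_wpM2l.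
  lra.
have [f fs] := approximates_exists P_pt (exprn_gt0 2 s_gt0).
have fgood := good s f (introT andP (conj s_gt0 ss0)) fs.
have [D fD] := degree_bound f.
pose L := (2 * (D + N) + 2 + (Num.truncn (2 * Q1 / et)).+1)%N.
have L_large : (2 * (D + N) + 2 <= L)%N by rewrite leq_addr.
have NL : (N <= L)%N by clear -L_large; lia.
have L1 : 2 * Q1 / L%:R <= et.
  have Q1e : 0 <= 2 * Q1 / et by rewrite divr_ge0 ?(ltW et0) // mulr_ge0.
  have /andP[_ h] := truncn_itv Q1e.
  have Lp : 0 < L%:R :> R by rewrite ltr0n addn_gt0 orbT.
  rewrite ler_pdivrMr // [et * _]mulrC -ler_pdivrMr // (le_trans (ltW h)) // ler_nat.
  exact: leq_addl.
have [t [c [tr c0 csol]]] := solve _ fgood L NL.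
have [G0 GA] := resonant_part n_gt2 n_even fgood ctr small tr L_large csol m_gt0 c0.
have rsmall := residual_small P_pt n_gt2 n_even fD fgood ctr small tr L_large csol fs (sqr_ge0 s).
set G := mass _ _ in G0 GA rsmall; set A := \sum_i _ in GA.
exists L.*2.+1, (@mode L), t, c, A; split.
- have G2 : 0 < G ^+ 2 by rewrite exprn_gt0.
  have h := lt_le_trans G2 GA; rewrite -/Kg in h.
  by rewrite ltNge; apply: contraTN h => A0; rewrite -leNgt mulr_ge0_le0.
- under eq_integral do rewrite -sumEFin.
  rewrite ge0_integral_sum //; last 2 first.
  + move=> i; apply/measurable_EFinP; apply: measurable_normc_sqr; exact: cmeas_bloch.
  + by move=> i x _; rewrite lee_fin sqr_ge0.
  rewrite -sumEFin; apply: eq_bigr => i _.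
  exact: (parseval (fun k => c k i ord0) t (@mode_inj L)).
- apply: (le_trans rsmall); rewrite lee_fin -/Kb -/K.
  set V := m%:R * _; have V0 : 0 <= V.
    rewrite mulr_ge0 // addr_ge0 //; first by rewrite divr_ge0 // mulr_ge0 // sqr_ge0.
    by rewrite mulr_ge0 // mulr_ge0 // sqr_ge0.
  rewrite (le_trans (ler_wpM2l V0 GA)) // -/Kg mulrA.
  have A0 : 0 <= A by apply: sumr_ge0 => i _; apply: sumr_ge0 => k _; rewrite sqr_ge0.
  rewrite ler_wpM2r //.
  have -> : V * Kg = Q1 / L%:R + Q2 * s ^+ 2 by rewrite /V /Q1 /Q2; ring.
  have h : 2 * (Q1 / L%:R) <= et by rewrite mulrA.
  lra.
Qed.

(** The imaginary part of an entry is approximated in mean square by the imaginary part of a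
    trigonometric polynomial with real coefficients, which is a sum of sines and has mean 0.
    *)
Lemma mean_matrix_real : mean_matrix (P 2%N) = map_mx (real_complex R) (mean_coef P).
Proof.
have two : (2 <= 2 <= n)%N by exact: ltnW.
apply/matrixP => i j; rewrite !mxE.
suff -> : (\int[mu]_(x in `[0, 1]) complex.Im (P 2%N x i j))%R = 0 by [].
apply/eqP; rewrite -normr_eq0 eq_le normr_ge0 andbT; apply/ler_addgt0Pr => e e0; rewrite add0r.
have [d [q h]] := pt_approx (P_pt two i j) (exprn_gt0 2 e0).
have [_ _ [mRe mIm fin]] := P_pt two i j.
by have [] := approximant_mean (conj mRe mIm : cmeas J (fun x => P 2%N x i j)) e0 fin h.
Qed.

Lemma mup_map (p : {poly R}) (z : R) : p != 0 ->
  mup z%:C (map_poly (real_complex R) p) = mup z p.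
Proof.
move=> p0; have mp0 : map_poly (real_complex R) p != 0 by rewrite map_poly_eq0.
have h k : (k <= mup z%:C (map_poly (real_complex R) p))%N = (k <= mup z p)%N.
  rewrite !mup_geq // -[RHS](dvdp_map (real_complex R)); congr (_ %| _)%R.
  by rewrite rmorphXn /= map_polyXsubC.
by apply/eqP; rewrite eqn_leq -h leqnn h leqnn.
Qed.

Lemma nth_root_large (r0 lam : R) : 0 <= r0 -> r0 ^+ n <= lam ->
  exists2 r, r0 <= r & r ^+ n = lam.
Proof.
move=> r00 lam_large; have lam0 : 0 <= lam by rewrite (le_trans _ lam_large) // exprn_ge0.
have n0 : (0 < n)%N by rewrite (ltn_trans _ n_gt2).
have rn : (lam `^ n%:R^-1) ^+ n = lam.
  by rewrite -powR_mulrn ?powR_ge0 // -powRrM mulVf ?powRr1 // pnatr_eq0 -lt0n.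
exists (lam `^ n%:R^-1) => //; rewrite leNgt; apply/negP => h.
by move: lam_large; rewrite leNgt -[X in X < _]rn ltrXn2r ?powR_ge0 // -lt0n n0.
Qed.

End Conclusion.

Theorem theorem6 (R : realType) (n m : nat) (P : nat -> R -> 'M[R[i]]_m)
    (s : nat) (mu : 'I_s -> R) :
  (2 < n)%N -> ~~ odd n -> (1 <= m)%N ->
  (forall k, (2 <= k <= n)%N ->
     forall i j : 'I_m, PT_periodic_L2 (fun x => P k x i j)) ->
  {homo mu : i j / (i < j)%N >-> i < j} ->
  (forall z : R, eigenvalue (mean_matrix (P 2%N)) z%:C <-> exists i, mu i = z) ->
  (exists j1 j2 j3 : 'I_s,
     [/\ j1 != j2, j1 != j3 & j2 != j3] /\
     [/\ odd (alg_mult (mean_matrix (P 2%N)) (mu j1)%:C),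
         odd (alg_mult (mean_matrix (P 2%N)) (mu j2)%:C) &
         odd (alg_mult (mean_matrix (P 2%N)) (mu j3)%:C)] /\
     min_diam mu j1 j2 j3 <> 0) ->
  exists H : R, [set z%:C | z in `[H, +oo[] `<=` spectrum (operT n P).
Proof.
move=> n_gt2 n_even m_gt0 P_pt mu_mono eig [j1 [j2 [j3 [_ [[d1 d2 d3] md]]]]].
have ME := mean_matrix_real P_pt n_gt2; pose C := mean_coef P.
have charE : char_poly (mean_matrix (P 2%N)) = map_poly (real_complex R) (char_poly C).
  by rewrite ME map_char_poly.
have C0 : char_poly C != 0 by rewrite monic_neq0 // char_poly_monic.
have muI : injective mu.
  move=> i j ij; apply: val_inj; case: (ltngtP i j) => // /mu_mono; by rewrite ij ltxx.
have rootC z : root (char_poly C) z -> exists i, mu i = z.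
  move=> rz; apply/eig; rewrite eigenvalue_root_char charE.
  by rewrite -[z%:C]/(real_complex R z) fmorph_root.
have oddC j : odd (alg_mult (mean_matrix (P 2%N)) (mu j)%:C) -> odd (mup (mu j) (char_poly C)).
  by rewrite /alg_mult charE mup_map.
have B0 : 0 <= 1 + coef_energy (n := n) P by rewrite addr_ge0 // coef_energy_ge0.
have [eta eta0 solve] := galerkin_solution_exists n_even n_gt2 muI rootC (oddC _ d1) (oddC _ d2) (oddC _ d3) md B0.
have [s0 s00 [N0 good]] := good_coefs_of_approximation P_pt (ltnW n_gt2) eta0.
have [r0 r0P] := solve N0.
pose r1 := Num.max 0 r0; exists (r1 ^+ n) => _ [lam /= lamH <-].
have r10 : 0 <= r1 by rewrite le_max lexx.
have [|r rr <-] := @nth_root_large R n n_gt2 r1 lam r10.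
  by move: lamH; rewrite in_itv /= andbT.
have [|N [ctr small sol]] := r0P r; first by rewrite (le_trans _ rr) // le_max lexx orbT.
exact: (spectrum_near_resonance P_pt n_gt2 n_even m_gt0 s00 good ctr small sol).
Qed.
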